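(* Let $(V,\Upsilon(z),c,\rho)$ be a graded vertex operator coalgebra with $V_0\not\subseteq\ker c$ and $V_2\not\subseteq\ker\rho$, and let $g\in\mathrm{Aut}\,V$ be an automorphism of finite order $T$. Let $V'$ be the dual vertex operator algebra, and assume that the higher level twisted Zhu algebras satisfy $\dim A_{k,g}(V')<\infty$ for all $k\in\frac1T\mathbb N$. Then $V$ is $g$-corational if and only if $V'$ is a $g$-rational vertex operator algebra.
   Context: All vector spaces are over $\mathbb C$; $\mathbb N=\{0,1,2,\dots\}$; $\tau(v\otimes w)=w\otimes v$; $(z_1+z_2)^n$ is expanded in nonnegative powers of $z_2$; $\delta(x)=\sum_{n\in\mathbb Z}x^n$; $\mathrm{Res}_z$ is the coefficient of $z^{-1}$. Graded vertex operator coalgebra $(V,\Upsilon(z),c,\rho)$: $V=\bigoplus_{s\in\mathbb Z}V_s$, $\dim V_s<\infty$, $V_s=0$ for $s\ll0$; linear maps $c,\rho:V\to\mathbb C$ and $\Upsilon(z):V\to(V\otimes V)[[z,z^{-1}]]$, $\Upsilon(z)v=\sum_{k\in\mathbb Z}\Delta_k(v)z^{-k-1}$, with: (1) $\Delta_k(v)=0$ for $k\ll0$ and $\Delta_k(V_s)\subseteq(V\otimes V)_{s+k+1}$; (2) $(c\otimes\mathrm{Id})\Upsilon(z)v=v$, $(\mathrm{Id}\otimes c)\Upsilon(z)v\in V[[z]]$ with constant term $v$; (3) Jacobi identity $z_0^{-1}\delta(\frac{z_1-z_2}{z_0})(\mathrm{Id}\otimes\Upsilon(z_2))\Upsilon(z_1)-z_0^{-1}\delta(\frac{z_2-z_1}{-z_0})(\tau\otimes\mathrm{Id})(\mathrm{Id}\otimes\Upsilon(z_1))\Upsilon(z_2)=z_1^{-1}\delta(\frac{z_2+z_0}{z_1})(\Upsilon(z_0)\otimes\mathrm{Id})\Upsilon(z_2)$;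 (4) writing $(\rho\otimes\mathrm{Id})\Upsilon(z)=\sum_kL(k)z^{k-2}$, the operators $L(k)\in\mathrm{End}(V)$ satisfy $[L(k),L(j)]=(k-j)L(k+j)+\frac{k^3-k}{12}\delta_{k+j,0}d$ for a constant $d$, $V_s$ is the $s$-eigenspace of $L(0)$, and $(L(1)\otimes\mathrm{Id})\Upsilon(z)=\frac{d}{dz}\Upsilon(z)$. Automorphisms: linear bijections $g:V\to V$ with $c\circ g=c$, $\rho\circ g=\rho$, $\Upsilon(z)g=(g\otimes g)\Upsilon(z)$. For $g$ of order $T$: $V^{(r)}=\{v: gv=e^{2\pi ir/T}v\}$, $0\le r\le T-1$. $\frac{\ln g}{2\pi i}$ acts on $V^{(r)}$ as $\frac rT$; $z^\phi v=z^\lambda v$ if $\phi v=\lambda v$. Weak $g$-twisted $V$-comodule: a vector space $\mathcal M$ with a linear map $\Upsilon_{\mathcal M}(z)m=\sum_{k\in\mathbb Z}(z^{-\frac{\ln g}{2\pi i}}\otimes\mathrm{Id})\Delta_{\mathcal M,k}(m)z^{-k-1}$, $\Delta_{\mathcal M,k}:\mathcal M\to V\otimes\mathcal M$, with: (i) $\Delta_{\mathcal M,k}(m)=0$ for $k\ll0$, $(c\otimes\mathrm{Id})\Upsilon_{\mathcal M}(z)=\mathrm{Id}$; (ii) $z_0^{-1}\delta(\frac{z_1-z_2}{z_0})(\mathrm{Id}\otimes\Upsilon_{\mathcal M}(z_2))\Upsilon_{\mathcal M}(z_1)-z_0^{-1}\delta(\frac{z_2-z_1}{-z_0})(\tau\otimes\mathrm{Id})(\mathrm{Id}\otimes\Upsilon_{\mathcal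 M}(z_1))\Upsilon_{\mathcal M}(z_2)=z_2^{-1}\delta(\frac{z_1-z_0}{z_2})((\frac{z_1-z_0}{z_2})^{-\frac{\ln g}{2\pi i}}\otimes\mathrm{Id}\otimes\mathrm{Id})(\Upsilon(z_0)\otimes\mathrm{Id})\Upsilon_{\mathcal M}(z_2)$; (iii) writing $(\rho\otimes\mathrm{Id})\Upsilon_{\mathcal M}(z)=\sum_kL(k)z^{k-2}$, $L(k)\in\mathrm{End}(\mathcal M)$ satisfy the same Virasoro relations; (iv) $(L(1)\otimes\mathrm{Id})\Upsilon_{\mathcal M}(z)=\frac d{dz}\Upsilon_{\mathcal M}(z)=\Upsilon_{\mathcal M}(z)L(1)-(\mathrm{Id}\otimes L(1))\Upsilon_{\mathcal M}(z)$. It is admissible if $\mathcal M=\bigoplus_{t\in\frac1T\mathbb N}M_t$ with $\Delta_{\mathcal M,k}(M_t)\subseteq\bigoplus_{r=0}^{T-1}(V^{(r)}\otimes\mathcal M)_{t+k+1+\frac rT}$. Admissible subcomodules are graded subspaces $\mathcal N$ with $\Delta_{\mathcal M,k}(\mathcal N)\subseteq V\otimes\mathcal N$; $\mathcal M$ is irreducible if it has no nontrivial one, completely reducible if it is a direct sum of irreducible ones. $V$ is $g$-corational if every admissible $g$-twisted $V$-comodule is completely reducible. Dual: $V'=\bigoplus_sV_s^*$ is a vertex operator algebra with $\mathbf 1=c|_{V_0}$, $\omega=\rho|_{V_2}$, $(Y(u^*,z)v^*,v)=(u^*\otimes v^*,\Upsilon(z)v)$; $g$ acts on $V'$ as an automorphism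 of order $T$ by $(g(v^* ),v)=(v^*,g^{-1}(v))$. Twisted modules: for a vertex operator algebra $\mathcal V$ and $h\in\mathrm{Aut}\,\mathcal V$ of order $T$, $\mathcal V^{(r)}=\{v:hv=e^{2\pi ir/T}v\}$. A weak $h$-twisted $\mathcal V$-module is a vector space $\mathcal N$ with $Y_{\mathcal N}(u,z)=\sum_{t\in\mathbb Z+r/T}u_tz^{-t-1}$ ($u\in\mathcal V^{(r)}$, $u_t\in\mathrm{End}\,\mathcal N$), $u_tn=0$ for $t\gg0$, $Y_{\mathcal N}(\mathbf 1,z)=\mathrm{Id}$, and for $u\in\mathcal V^{(r)},v\in\mathcal V$: $z_0^{-1}\delta(\frac{z_1-z_2}{z_0})Y_{\mathcal N}(u,z_1)Y_{\mathcal N}(v,z_2)-z_0^{-1}\delta(\frac{-z_2+z_1}{z_0})Y_{\mathcal N}(v,z_2)Y_{\mathcal N}(u,z_1)=z_2^{-1}\delta(\frac{z_1-z_0}{z_2})(\frac{z_1-z_0}{z_2})^{-r/T}Y_{\mathcal N}(Y(u,z_0)v,z_2)$. It is admissible if $\mathcal N=\bigoplus_{t\in\frac1T\mathbb N}N_t$ with $a_sN_t\subseteq N_{\mathrm{wt}\,a+t-s-1}$ for homogeneous $a$. $\mathcal V$ is $h$-rational if every admissible $h$-twisted module is a direct sum of irreducible admissible $h$-twisted submodules. Higher level twisted Zhu algebra (Dong–Li–Mason): for $h\in\mathrm{Aut}\,\mathcal V$ of order $T$ and $k=l+\frac iT$ with $l\in\mathbb N$, $0\le i\le T-1$, put for $0\le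 r\le T-1$: $\delta_i(r)=1$ if $i\ge r$, $\delta_i(r)=0$ if $i<r$, and $\delta_i(T)=0$. $O_{k,h}(\mathcal V)$ is the span of all $L(-1)u+L(0)u$ ($u\in\mathcal V$) and all $\mathrm{Res}_z\frac{(1+z)^{\mathrm{wt}\,u-1+\delta_i(r)+l+r/T}}{z^{2l+\delta_i(r)+\delta_i(T-r)+1}}Y(u,z)v$ with $u\in\mathcal V^{(r)}$ homogeneous, $v\in\mathcal V$; $A_{k,h}(\mathcal V)=\mathcal V/O_{k,h}(\mathcal V)$. *)

(* Defs.v *)
From HB Require Import structures.
From mathcomp Require Import all_boot all_order all_algebra.
From mathcomp Require Import generic_quotient complex ring.
From mathcomp Require Import finmap boolp classical_sets functions cardinality fsbigop.
From mathcomp Require Import reals trigo.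

Set Implicit Arguments.
Unset Strict Implicit.
Unset Printing Implicit Defensive.

Import Order.TTheory GRing.Theory Num.Theory.
Local Open Scope quotient_scope.
Local Open Scope classical_set_scope.
Local Open Scope ring_scope.

Section Subspaces.
Variables (K : fieldType) (V : lmodType K).

Definition is_subspace (S : set V) : Prop :=
  S 0 /\ forall (a : K) u v, S u -> S v -> S (a *: u + v).

Definition span (A : set V) : set V :=
  [set v | exists n (a : 'I_n -> K) (x : 'I_n -> V),
     (forall i, A (x i)) /\ v = \sum_(i < n) a i *: x i].

Definition finite_dim (S : set V) : Prop :=
  exists s : seq V, S `<=` span [set` s].

(* dim (V / S) < oo *)
Definition finite_codim (S : set V) : Prop :=
  exists s : seq V, forall v, exists2 x, span [set` s] x & S (v - x).

Definition decomposition (I : choiceType) (S : I -> set V) (v : V)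
    (f : I -> V) : Prop :=
  [/\ forall i, S i (f i), finite_set [set i | f i != 0]
    & \sum_(i \in [set: I]) f i = v].

(* V is the internal direct sum of the family S *)
Definition direct_sum (I : choiceType) (S : I -> set V) : Prop :=
  (forall i, is_subspace (S i)) /\
  (forall v, exists! f : I -> V, decomposition S v f).

(* i-th component of v with respect to a direct sum decomposition of V *)
Definition component (I : choiceType) (S : I -> set V) (i : I) (v : V) : V :=
  xget 0 [set w | exists2 f, decomposition S v f & w = f i].

Definition graded_subspace (I : choiceType) (gr : I -> set V) (S : set V) :
    Prop :=
  is_subspace S /\ S `<=` span (\bigcup_i (S `&` gr i)).

(* In the next two definitions sub is a predicate selecting the subobjects
   of V, for a given additional structure on V. *)
Definition irreducible_sub (sub : set V -> Prop) (S : set V) : Prop :=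
  [/\ sub S, S != [set 0] &
      forall S', sub S' -> S' `<=` S -> S' = [set 0] \/ S' = S].

Definition completely_reducible (sub : set V -> Prop) : Prop :=
  exists (I : choiceType) (S : I -> set V),
    direct_sum S /\ forall i, irreducible_sub sub (S i).

Lemma direct_sum_component (I : choiceType) (S : I -> set V) :
  direct_sum S -> forall v, decomposition S v (component S ^~ v).
Proof.
move=> [_ H] v; have [f [df uf]] := H v.
suff -> : component S ^~ v = f by [].
apply/funext => i; rewrite /component.
case: xgetP => [x _ [h dh ->]|/(_ (f i))]; first by rewrite (uf h dh).
by move=> nf; exfalso; apply: nf; exists f.
Qed.

Lemma component_linear (I : choiceType) (S : I -> set V) (i : I) :
  direct_sum S -> linear (component S i).
Proof.
move=> dS a u v; have [sS H] := dS.
have [pu fu su] := direct_sum_component dS u.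
have [pv fv sv] := direct_sum_component dS v.
have [f [df uf]] := H (a *: u + v).
have e1 := uf _ (direct_sum_component dS (a *: u + v)).
suff e2 : f = (fun j => a *: component S j u + component S j v).
  by have /= <- := congr1 (@^~ i) e1; rewrite e2.
have fS : finite_set ([set j | component S j u != 0] `|`
                      [set j | component S j v != 0]) by rewrite finite_setU.
pose X := fset_set ([set j | component S j u != 0] `|`
                    [set j | component S j v != 0]).
have XP j : j \notin X -> component S j u = 0 /\ component S j v = 0.
  rewrite /X in_fset_set // => /negP nX; split; apply/eqP/negPn/negP => h;
    apply: nX; apply/mem_set; by [left | right].
apply: uf; split.
- by move=> j; exact: (sS j).2.
- apply: (sub_finite_set _ fS) => j /= h.
  apply: contrapT => /not_orP[/negP/negPn/eqP hu /negP/negPn/eqP hv].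
  by move: h; rewrite hu hv scaler0 addr0 eqxx.
- rewrite (fsbigTE X); last first.
    by move=> j /XP[-> ->]; rewrite scaler0 addr0.
  rewrite big_split /= -scaler_sumr.
  have su' : \sum_(i <- X) component S i u = u.
    by rewrite -[RHS]su (fsbigTE X) // => j /XP[].
  have sv' : \sum_(i <- X) component S i v = v.
    by rewrite -[RHS]sv (fsbigTE X) // => j /XP[].
  by rewrite su' sv'.
Qed.

Lemma component_out (I : choiceType) (S : I -> set V) (i j : I) (v : V) :
  direct_sum S -> S j v -> i != j -> component S i v = 0.
Proof.
move=> dS Sv ij; have [sS H] := dS.
have [f [df uf]] := H v.
have /= <- := congr1 (@^~ i) (uf _ (direct_sum_component dS v)).
suff -> : f = (fun k => if k == j then v else 0) by rewrite (negbTE ij).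
apply: uf; split.
- by move=> k; case: eqP => [->//|_]; exact: (sS k).1.
- apply: (sub_finite_set _ (finite_set1 j)) => k /=.
  by case: (k =P j) => // _; rewrite eqxx.
- rewrite (fsbigTE [fset j]%fset) ?big_seq_fset1 ?eqxx // => k.
  by rewrite inE => /negbTE ->.
Qed.

End Subspaces.

Section Tensor.
Variable K : fieldType.

Definition bilinear_fun (V W U : lmodType K) (f : V -> W -> U) : Prop :=
  (forall w, linear (f^~ w)) /\ (forall v, linear (f v)).

Section TensorDef.
Variables V W : lmodType K.

Definition formal_sum (U : lmodType K) (f : V -> W -> U) (s : seq (V * W)) : U :=
  \sum_(p <- s) f p.1 p.2.

(* Two formal sums of pure tensors are identified when every bilinear map
   takes the same value on them. *)
Definition tensor_rel (s t : seq (V * W)) : bool :=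
  `[< forall (U : lmodType K) (f : V -> W -> U),
        bilinear_fun f -> formal_sum f s = formal_sum f t >].

Lemma tensor_rel_equiv : equiv_class_of tensor_rel.
Proof.
split.
- by move=> s; apply/asboolP.
- by move=> s t; apply/asbool_equiv_eq; split=> h U f bf; rewrite h.
- move=> t s u /asboolP h1 /asboolP h2; apply/asboolP => U f bf.
  by rewrite h1 // h2.
Qed.

Canonical tensor_equiv : equiv_rel (seq (V * W)) :=
  EquivRelPack tensor_rel_equiv.

Definition tensor : Type := {eq_quot tensor_equiv}.
HB.instance Definition _ := Choice.on tensor.
HB.instance Definition _ := EqQuotient.on tensor.

Definition tlift (U : lmodType K) (f : V -> W -> U) (x : tensor) : U :=
  formal_sum f (repr x).

Definition ptens (v : V) (w : W) : tensor := \pi_tensor [:: (v, w)].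

Lemma tlift_pi (U : lmodType K) (f : V -> W -> U) s : bilinear_fun f ->
  tlift f (\pi_tensor s) = formal_sum f s.
Proof.
move=> bf; rewrite /tlift.
have : tensor_rel (repr (\pi_tensor s)) s.
  by rewrite -[tensor_rel _ _]/(tensor_equiv _ _) -eqmodE reprK.
by move=> /asboolP; exact.
Qed.

Lemma tensor_ext (x y : tensor) :
  (forall (U : lmodType K) (f : V -> W -> U), bilinear_fun f ->
     tlift f x = tlift f y) -> x = y.
Proof.
move=> h; rewrite -[x]reprK -[y]reprK; apply/eqP.
by rewrite eqmodE; apply/asboolP.
Qed.

Definition tensor_zero : tensor := \pi_tensor [::].
Definition tensor_add (x y : tensor) : tensor :=
  \pi_tensor (repr x ++ repr y).
Definition tensor_scale (a : K) (x : tensor) : tensor :=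
  \pi_tensor [seq (a *: p.1, p.2) | p <- repr x].

Lemma bilinearZl (U : lmodType K) (f : V -> W -> U) a v w :
  bilinear_fun f -> f (a *: v) w = a *: f v w.
Proof.
move=> [fl _]; pose h := GRing.isLinear.Build _ _ _ _ _ (fl w).
pose g : {linear V -> U} := HB.pack (f^~ w) h.
exact: (linearZ_LR g).
Qed.

Lemma tlift_zero (U : lmodType K) (f : V -> W -> U) : bilinear_fun f ->
  tlift f tensor_zero = 0.
Proof. by move=> bf; rewrite tlift_pi // /formal_sum big_nil. Qed.

Lemma tlift_add (U : lmodType K) (f : V -> W -> U) x y : bilinear_fun f ->
  tlift f (tensor_add x y) = tlift f x + tlift f y.
Proof. by move=> bf; rewrite tlift_pi // /formal_sum big_cat. Qed.

Lemma tlift_scale (U : lmodType K) (f : V -> W -> U) a x : bilinear_fun f ->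
  tlift f (tensor_scale a x) = a *: tlift f x.
Proof.
move=> bf; rewrite tlift_pi // /formal_sum big_map scaler_sumr.
by apply: eq_bigr => p _ /=; rewrite bilinearZl.
Qed.

Let tensorE := (tlift_add, tlift_scale, tlift_zero).

Fact tensor_addA : associative tensor_add.
Proof. by move=> x y z; apply: tensor_ext => U f bf; rewrite !tensorE ?addrA. Qed.
Fact tensor_addC : commutative tensor_add.
Proof. by move=> x y; apply: tensor_ext => U f bf; rewrite !tensorE // addrC. Qed.
Fact tensor_add0 : left_id tensor_zero tensor_add.
Proof. by move=> x; apply: tensor_ext => U f bf; rewrite !tensorE // add0r. Qed.
Fact tensor_addN : left_inverse tensor_zero (tensor_scale (-1)) tensor_add.
Proof.
by move=> x; apply: tensor_ext => U f bf; rewrite !tensorE // scaleN1r addNr.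
Qed.
HB.instance Definition _ := GRing.isZmodule.Build tensor
  tensor_addA tensor_addC tensor_add0 tensor_addN.

Fact tensor_scaleA a b x :
  tensor_scale a (tensor_scale b x) = tensor_scale (a * b) x.
Proof. by apply: tensor_ext => U f bf; rewrite !tensorE // scalerA. Qed.
Fact tensor_scale1 : left_id 1 tensor_scale.
Proof. by move=> x; apply: tensor_ext => U f bf; rewrite !tensorE // scale1r. Qed.
Fact tensor_scaleDr : right_distributive tensor_scale +%R.
Proof.
move=> a x y; apply: tensor_ext => U f bf.
by rewrite !tensorE // scalerDr.
Qed.
Fact tensor_scaleDl x : {morph tensor_scale^~ x : a b / a + b}.
Proof.
move=> a b; apply: tensor_ext => U f bf.
by rewrite !tensorE // scalerDl.
Qed.
HB.instance Definition _ := GRing.Zmodule_isLmodule.Build K tensor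
  tensor_scaleA tensor_scale1 tensor_scaleDr tensor_scaleDl.

Lemma tlift_linear (U : lmodType K) (f : V -> W -> U) :
  bilinear_fun f -> linear (tlift f).
Proof.
move=> bf a x y; rewrite -[LHS]/(tlift f (tensor_add (tensor_scale a x) y)).
by rewrite !tensorE.
Qed.

Lemma tliftE (U : lmodType K) (f : V -> W -> U) v w :
  bilinear_fun f -> tlift f (ptens v w) = f v w.
Proof. by move=> bf; rewrite tlift_pi // /formal_sum big_seq1. Qed.

Lemma ptens_bilinear : bilinear_fun ptens.
Proof.
split=> [w a u v|v a u w]; apply: tensor_ext => U f bf;
  rewrite -[in RHS]/(tensor_add (tensor_scale a _) _) !tensorE // !tliftE //.
  exact: bf.1.
exact: bf.2.
Qed.

Lemma tensor_sum (x : tensor) : x = \sum_(p <- repr x) ptens p.1 p.2.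
Proof.
apply: tensor_ext => U f bf; rewrite -[x in LHS]reprK tlift_pi //.
have h := GRing.isLinear.Build _ _ _ _ _ (tlift_linear bf).
pose g : {linear tensor -> U} := HB.pack (tlift f) h.
rewrite -[RHS]/(g _) linear_sum; apply: eq_bigr => p _ /=.
by rewrite tliftE.
Qed.
End TensorDef.

Definition tmap (V W V' W' : lmodType K) (f : V -> V') (g : W -> W') :
    tensor V W -> tensor V' W' :=
  tlift (fun v w => ptens (f v) (g w)).

(* tau (v (x) w) = w (x) v *)
Definition tswap (V W : lmodType K) : tensor V W -> tensor W V :=
  tlift (fun v w => ptens w v).

(* u (x) (v (x) w) |-> (u (x) v) (x) w *)
Definition tassoc (U V W : lmodType K) :
    tensor U (tensor V W) -> tensor (tensor U V) W :=
  tlift (fun u x => tlift (fun v w => ptens (ptens u v) w) x).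

(* f (x) Id and Id (x) f, for a linear form f *)
Definition tforml (V W : lmodType K) (f : V -> K) : tensor V W -> W :=
  tlift (fun v w => f v *: w).
Definition tformr (V W : lmodType K) (f : W -> K) : tensor V W -> V :=
  tlift (fun v w => f w *: v).

(* the pairing with f (x) g, for linear forms f and g *)
Definition tpair (V W : lmodType K) (f : V -> K) (g : W -> K) :
    tensor V W -> K^o :=
  tlift (fun v w => (f v * g w : K^o)).

Lemma tpair_bilinear (V W : lmodType K) (f : V -> K^o) (g : W -> K^o) :
  linear f -> linear g -> bilinear_fun (fun v w => (f v * g w : K^o)).
Proof.
move=> lf lg; split=> [w a u v|v a u w].
  by rewrite lf mulrDl -scalerAl.
by rewrite lg mulrDr -scalerAr.
Qed.

Lemma tforml_bilinear (V W : lmodType K) (f : V -> K^o) :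
  linear f -> bilinear_fun (fun v (w : W) => f v *: w).
Proof.
move=> lf; split=> [w a u v|v a u w].
  by rewrite lf scalerDl -scalerA.
by rewrite scalerDr !scalerA mulrC.
Qed.

Lemma tmap_bilinear (V W V' W' : lmodType K) (f : V -> V') (g : W -> W') :
  linear f -> linear g -> bilinear_fun (fun v w => ptens (f v) (g w)).
Proof.
move=> lf lg; have [bl br] := ptens_bilinear V' W'.
split=> [w a u v|v a u w]; first by rewrite lf bl.
by rewrite lg br.
Qed.

Lemma linear_tensor_ext (V W U : lmodType K) (f h : tensor V W -> U) :
  linear f -> linear h -> (forall v w, f (ptens v w) = h (ptens v w)) ->
  f =1 h.
Proof.
move=> lf lh fh x.
pose f' : {linear tensor V W -> U} :=
  HB.pack f (GRing.isLinear.Build _ _ _ _ _ lf).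
pose h' : {linear tensor V W -> U} :=
  HB.pack h (GRing.isLinear.Build _ _ _ _ _ lh).
rewrite -[f x]/(f' x) -[h x]/(h' x) [x]tensor_sum !linear_sum.
by apply: eq_bigr => p _; exact: fh.
Qed.

End Tensor.

(* A formal series with coefficients in U and exponents in E is the function
   sending an exponent to its coefficient. One-variable series have E = rat;
   series in z_0, z_1, z_2 have E = {ffun 'I_3 -> rat}. *)
Section FormalSeries.
Variable K : fieldType.

Definition fmon (E : zmodType) (U : zmodType) (e0 : E) (u : U) : E -> U :=
  fun e => if e == e0 then u else 0.

(* formal sum of a family of series, each coefficient of which receives
   finitely many nonzero contributions *)
Definition fsum (E : zmodType) (U : zmodType) (I : choiceType)
    (F : I -> E -> U) : E -> U :=
  fun e => \sum_(i \in [set: I]) F i e.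

(* product of a scalar series with a series (same proviso) *)
Definition fmul (E : zmodType) (U : lmodType K) (f : E -> K) (h : E -> U) :
    E -> U :=
  fun e => \sum_(d \in [set: E]) f d *: h (e - d).

Definition fderiv (U : lmodType K) (f : rat -> U) : rat -> U :=
  fun e => ratr (e + 1) *: f (e + 1).

Definition fres (U : lmodType K) (f : rat -> U) : U := f (-1).

(* sum_k D_k(v) z^(-k-1) *)
Definition field_of (V : Type) (U : zmodType) (D : int -> V -> U) (v : V) :
    rat -> U :=
  fsum (fun k : int => fmon (- k%:~R - 1 : rat) (D k v)).

(* the binomial coefficient a(a-1)...(a-n+1)/n! *)
Definition gbinom (a : rat) (n : nat) : K :=
  ratr ((\prod_(m < n) (a - m%:R)) / n`!%:R).

(* (1 + z)^a *)
Definition onepow (a : rat) : rat -> K :=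
  fsum (fun n : nat => fmon (n%:R : rat) (gbinom a n)).

Definition exp3 := {ffun 'I_3 -> rat}.
Definition z0 : 'I_3 := @Ordinal 3 0 isT.
Definition z1 : 'I_3 := @Ordinal 3 1 isT.
Definition z2 : 'I_3 := @Ordinal 3 2 isT.

(* the exponent of z_i^a *)
Definition zexp (i : 'I_3) (a : rat) : exp3 :=
  [ffun k => if k == i then a else 0].

(* (z_i + s z_j)^a, in nonnegative powers of z_j *)
Definition binpow (i j : 'I_3) (s : K) (a : rat) : exp3 -> K :=
  fsum (fun n : nat =>
    fmon (zexp i (a - n%:R) + zexp j n%:R) (gbinom a n * s ^+ n)).

(* z_k^-1 delta((z_i + s z_j)/(t z_k))
   = sum_n t^(-n) (z_i + s z_j)^n z_k^(-n-1) *)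
Definition fdelta (k i j : 'I_3) (s t : K) : exp3 -> K :=
  fsum (fun (n : int) e =>
    t ^ (- n) * binpow i j s n%:~R (e - zexp k (- n%:~R - 1))).

(* sum_(a, b) F(a, b) z_i^a z_j^b *)
Definition in_vars (i j : 'I_3) (U : zmodType) (F : rat -> rat -> U) :
    exp3 -> U :=
  fun e => if e == zexp i (e i) + zexp j (e j) then F (e i) (e j) else 0.

End FormalSeries.

Section Structures.
Variable R : realType.
Local Notation C := R[i].

Definition cis (x : R) : C := (cos x +i* sin x)%C.

(* e^(2 pi i r / T) *)
Definition zeta (T r : nat) : C := cis (2 * pi * r%:R / T%:R).

Definition has_order (V : Type) (g : V -> V) (T : nat) : Prop :=
  [/\ (0 < T)%N, iter T g =1 id
    & forall j, (0 < j < T)%N -> ~ (iter j g =1 id)].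

(* V^(r) *)
Definition eigenpart (V : lmodType C) (g : V -> V) (T r : nat) : set V :=
  [set v | g v = zeta T r *: v].

(* For g of order T, the projection of V onto V^(r) along the sum of the
   other eigenspaces: T^-1 sum_j e^(-2 pi i r j / T) g^j. *)
Definition eigenproj (V : lmodType C) (g : V -> V) (T r : nat) (v : V) : V :=
  T%:R^-1 *: \sum_(j < T) (zeta T r ^- j) *: iter j g v.

Definition virasoro (V : lmodType C) (L : int -> V -> V) (d : C) : Prop :=
  forall (k j : int) v,
    L k (L j v) - L j (L k v)
    = (k - j)%:~R *: L (k + j) v
      + (if k + j == 0 then ((k ^+ 3 - k)%:~R / 12%:R * d) *: v else 0).

Definition in_fracN (T : nat) (t : rat) : Prop :=
  exists n : nat, t = n%:R / T%:R.

(* (V (x) V)_n *)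
Definition tensor_gr (V : lmodType C) (gr : int -> set V) (n : int) :
    set (tensor V V) :=
  span [set x | exists a v w, [/\ gr a v, gr (n - a) w & x = ptens v w]].

(* V (x) S, for a subspace S of M *)
Definition tensor_sub (V M : lmodType C) (S : set M) : set (tensor V M) :=
  span [set x | exists2 m, S m & exists v : V, x = ptens v m].

Record gvoc (V : lmodType C) := Gvoc {
  voc_gr : int -> set V;
  voc_delta : int -> {linear V -> tensor V V};
  voc_c : {linear V -> C^o};
  voc_rho : {linear V -> C^o};
  voc_rank : C;
  voc_ups := field_of voc_delta;
  (* (rho (x) Id) Upsilon(z) = sum_k L(k) z^(k-2) *)
  voc_L := fun (k : int) (v : V) =>
    tforml voc_rho (voc_ups v (k%:~R - 2));
  voc_direct : direct_sum voc_gr;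
  voc_fin : forall s, finite_dim (voc_gr s);
  voc_bounded : exists s0, forall s, s < s0 -> voc_gr s = [set 0];
  voc_trunc : forall v, exists k0, forall k, k < k0 -> voc_delta k v = 0;
  voc_graded : forall k s v, voc_gr s v ->
    tensor_gr voc_gr (s + k + 1) (voc_delta k v);
  voc_counitl : forall v e, tforml voc_c (voc_ups v e) = fmon 0 v e;
  voc_counitr : forall v,
    (forall e, e < 0 -> tformr voc_c (voc_ups v e) = 0) /\
    tformr voc_c (voc_ups v 0) = v;
  voc_jacobi : forall v e,
    fmul (fdelta z0 z1 z2 (-1) 1)
      (in_vars z1 z2 (fun a b =>
         tassoc (tmap id (voc_ups^~ b) (voc_ups v a)))) e
    - fmul (fdelta z0 z2 z1 (-1) (-1))
      (in_vars z1 z2 (fun a b =>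
         tmap (@tswap _ V V) id
           (tassoc (tmap id (voc_ups^~ a) (voc_ups v b))))) e
    = fmul (fdelta z1 z2 z0 1 1)
      (in_vars z0 z2 (fun a b => tmap (voc_ups^~ a) id (voc_ups v b))) e;
  voc_virasoro : virasoro voc_L voc_rank;
  voc_L0 : forall s, voc_gr s = [set v | voc_L 0 v = s%:~R *: v];
  voc_L1 : forall v e,
    tmap (voc_L 1) id (voc_ups v e) = fderiv (voc_ups v) e
}.

Record voc_aut (V : lmodType C) (X : gvoc V) := VocAut {
  aut_fun :> {linear V -> V};
  aut_inv : V -> V;
  aut_invK : cancel aut_inv aut_fun;
  aut_funK : cancel aut_fun aut_inv;
  aut_c : forall v, voc_c X (aut_fun v) = voc_c X v;
  aut_rho : forall v, voc_rho X (aut_fun v) = voc_rho X v;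
  aut_ups : forall v e,
    voc_ups X (aut_fun v) e = tmap aut_fun aut_fun (voc_ups X v e)
}.

(* Upsilon_M(z)m: for D_k(m) in V^(r) (x) M the exponent is -k-1-r/T. *)
Definition twisted_field_of (V M : lmodType C) (g : V -> V) (T : nat)
    (D : int -> M -> tensor V M) (m : M) : rat -> tensor V M :=
  fun e => \sum_(r < T)
    fsum (fun k : int =>
      fmon (- k%:~R - 1 - r%:R / T%:R : rat)
           (tmap (eigenproj g T r) id (D k m))) e.

(* ((z_1 - z_0)/z_2)^(-a) *)
Definition twist_factor (a : rat) : exp3 -> C :=
  fmul (U := C^o) (binpow z1 z0 (-1) (- a)) (fmon (zexp z2 a) (1 : C^o)).

Record twisted_comodule (V : lmodType C) (X : gvoc V) (g : voc_aut X)
    (T : nat) (M : lmodType C) := TwistedComodule {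
  com_delta : int -> {linear M -> tensor V M};
  com_ups := twisted_field_of g T com_delta;
  com_L := fun (k : int) (m : M) =>
    tforml (voc_rho X) (com_ups m (k%:~R - 2));
  com_trunc : forall m, exists k0, forall k, k < k0 -> com_delta k m = 0;
  com_counit : forall m e, tforml (voc_c X) (com_ups m e) = fmon 0 m e;
  com_jacobi : forall m e,
    fmul (fdelta z0 z1 z2 (-1) 1)
      (in_vars z1 z2 (fun a b =>
         tassoc (tmap id (com_ups^~ b) (com_ups m a)))) e
    - fmul (fdelta z0 z2 z1 (-1) (-1))
      (in_vars z1 z2 (fun a b =>
         tmap (@tswap _ V V) id
           (tassoc (tmap id (com_ups^~ a) (com_ups m b))))) e
    = fmul (fdelta z2 z1 z0 (-1) 1)
      (fun e' => \sum_(r < T)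
         fmul (twist_factor (r%:R / T%:R))
           (in_vars z0 z2 (fun a b =>
              tmap (tmap (eigenproj g T r) id) id
                (tmap ((voc_ups X)^~ a) id (com_ups m b)))) e') e;
  com_virasoro : virasoro com_L (voc_rank X);
  com_L1 : forall m e,
    tmap (voc_L X 1) id (com_ups m e) = fderiv (com_ups m) e;
  com_L1M : forall m e,
    fderiv (com_ups m) e
    = com_ups (com_L 1 m) e - tmap id (com_L 1) (com_ups m e)
}.

Section Corational.
Variables (V : lmodType C) (X : gvoc V) (g : voc_aut X) (T : nat).

(* the sum over r of the subspaces (V^(r) (x) M)_(t' + r/T) *)
Definition comodule_target (M : lmodType C) (grM : rat -> set M) (t' : rat) :
    set (tensor V M) :=
  span [set x | exists r a v m,
    [/\ (r < T)%N, eigenpart g T r v, voc_gr X a v,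
        grM (t' + r%:R / T%:R - a%:~R) m & x = ptens v m]].

Definition admissible_comodule (M : lmodType C)
    (W : twisted_comodule g T M) (grM : rat -> set M) : Prop :=
  [/\ direct_sum grM, forall t, ~ in_fracN T t -> grM t = [set 0]
    & forall k t m, grM t m ->
        comodule_target grM (t + k%:~R + 1) (com_delta W k m)].

Definition admissible_subcomodule (M : lmodType C)
    (W : twisted_comodule g T M) (grM : rat -> set M) (S : set M) : Prop :=
  graded_subspace grM S /\
  forall k m, S m -> tensor_sub (V := V) S (com_delta W k m).

Definition corational : Prop :=
  forall (M : lmodType C) (W : twisted_comodule g T M) (grM : rat -> set M),
    admissible_comodule W grM ->
    completely_reducible (admissible_subcomodule W grM).

End Corational.

(* voa_mode u k v is u_k v, where Y(u, z)v = sum_k (u_k v) z^(-k-1). *)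
Record voa_data (U : lmodType C) := VoaData {
  voa_gr : int -> set U;
  voa_mode : U -> int -> U -> U;
  voa_vac : U;
  voa_conf : U;
  voa_rank : C
}.

Section VOA.
Variables (U : lmodType C) (X : voa_data U).

Definition voa_Y (u : U) : U -> rat -> U := field_of (voa_mode X u).

(* Y(omega, z) = sum_n L(n) z^(-n-2) *)
Definition voa_L (n : int) (u : U) : U := voa_mode X (voa_conf X) (n + 1) u.

Record is_voa : Prop := IsVoa {
  voa_direct : direct_sum (voa_gr X);
  voa_fin : forall s, finite_dim (voa_gr X s);
  voa_bounded : exists s0, forall s, s < s0 -> voa_gr X s = [set 0];
  voa_bilinear : forall k, bilinear_fun (fun u v => voa_mode X u k v);
  voa_trunc : forall u v, exists k0, forall k, k0 < k -> voa_mode X u k v = 0;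
  voa_vacuum : forall v e, voa_Y (voa_vac X) v e = fmon 0 v e;
  voa_creation : forall v,
    (forall e, e < 0 -> voa_Y v (voa_vac X) e = 0) /\
    voa_Y v (voa_vac X) 0 = v;
  voa_jacobi : forall u v w e,
    fmul (fdelta z0 z1 z2 (-1) 1)
      (in_vars z1 z2 (fun a b => voa_Y u (voa_Y v w b) a)) e
    - fmul (fdelta z0 z2 z1 (-1) (-1))
      (in_vars z1 z2 (fun a b => voa_Y v (voa_Y u w a) b)) e
    = fmul (fdelta z2 z1 z0 (-1) 1)
      (in_vars z0 z2 (fun a b => voa_Y (voa_Y u v a) w b)) e;
  voa_virasoro : virasoro voa_L (voa_rank X);
  voa_L0 : forall s, voa_gr X s = [set v | voa_L 0 v = s%:~R *: v];
  voa_Lm1 : forall u v e,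
    voa_Y (voa_L (-1) u) v e = fderiv (voa_Y u v) e
}.

Record is_voa_aut (h : U -> U) : Prop := IsVoaAut {
  vaut_linear : linear h;
  vaut_bij : bijective h;
  vaut_vac : h (voa_vac X) = voa_vac X;
  vaut_conf : h (voa_conf X) = voa_conf X;
  vaut_mode : forall u k v, h (voa_mode X u k v) = voa_mode X (h u) k (h v)
}.

Variables (h : U -> U) (T : nat).

(* tm_mode u t is u_t; u |-> Y_N(u, z) is extended linearly from the U^(r)
   to U, hence t ranges over all rationals. *)
Record twisted_module (N : lmodType C) := TwistedModule {
  tm_mode : U -> rat -> N -> N;
  tm_Y := fun (u : U) (n : N) (e : rat) => tm_mode u (- e - 1) n;
  tm_bilinear : forall t, bilinear_fun (fun u n => tm_mode u t n);
  tm_support : forall r u t n, (r < T)%N -> eigenpart h T r u ->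
    (forall k : int, t != k%:~R + r%:R / T%:R) -> tm_mode u t n = 0;
  tm_trunc : forall u n, exists t0, forall t, t0 < t -> tm_mode u t n = 0;
  tm_vacuum : forall n e, tm_Y (voa_vac X) n e = fmon 0 n e;
  (* delta((-z_2 + z_1)/z_0) is delta((z_2 - z_1)/(- z_0)), expanded in
     nonnegative powers of z_1 *)
  tm_jacobi : forall r u v n e, (r < T)%N -> eigenpart h T r u ->
    fmul (fdelta z0 z1 z2 (-1) 1)
      (in_vars z1 z2 (fun a b => tm_Y u (tm_Y v n b) a)) e
    - fmul (fdelta z0 z2 z1 (-1) (-1))
      (in_vars z1 z2 (fun a b => tm_Y v (tm_Y u n a) b)) e
    = fmul (fdelta z2 z1 z0 (-1) 1)
      (fmul (twist_factor (r%:R / T%:R))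
        (in_vars z0 z2 (fun a b => tm_Y (voa_Y u v a) n b))) e
}.

Definition admissible_module (N : lmodType C) (W : twisted_module N)
    (grN : rat -> set N) : Prop :=
  [/\ direct_sum grN, forall t, ~ in_fracN T t -> grN t = [set 0]
    & forall (w : int) u s t n, voa_gr X w u -> grN t n ->
        grN (w%:~R + t - s - 1) (tm_mode W u s n)].

Definition admissible_submodule (N : lmodType C) (W : twisted_module N)
    (grN : rat -> set N) (S : set N) : Prop :=
  graded_subspace grN S /\
  forall u t n, S n -> S (tm_mode W u t n).

Definition rational_voa : Prop :=
  [/\ is_voa, is_voa_aut h, has_order h T
    & forall (N : lmodType C) (W : twisted_module N) (grN : rat -> set N),
        admissible_module W grN ->
        completely_reducible (admissible_submodule W grN)].

(* The subspace O_(k,h), with k = l + i/T. For 0 <= r < T and i < T, the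
   numbers delta_i(r) and delta_i(T - r) are the truth values of r <= i and
   T - r <= i. *)
Definition zhu_O (l i : nat) : set U :=
  span [set x |
    (exists u, x = voa_L (-1) u + voa_L 0 u) \/
    (exists r (w : int) u v,
      [/\ (r < T)%N, eigenpart h T r u, voa_gr X w u &
        x = fres
          (fmul (onepow C (w%:~R - 1 + (r <= i)%N%:R + l%:R + r%:R / T%:R))
            (fmul (fmon (- (2 * l + (r <= i) + (T - r <= i) + 1)%N%:R) 1)
              (voa_Y u v)))])].

(* dim A_(k,h) < oo, with k = l + i/T *)
Definition zhu_finite (l i : nat) : Prop := finite_codim (zhu_O l i).

End VOA.

(* For V the direct sum of the V_s = gr s, the direct sum of the V_s^* is
   the space of linear forms on V that vanish on all but finitely many V_s. *)
Section RestrictedDual.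
Variables (V : lmodType C) (gr : int -> set V).

Definition rdual_pred : {pred V -> C^o} :=
  [pred f : V -> C^o | `[< linear f /\
     finite_set [set s | exists2 v, gr s v & f v != 0] >]].

Fact rdual_submod_closed : submod_closed rdual_pred.
Proof.
split.
  apply/asboolP; split.
    by move=> a u v /=; rewrite /GRing.zero /= scaler0 addr0.
  by apply: (sub_finite_set _ (finite_set0 int)) => s [v _] /=; rewrite eqxx.
move=> a f1 f2 /asboolP[l1 F1] /asboolP[l2 F2].
apply/asboolP; split.
  move=> b u v; rewrite !fctE l1 l2 !scalerDr !scalerA [a * b]mulrC.
  by rewrite addrACA.
have F12 : finite_set ([set s | exists2 v, gr s v & f1 v != 0] `|`
                       [set s | exists2 v, gr s v & f2 v != 0]).
  by rewrite finite_setU.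
apply: (sub_finite_set _ F12) => s [v gv] h.
have [h1|h1] := eqVneq (f1 v) 0; last by left; exists v.
by right; exists v => //; move: h; rewrite !fctE h1 scaler0 add0r.
Qed.

HB.instance Definition _ :=
  GRing.isSubmodClosed.Build C (V -> C^o) rdual_pred rdual_submod_closed.

Record rdual := RDual { rdual_val :> V -> C^o; _ : rdual_val \in rdual_pred }.
HB.instance Definition _ := [isSub for rdual_val].
HB.instance Definition _ := [Choice of rdual by <:].
HB.instance Definition _ := [SubChoice_isSubLmodule of rdual by <:].

Lemma rdual_linear (f : rdual) : linear f.
Proof. by case: f => f /= /asboolP[]. Qed.

Lemma rdual_finite (f : rdual) :
  finite_set [set s | exists2 v, gr s v & f v != 0].
Proof. by case: f => f /= /asboolP[]. Qed.

Lemma rdual_subproof (f : V -> C^o) : linear f ->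
  finite_set [set s | exists2 v, gr s v & f v != 0] -> f \in rdual_pred.
Proof. by move=> lf ff; apply/asboolP. Qed.

(* V_s^*, extended by 0 on the other V_t *)
Definition rdual_gr (s : int) : set rdual :=
  [set f | forall t v, t != s -> gr t v -> f v = 0].

End RestrictedDual.

Section DualVOA.
Variables (V : lmodType C) (X : gvoc V).
Local Notation V' := (rdual (voc_gr X)).

(* u_k v = (u (x) v) o Delta_k *)
Definition dual_mode_fun (u : V') (k : int) (v : V') (x : V) : C^o :=
  tpair u v (voc_delta X k x).

Fact dual_mode_subproof u k v : dual_mode_fun u k v \in rdual_pred (voc_gr X).
Proof.
have bf := tpair_bilinear (rdual_linear u) (rdual_linear v).
have lt := tlift_linear bf.
apply: rdual_subproof => [a x y|].
  by rewrite /dual_mode_fun linearP /= /tpair lt.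
have F := finite_image2 (fun p q : int => p + q - k - 1)
  (rdual_finite u) (rdual_finite v).
apply: sub_finite_set F => s [x xs] /=; rewrite /dual_mode_fun.
have [n [a [y [yP ->]]]] := voc_graded k xs.
pose g : {linear tensor V V -> C^o} :=
  HB.pack (tpair u v) (GRing.isLinear.Build _ _ _ _ _ lt).
rewrite -[tpair u v _]/(g _) linear_sum /= => h.
have [i hi] : exists i, tpair u v (a i *: y i) != 0.
  apply: contrapT => /forallNP hn; move/eqP: h; apply.
  by rewrite big1 // => i _; apply/eqP/negPn/negP/hn.
move: hi; rewrite -[tpair u v _]/(g _) linearZ_LR /=.
have [p [b [c [pb pc ->]]]] := yP i.
rewrite /tpair tliftE // => hi.
exists p; first by exists b => //; apply: contra_neq hi => ->; rewrite mul0r scaler0.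
exists (s + k + 1 - p); last by ring.
by exists c => //; apply: contra_neq hi => ->; rewrite mulr0 scaler0.
Qed.

Definition dual_mode u k v : V' := RDual (dual_mode_subproof u k v).

(* the restriction of the linear form f to V_s, extended by 0 *)
Fact dual_restrict_subproof (f : {linear V -> C^o}) (s : int) :
  (fun v => f (component (voc_gr X) s v)) \in rdual_pred (voc_gr X).
Proof.
apply: rdual_subproof => [a x y|].
  by rewrite (component_linear s (voc_direct X)) linearP.
apply: (sub_finite_set _ (finite_set1 s)) => t [v tv] /=.
apply: contra_neqP => /eqP ts.
by rewrite (component_out (voc_direct X) tv) ?linear0 // eq_sym.
Qed.

Definition dual_restrict f s : rdual (voc_gr X) :=
  RDual (dual_restrict_subproof f s).

Definition dual_voa : voa_data V' :=
  VoaData (rdual_gr (gr := voc_gr X)) dual_mode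
    (dual_restrict (voc_c X) 0) (dual_restrict (voc_rho X) 2) (voc_rank X).

Variable g : voc_aut X.

Lemma aut_inv_linear : linear (aut_inv g).
Proof. exact: (can2_linear (aut_funK g) (aut_invK g)). Qed.

Lemma aut_inv_gr s v : voc_gr X s v -> voc_gr X s (aut_inv g v).
Proof.
rewrite !voc_L0 /= => Lv; apply: (can_inj (aut_funK g)).
rewrite linearZ_LR /= aut_invK -Lv.
rewrite -[v in RHS](aut_invK g) /voc_L aut_ups; set x := voc_ups X _ _.
have bf (f : {linear V -> C^o}) := tforml_bilinear V (linearP f).
have bg := tmap_bilinear (linearP g) (linearP g).
apply: (linear_tensor_ext (f := g \o tforml (voc_rho X))
  (h := tforml (voc_rho X) \o tmap g g)).
- by move=> a y z /=; rewrite /tforml (tlift_linear (bf _)) linearP.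
- move=> a y z /=; rewrite /tmap (tlift_linear bg).
  by rewrite /tforml (tlift_linear (bf _)).
- move=> a b /=; rewrite /tmap tliftE // /tforml !tliftE //.
  by rewrite linearZ_LR /= aut_rho.
Qed.

(* (g v^*, v) = (v^*, g^-1 v) *)
Fact dual_aut_subproof (f : V') :
  (fun v => f (aut_inv g v)) \in rdual_pred (voc_gr X).
Proof.
apply: rdual_subproof => [a x y|].
  by rewrite aut_inv_linear rdual_linear.
apply: (sub_finite_set _ (rdual_finite f)) => s [v vs h] /=.
by exists (aut_inv g v) => //; exact: aut_inv_gr.
Qed.

Definition dual_aut (f : V') : V' := RDual (dual_aut_subproof f).

End DualVOA.
End Structures.

(* Main.v *)
Require Import Defs.
From HB Require Import structures.
From mathcomp Require Import all_boot all_order all_algebra.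
From mathcomp Require Import complex ring lra zify.
From mathcomp Require Import finmap boolp classical_sets functions cardinality.
From mathcomp Require Import fsbigop reals trigo.

Set Implicit Arguments.
Unset Strict Implicit.
Unset Printing Implicit Defensive.

Import Order.TTheory GRing.Theory Num.Theory.
Local Open Scope classical_set_scope.
Local Open Scope ring_scope.
Local Notation span := Defs.span.
Local Notation z0 := Defs.z0.
Local Notation z1 := Defs.z1.
Local Notation z2 := Defs.z2.

(** An admissible g-twisted V-comodule and an admissible twisted V'-module for
    the transported automorphism h are the same structure on the same graded
    space M, with the same graded subobjects; complete reducibility depends on
    nothing else.

    Let M be a twisted comodule. Contracting the V factor of Upsilon_M with
    u in V' gives operators R(u, t) on M, and pairing the co-Jacobi identity
    with u (x) v turns it into the Jacobi identity of these modes, except that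
    their composition is reversed (com_jacobi_modes): M becomes a twisted
    module acted on from the right, and the indices of u lie in r/T + Z where
    h-twisted modules have -r/T + Z. Both defects are repaired by the
    contragredient operation of Frenkel, Huang and Lepowsky, usually applied to
    the dual of a module and here to the modes on M themselves:
    R'(u, t) = sum_w (-1)^w sum_j R(L(1)^j u_w / j!, 2 w - j - 2 - t),
    where u_w is the part of weight w of u. It makes left modes out of right
    modes and conversely, and is an involution (contra_borcherds, contraK); it
    negates the class of the indices, preserves the grading and preserves
    invariant subspaces.

    Everything is done with coefficients. The Jacobi identity of a family of
    modes is equivalent to Borcherds' identity together with support and
    truncation conditions (jacobi_borcherds, borcherds_jacobi), and the
    contragredient of Borcherds' identity rests on the effect of L(1)^N / N! on
    u_n v (dL_mode) and on the sum gbinom_alternating. From the same identity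
    follow the derivative and Virasoro axioms of a comodule
    (mode_derivative, mode_virasoro), which a twisted module does not carry
    explicitly.

    A module is turned back into a comodule by reconstructing Delta_k(x) from
    its contractions (modes_delta_ex). A family of vectors depending linearly
    on u in V' is the family of contractions of a tensor as soon as it vanishes
    for u outside finitely many weights, because each V_s is finite dimensional
    (tensor_of); weights are bounded below in V, and large weights would lower
    the degree in M below zero.

    The axioms of V' are transposed from those of V in dual_is_voa. *)

(** * Finitely supported sums *)
Section FinSum.
Variable U : zmodType.

Lemma fsum_seq (I : choiceType) (s : seq I) (F : I -> U) :
  uniq s -> (forall i, i \notin s -> F i = 0) ->
  \sum_(i \in [set: I]) F i = \sum_(i <- s) F i.
Proof.
move=> us Fs; rewrite (fsbigTE [fset x | x in s]%fset); last first.
  by move=> i; rewrite !inE /= => /Fs.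
apply: perm_big; apply: uniq_perm => //.
by move=> i; rewrite !inE.
Qed.

Lemma fsum_one (I : choiceType) (i0 : I) (F : I -> U) :
  (forall i, i != i0 -> F i = 0) -> \sum_(i \in [set: I]) F i = F i0.
Proof.
move=> h; rewrite (@fsum_seq _ [:: i0]) ?big_seq1 // => i.
by rewrite inE => /h.
Qed.

Lemma fsum_zero (I : choiceType) (F : I -> U) :
  (forall i, F i = 0) -> \sum_(i \in [set: I]) F i = 0.
Proof. by move=> h; rewrite (@fsum_seq _ [::]) ?big_nil. Qed.

(** The supports on the two sides correspond under h, so that both sums are
    finite or both are zero by convention. *)
Lemma fsum_inj (I J : choiceType) (h : J -> I) (F : I -> U) :
  injective h -> (forall i, (forall j, i != h j) -> F i = 0) ->
  \sum_(i \in [set: I]) F i = \sum_(j \in [set: J]) F (h j).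
Proof.
move=> hi F0.
rewrite -(fsbig_widen (range h)) //=; last first.
  move=> i [_ /= ni]; apply: F0 => j; apply/negP => /eqP e; apply: ni.
  by exists j.
by rewrite fsbig_image //= => x y _ _; exact: hi.
Qed.

(** The coefficients of products with binomial series are sums of this kind;
    truncation conditions make them finite. *)
Definition natsum (F : nat -> U) : U := \sum_(i \in [set: nat]) F i.

Definition eventually0 (F : nat -> U) := exists N, forall i, (N <= i)%N -> F i = 0.

Lemma natsumE N (F : nat -> U) :
  (forall i, (N <= i)%N -> F i = 0) -> natsum F = \sum_(i < N) F i.
Proof.
move=> h; rewrite /natsum (@fsum_seq _ (iota 0 N)) ?iota_uniq //.
  by rewrite -[N in iota 0 N]subn0 big_mkord.
by move=> i; rewrite mem_iota /= add0n -leqNgt => /h.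
Qed.

Lemma eq_natsum (F G : nat -> U) : F =1 G -> natsum F = natsum G.
Proof. by move=> /funext ->. Qed.

Lemma natsum1 (F : nat -> U) : (forall i, (0 < i)%N -> F i = 0) -> natsum F = F 0%N.
Proof. by move=> h; rewrite (@natsumE 1) ?big_ord1. Qed.

End FinSum.

Section NatSumLinear.
Variable K : fieldType.

Lemma linear_fun0 (U W : lmodType K) (f : U -> W) : linear f -> f 0 = 0.
Proof. by move=> lf; have := lf (-1) 0 0; rewrite scaler0 addr0 scaleN1r addNr. Qed.
Lemma linear_funD (U W : lmodType K) (f : U -> W) u v : linear f -> f (u + v) = f u + f v.
Proof. by move=> lf; have := lf 1 u v; rewrite !scale1r. Qed.
Lemma linear_funZ (U W : lmodType K) (f : U -> W) a u : linear f -> f (a *: u) = a *: f u.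
Proof. by move=> lf; have := lf a u 0; rewrite !addr0 (linear_fun0 lf) addr0. Qed.
Lemma linear_funN (U W : lmodType K) (f : U -> W) u : linear f -> f (- u) = - f u.
Proof. by move=> lf; rewrite -scaleN1r (linear_funZ _ _ lf) scaleN1r. Qed.
Lemma linear_funB (U W : lmodType K) (f : U -> W) u v : linear f -> f (u - v) = f u - f v.
Proof. by move=> lf; rewrite linear_funD // linear_funN. Qed.
Lemma linear_sumE (U W : lmodType K) (f : U -> W) (I : Type) (s : seq I) (P : pred I) (F : I -> U) :
  linear f -> f (\sum_(i <- s | P i) F i) = \sum_(i <- s | P i) f (F i).
Proof.
move=> lf; apply: (big_morph f) => [u v|]; [exact: linear_funD | exact: linear_fun0].
Qed.

Lemma linear_comp (U V W : lmodType K) (f : V -> W) (h : U -> V) :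
  linear f -> linear h -> linear (fun x => f (h x)).
Proof. by move=> lf lh a u v; rewrite lh lf. Qed.

Lemma linear_fsum (U W : lmodType K) (f : U -> W) (I : choiceType) (F : I -> U) :
  linear f -> finite_set [set i | F i != 0] ->
  f (\sum_(i \in [set: I]) F i) = \sum_(i \in [set: I]) f (F i).
Proof.
move=> lf fF; pose s := fset_set [set i | F i != 0].
have h i : i \notin (s : seq I) -> F i = 0.
  move=> nis; apply/eqP/negPn/negP => Fi; move/negP: nis; apply.
  by rewrite /s in_fset_set //; apply/mem_set.
rewrite !(fsum_seq (fset_uniq s)) ?(linear_sumE _ _ _ lf) // => i /h ->.
exact: linear_fun0.
Qed.

Lemma natsum_linear (U W : lmodType K) (f : U -> W) (F : nat -> U) :
  linear f -> eventually0 F -> f (natsum F) = natsum (fun i => f (F i)).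
Proof.
move=> lf [N h]; rewrite (natsumE h) (@natsumE _ N) ?(linear_sumE _ _ _ lf) //.
by move=> i /h ->; exact: linear_fun0.
Qed.

Lemma natsumD (U : zmodType) (F G : nat -> U) : eventually0 F -> eventually0 G ->
  natsum (fun i => F i + G i) = natsum F + natsum G.
Proof.
move=> [N hF] [N' hG]; rewrite !(@natsumE _ (maxn N N')) ?big_split //.
- by move=> i; rewrite geq_max => /andP[_ /hG].
- by move=> i; rewrite geq_max => /andP[/hF].
- by move=> i; rewrite geq_max => /andP[/hF -> /hG ->]; rewrite addr0.
Qed.

Lemma natsum_sum (U : zmodType) (I : finType) (F : I -> nat -> U) :
  (forall j, eventually0 (F j)) ->
  natsum (fun i => \sum_j F j i) = \sum_j natsum (F j).
Proof.
move=> h; have [N hN] : exists N, forall j i, (N <= i)%N -> F j i = 0.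
  pose N j := projT1 (cid (h j)).
  exists (\max_j N j) => j i le; apply: (projT2 (cid (h j))).
  exact: leq_trans (leq_bigmax j) le.
rewrite (@natsumE _ N) => [|i le]; last by rewrite big1 // => j _; exact: hN.
rewrite exchange_big; apply: eq_bigr => j _.
by rewrite (@natsumE _ N) // => i; exact: hN.
Qed.

End NatSumLinear.

(** * Generalized binomial coefficients *)
Section GBinom.
Variable K : numFieldType.
Local Notation "''B' ( a , n )" := (gbinom K a n) (at level 8, format "''B' ( a ,  n )").

Lemma gbinom0 a : 'B(a, 0%N) = 1.
Proof. by rewrite /gbinom big_ord0 fact0 divr1 rmorph1. Qed.

Lemma gbinomS a n : n.+1%:R * 'B(a, n.+1) = ratr (a - n%:R) * 'B(a, n).
Proof.
rewrite /gbinom -[n.+1%:R](ratr_nat K) -!rmorphM /=; congr ratr.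
rewrite big_ord_recr /= factS natrM.
have h1 : n`!%:R != 0 :> rat by rewrite pnatr_eq0 -lt0n fact_gt0.
have h2 : n.+1%:R != 0 :> rat by rewrite pnatr_eq0.
move: h1 h2; move: (n`!%:R : rat) (n.+1%:R : rat) (\prod_(i < n) _) => x y z h1 h2.
by field; rewrite h1 h2.
Qed.

Lemma natS_neq0 n : n.+1%:R != 0 :> K.
Proof. by rewrite pnatr_eq0. Qed.

Lemma gbinom1 a : 'B(a, 1%N) = ratr a.
Proof. by have := gbinomS a 0; rewrite mul1r gbinom0 subr0 mulr1. Qed.

Lemma gbinom_pascal a n : 'B(a + 1, n.+1) = 'B(a, n.+1) + 'B(a, n).
Proof.
elim: n => [|n IH]; first by rewrite !gbinom1 gbinom0 rmorphD rmorph1.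
apply: (mulfI (natS_neq0 n.+1)); rewrite mulrDr !gbinomS IH.
have := gbinomS a n; move: 'B(a, n.+1) 'B(a, n) => x y e.
have -> : n.+2%:R = n.+1%:R + 1 :> K by rewrite -natr1.
rewrite !rmorphB /= !rmorphD /= !rmorph1 !ratr_nat in e *.
rewrite mulrDr [X in _ = _ + X]mulrDl mul1r e.
have -> : n.+1%:R = n%:R + 1 :> K by rewrite -natr1.
by ring.
Qed.

(** Multiplying by N lowers one of the two indices in each term, so that the
    convolution satisfies the recursion gbinomS of the right-hand side. *)
Lemma gbinom_vandermonde a b N :
  \sum_(l < N.+1) 'B(a, l) * 'B(b, (N - l)%N) = 'B(a + b, N).
Proof.
elim: N => [|N IH]; first by rewrite big_ord1 !gbinom0 mul1r.
apply: (mulfI (natS_neq0 N)); rewrite gbinomS -IH !mulr_sumr.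
transitivity (\sum_(l < N.+2) l%:R * 'B(a, l) * 'B(b, (N.+1 - l)%N) +
    \sum_(l < N.+2) 'B(a, l) * ((N.+1 - l)%N%:R * 'B(b, (N.+1 - l)%N))).
  rewrite -big_split; apply: eq_bigr => l _ /=.
  have le : (l <= N.+1)%N by rewrite -ltnS.
  by rewrite natrB //; ring.
rewrite big_ord_recl [X in _ + X]big_ord_recr /= subnn !mul0r mulr0 addr0 add0r.
rewrite -big_split; apply: eq_bigr => l _ /=.
have le : (l <= N)%N by rewrite -ltnS.
rewrite ?/bump /= ?add1n subSS subSn // !gbinomS !rmorphB /= rmorphD /= !ratr_nat natrB //.
by ring.
Qed.

(** The upper argument on the right moves with N; Pascal's rule brings it back
    in the induction step. *)
Lemma gbinom_reflect a N : 'B(a, N) = (-1) ^+ N * 'B(N%:R - 1 - a, N).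
Proof.
elim: N a => [|N IH] a; first by rewrite !gbinom0 expr0 mul1r.
apply: (mulfI (natS_neq0 N)); rewrite gbinomS [RHS]mulrCA.
have -> : N.+1%:R - 1 - a = (N%:R - 1 - a) + 1 by rewrite -natr1; ring.
rewrite gbinom_pascal mulrDr gbinomS IH exprS.
rewrite !rmorphB /= !ratr_nat rmorph1 -natr1; ring.
Qed.

(** After reflection of the second factor this is Vandermonde's convolution. It
    is the identity of binomial coefficients behind the change of variable
    z |-> -z/(1 + z) in the contragredient. *)
Lemma gbinom_alternating (p A : rat) m :
  \sum_(i < m.+1) (-1) ^+ i * 'B(p, i) * 'B(A - i%:R, (m - i)%N) = 'B(A - p, m).
Proof.
transitivity ((-1) ^+ m * \sum_(i < m.+1) 'B(p, i) * 'B(m%:R - 1 - A, (m - i)%N)).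
  rewrite mulr_sumr; apply: eq_bigr => i _.
  have le : (i <= m)%N by rewrite -ltnS.
  rewrite [in LHS](gbinom_reflect (A - _)) natrB //.
  have -> : m%:R - i%:R - 1 - (A - i%:R) = m%:R - 1 - A by ring.
  have -> : (-1) ^+ m = (-1) ^+ i * (-1) ^+ (m - i) :> K by rewrite -exprD subnKC.
  by ring.
rewrite gbinom_vandermonde (gbinom_reflect (A - p)).
by congr (_ * 'B(_, _)); ring.
Qed.

Lemma gbinom_nat0 (n m : nat) : (n < m)%N -> 'B(n%:R, m) = 0.
Proof.
by move=> lt; rewrite /gbinom (bigD1 (Ordinal lt)) //= subrr !mul0r rmorph0.
Qed.

End GBinom.

(** * Coefficients of the formal delta functions *)
Section Delta.
Variable K : numFieldType.

Definition is_int (x : rat) := exists n : int, x = n%:~R.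

(** The monomials of z_k^-1 delta((z_i + s z_j)/(t z_k)) are the
    z_i^(n-l) z_j^l z_k^(-n-1). They are pairwise distinct, so that
    multiplication by the delta function is a sum over the pairs (n, l). *)
Definition dexp (k i j : 'I_3) (x : int * nat) : exp3 :=
  zexp i (x.1%:~R - x.2%:R) + zexp j x.2%:R + zexp k (- x.1%:~R - 1).

Definition dcoef (s t : K) (x : int * nat) : K :=
  t ^ (- x.1) * (gbinom K x.1%:~R x.2 * s ^+ x.2).

Definition distinct3 (k i j : 'I_3) := [&& k != i, k != j & i != j].

Lemma zexp_at (i k : 'I_3) a : zexp i a k = if k == i then a else 0.
Proof. by rewrite ffunE. Qed.

Section Dexp.
Variables (k i j : 'I_3).
Hypothesis dis : distinct3 k i j.

Lemma cover3 x : [|| x == k, x == i | x == j].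
Proof.
by move: dis; rewrite /distinct3 -!val_eqE /=; have := ltn_ord x;
   have := ltn_ord k; have := ltn_ord i; have := ltn_ord j;
   move: (x : nat) (k : nat) (i : nat) (j : nat) => a b c d *; lia.
Qed.

Lemma exp3P (d e : exp3) : d k = e k -> d i = e i -> d j = e j -> d = e.
Proof.
by move=> *; apply/ffunP => x; have /or3P[] := cover3 x => /eqP ->.
Qed.

Let ki : (k == i) = false. Proof. by case/and3P: dis => /negbTE. Qed.
Let kj : (k == j) = false. Proof. by case/and3P: dis => _ /negbTE. Qed.
Let ij : (i == j) = false. Proof. by case/and3P: dis => _ _ /negbTE. Qed.
Let ik : (i == k) = false. Proof. by rewrite eq_sym. Qed.
Let jk : (j == k) = false. Proof. by rewrite eq_sym. Qed.
Let ji : (j == i) = false. Proof. by rewrite eq_sym. Qed.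
Let eqs := (ki, kj, ij, ik, jk, ji).

Lemma dexp_k x : dexp k i j x k = - x.1%:~R - 1.
Proof. by rewrite !ffunE eqxx !eqs !add0r. Qed.
Lemma dexp_i x : dexp k i j x i = x.1%:~R - x.2%:R.
Proof. by rewrite !ffunE eqxx !eqs !addr0. Qed.
Lemma dexp_j x : dexp k i j x j = x.2%:R.
Proof. by rewrite !ffunE eqxx !eqs !addr0 add0r. Qed.

Lemma dexp_inj : injective (dexp k i j).
Proof.
move=> [n l] [n' l'] e; have := congr1 (fun f : exp3 => f k) e; have := congr1 (fun f : exp3 => f j) e.
rewrite !dexp_k !dexp_j /= => /eqP; rewrite eqr_nat => /eqP ->.
by move/addIr/oppr_inj/eqP; rewrite eqr_int => /eqP ->.
Qed.

Lemma fdelta_dexp (s t : K) x : fdelta k i j s t (dexp k i j x) = dcoef s t x.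
Proof.
case: x => n l; rewrite /fdelta /fsum (@fsum_one _ _ n); last first.
  move=> n' nn'; rewrite /binpow /fsum fsum_zero ?mulr0 // => l'; rewrite /fmon.
  case: eqP => // /(congr1 (fun f : exp3 => f k)); rewrite ffunE [X in X + _]dexp_k !ffunE !eqs eqxx addr0.
  move/eqP; rewrite subr_eq add0r => /eqP/addIr/oppr_inj/eqP.
  by rewrite eqr_int eq_sym (negbTE nn').
rewrite /binpow /fsum (@fsum_one _ _ l).
  by rewrite /fmon /dexp addrK eqxx.
move=> l' ll'; rewrite /fmon /dexp addrK; case: eqP => // /(congr1 (fun f : exp3 => f j)).
rewrite !ffunE eqxx !eqs !add0r => /eqP; rewrite eqr_nat eq_sym.
by rewrite (negbTE ll').
Qed.

Lemma fdelta_out (s t : K) d : (forall x, d != dexp k i j x) -> fdelta k i j s t d = 0.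
Proof.
move=> h; rewrite /fdelta /fsum fsum_zero // => n.
rewrite /binpow /fsum fsum_zero ?mulr0 // => l; rewrite /fmon.
case: eqP => // e; have /eqP[] := h (n, l).
by rewrite /dexp -e subrK.
Qed.

Lemma fmul_fdelta (U : lmodType K) (s t : K) (G : exp3 -> U) e :
  fmul (fdelta k i j s t) G e =
  \sum_(x \in [set: int * nat]) dcoef s t x *: G (e - dexp k i j x).
Proof.
rewrite /fmul (fsum_inj (h := dexp k i j)) //.
- by apply: eq_fsbigr => x _; rewrite fdelta_dexp.
- exact: dexp_inj.
- by move=> d h; rewrite fdelta_out // scale0r.
Qed.

Definition fmul_finite (U : lmodType K) (f : exp3 -> K) (G : exp3 -> U) e :=
  finite_set [set d | f d *: G (e - d) != 0].

Lemma fmul_fdelta_finite (U : lmodType K) (s t : K) (G : exp3 -> U) e :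
  finite_set [set x | dcoef s t x *: G (e - dexp k i j x) != 0] ->
  fmul_finite (fdelta k i j s t) G e.
Proof.
move=> fin; apply: (sub_finite_set _ (finite_image (dexp k i j) fin)) => d /= hd.
have [[x dx]|no] := pselect (exists x, d = dexp k i j x).
  by exists x => //=; rewrite -fdelta_dexp -dx.
move: hd; rewrite fdelta_out ?scale0r ?eqxx // => x.
by apply/eqP => e'; apply: no; exists x.
Qed.

Lemma in_vars_shift (U : zmodType) (F : rat -> rat -> U) (e : exp3) x :
  in_vars i j F (e - dexp k i j x) =
  if e k == - x.1%:~R - 1 then F (e i - x.1%:~R + x.2%:R) (e j - x.2%:R) else 0.
Proof.
rewrite /in_vars; set e' := e - _.
have -> : (e' == zexp i (e' i) + zexp j (e' j)) = (e k == - x.1%:~R - 1).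
  apply/eqP/eqP => [/(congr1 (fun f : exp3 => f k))|ek].
    rewrite [RHS]ffunE !zexp_at !eqs addr0 /e' ffunE [X in _ + X]ffunE dexp_k.
    by move/eqP; rewrite subr_eq0 => /eqP.
  apply: exp3P; rewrite [RHS]ffunE !zexp_at !eqs ?eqxx ?addr0 ?add0r //.
  by rewrite /e' ffunE [X in _ + X]ffunE dexp_k ek subrr.
case: ifP => // _; rewrite /e' !(ffunE, eqxx, eqs) !addr0 add0r.
by congr F; ring.
Qed.

(** The exponent of z_k selects one power n of z_i + s z_j. *)
Lemma fmul_delta_int (U : lmodType K) (s t : K) (F : rat -> rat -> U) (e : exp3) (n : int) :
  e k = - n%:~R - 1 ->
  fmul (fdelta k i j s t) (in_vars i j F) e =
  natsum (fun l => dcoef s t (n, l) *: F (e i - n%:~R + l%:R) (e j - l%:R)).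
Proof.
move=> ek; rewrite fmul_fdelta (fsum_inj (h := fun l => (n, l))).
- by apply: eq_natsum => l; rewrite in_vars_shift /= ek eqxx.
- by move=> l l' [].
- move=> [n' l] h; rewrite in_vars_shift /= ek; case: eqP => [|_]; last by rewrite scaler0.
  move/addIr/oppr_inj/eqP; rewrite eqr_int => /eqP nn'.
  by move: (h l); rewrite nn' eqxx.
Qed.

Lemma fmul_delta_nint (U : lmodType K) (s t : K) (F : rat -> rat -> U) (e : exp3) :
  (forall n : int, e k != - n%:~R - 1) ->
  fmul (fdelta k i j s t) (in_vars i j F) e = 0.
Proof.
move=> ek; rewrite fmul_fdelta fsum_zero // => x.
by rewrite in_vars_shift (negbTE (ek _)) scaler0.
Qed.

Lemma finite_nat_lt N : finite_set [set l : nat | (l < N)%N].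
Proof.
apply: (sub_finite_set _ (finite_seq (iota 0 N))) => l /= h.
by rewrite mem_iota.
Qed.

Lemma fmul_delta_finite (U : lmodType K) (s t : K) (F : rat -> rat -> U) (e : exp3) :
  (forall c c', eventually0 (fun l => F (c + l%:R) (c' - l%:R))) ->
  fmul_finite (fdelta k i j s t) (in_vars i j F) e.
Proof.
move=> ev; apply: fmul_fdelta_finite.
have [[n ek]|no] := pselect (exists n : int, e k = - n%:~R - 1); last first.
  apply: (sub_finite_set _ (finite_set0 _)) => x /=.
  rewrite in_vars_shift; case: (e k =P _) => [h|_]; last by rewrite scaler0 eqxx.
  by case: no; exists x.1.
have [N hN] := ev (e i - n%:~R) (e j).
apply: (sub_finite_set _ (finite_image (fun l => (n, l)) (finite_nat_lt N))).
move=> [n' l] /=; rewrite in_vars_shift /= ek.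
case: (_ - 1 =P _) => [/addIr/oppr_inj/eqP|_]; last by rewrite scaler0 eqxx.
rewrite eqr_int => /eqP <- h; exists l => //=; rewrite ltnNge.
by apply: contra_neqN h => /hN ->; rewrite scaler0.
Qed.

Lemma in_varsC (U : zmodType) (F : rat -> rat -> U) :
  in_vars i j F = in_vars j i (fun a b => F b a).
Proof. by apply/funext => e; rewrite /in_vars addrC. Qed.

End Dexp.

End Delta.

(** * The twisted Jacobi identity in coefficients *)
Section Twist.
Variable R : realType.
Local Notation C := R[i].

(** The monomials of ((z_1 - z_0)/z_2)^(-a). *)
Definition texp (a : rat) (l : nat) : exp3 :=
  zexp z1 (- a - l%:R) + zexp z0 l%:R + zexp z2 a.

Lemma texp_inj a : injective (texp a).
Proof.
move=> l l' /(congr1 (fun f : exp3 => f z0)); rewrite !ffunE /= !addr0 !add0r.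
by move/eqP; rewrite eqr_nat => /eqP.
Qed.

Lemma twist_factorE a d :
  twist_factor R a d = binpow z1 z0 (-1) (- a) (d - zexp z2 a).
Proof.
rewrite /twist_factor /fmul (@fsum_one _ _ (d - zexp z2 a)).
  by rewrite /fmon subKr eqxx /GRing.scale /= mulr1.
move=> d' h; rewrite /fmon; case: eqP => [e|_]; last by rewrite scaler0.
by move: h; rewrite -e subKr eqxx.
Qed.

Lemma twist_texp a l : twist_factor R a (texp a l) = gbinom C (- a) l * (-1) ^+ l.
Proof.
rewrite twist_factorE /texp addrK /binpow /fsum (@fsum_one _ _ l).
  by rewrite /fmon eqxx.
move=> l' ll'; rewrite /fmon; case: eqP => // /(congr1 (fun f : exp3 => f z0)).
by rewrite !ffunE /= !add0r => /eqP; rewrite eqr_nat eq_sym (negbTE ll').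
Qed.

Lemma twist_out a d : (forall l, d != texp a l) -> twist_factor R a d = 0.
Proof.
move=> h; rewrite twist_factorE /binpow /fsum fsum_zero // => l.
rewrite /fmon; case: eqP => // e; have /eqP[] := h l.
by rewrite /texp -e subrK.
Qed.

Lemma twist_in_vars (U : lmodType C) a (F : rat -> rat -> U) (e : exp3) (m : int) :
  e z1 = - a - m%:~R ->
  fmul (twist_factor R a) (in_vars z0 z2 F) e =
  if m is Posz l then (gbinom C (- a) l * (-1) ^+ l) *: F (e z0 - l%:R) (e z2 - a)
  else 0.
Proof.
move=> em; rewrite /fmul (fsum_inj (h := texp a)); first last.
- by move=> d h; rewrite twist_out // scale0r.
- exact: texp_inj.
have inv l : in_vars z0 z2 F (e - texp a l) =
    if m == l then F (e z0 - l%:R) (e z2 - a) else 0.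
  have dis : distinct3 z1 z0 z2 by [].
  rewrite /in_vars; set e' := e - _.
  have e'1 : e' z1 = l%:R - m%:~R by rewrite !ffunE /= em; ring.
  have e'0 : e' z0 = e z0 - l%:R by rewrite !ffunE /=; ring.
  have e'2 : e' z2 = e z2 - a by rewrite !ffunE /=; ring.
  have -> : (e' == zexp z0 (e' z0) + zexp z2 (e' z2)) = (m == l).
    apply/eqP/eqP => [/(congr1 (fun f : exp3 => f z1))|ml].
      rewrite e'1 !ffunE /= addr0 => /eqP; rewrite subr_eq0.
      by rewrite pmulrn eqr_int => /eqP ->.
    apply: (exp3P dis); rewrite [RHS]ffunE !zexp_at /= ?addr0 ?add0r //.
    by rewrite e'1 ml subrr.
  by rewrite e'0 e'2.
case: m em inv => [m|m] em inv; last first.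
  by rewrite fsum_zero // => l; rewrite inv scaler0.
rewrite (@fsum_one _ _ m) => [|l lm]; first by rewrite inv eqxx twist_texp.
by rewrite inv eqz_nat eq_sym (negbTE lm) scaler0.
Qed.

Lemma twist_in_vars0 (U : lmodType C) a (F : rat -> rat -> U) (e : exp3) :
  (forall m : int, e z1 != - a - m%:~R) ->
  fmul (twist_factor R a) (in_vars z0 z2 F) e = 0.
Proof.
move=> h; rewrite /fmul (fsum_inj (h := texp a)); first last.
- by move=> d h'; rewrite twist_out // scale0r.
- exact: texp_inj.
rewrite fsum_zero // => l; rewrite /in_vars; case: eqP => [|_]; last by rewrite scaler0.
move/(congr1 (fun f : exp3 => f z1)); rewrite !ffunE /= !addr0 => e1.
have /eqP[] := h l; rewrite -pmulrn; apply/eqP; rewrite -subr_eq0.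
by rewrite e1.
Qed.

Local Notation iter_side a F := (fmul (twist_factor R a) (in_vars z0 z2 F)).

Section IterSide.
Variables (U : lmodType C) (a : rat) (F : rat -> rat -> U) (e : exp3) (c : int).
Hypothesis ec : e z1 + a = c%:~R.

Let dis : distinct3 z2 z1 z0. Proof. by []. Qed.

Lemma iter_shift (n : int) (l : nat) :
  iter_side a F (e - dexp z2 z1 z0 (n, l)) =
  if n - c - l%:Z is Posz l' then
    (gbinom C (- a) l' * (-1) ^+ l') *: F (e z0 - (l + l')%:R) (e z2 + n%:~R + 1 - a)
  else 0.
Proof.
rewrite (@twist_in_vars _ _ _ _ (n - c - l%:Z)); last first.
  rewrite ffunE [X in _ + X]ffunE (dexp_i dis) /= !intrD !mulrNz -pmulrn -ec; ring.
have -> : (e - dexp z2 z1 z0 (n, l)) z0 = e z0 - l%:R.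
  by rewrite ffunE [X in _ + X]ffunE (dexp_j dis).
have -> : (e - dexp z2 z1 z0 (n, l)) z2 = e z2 + n%:~R + 1.
  by rewrite ffunE [X in _ + X]ffunE (dexp_k dis) /=; ring.
case: (n - c - l%:Z) => l' //; congr (_ *: F _ _).
by rewrite natrD; ring.
Qed.

Hypothesis F0 : eventually0 (fun N => F (e z0 - N%:R) (e z2 + e z1 + N%:R + 1)).

(* The pairs (n, l) that contribute to the coefficient at e: the power N of z_0
   in the product of both binomial series is at least l and is bounded. *)
Let support N0 : seq (int * nat) :=
  [seq (c + N%:Z, l) | N <- iota 0 N0, l <- iota 0 N.+1].

Let support_out N0 (x : int * nat) :
  (forall N, (N0 <= N)%N -> F (e z0 - N%:R) (e z2 + e z1 + N%:R + 1) = 0) ->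
  x \notin support N0 -> iter_side a F (e - dexp z2 z1 z0 x) = 0.
Proof.
case: x => n l h nx; rewrite iter_shift; case E: (n - c - l%:Z) => [l'|//].
have En : n = c + (l + l')%N%:Z by lia.
suff -> : F (e z0 - (l + l')%:R) (e z2 + n%:~R + 1 - a) = 0 by rewrite scaler0.
have -> : e z2 + n%:~R + 1 - a = e z2 + e z1 + (l + l')%:R + 1.
  by rewrite En intrD -ec -pmulrn; ring.
apply: h; rewrite leqNgt; apply: contra nx => lt.
apply/allpairsPdep; exists (l + l')%N, l; split; rewrite ?mem_iota ?En //= ?add0n //.
by rewrite ltnS leq_addr.
Qed.

Lemma iter_side_finite :
  fmul_finite (fdelta z2 z1 z0 (-1) 1) (iter_side a F) e.
Proof.
have [N0 h] := F0; apply: (fmul_fdelta_finite dis).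
apply: (sub_finite_set _ (finite_seq (support N0))) => x /= hx.
by apply: contra_neqT hx => /(support_out h) ->; rewrite scaler0.
Qed.

(** The product of (z_1 - z_0)^n with (z_1 - z_0)^(-a) convolves two binomial
    series; Vandermonde's identity leaves a single one, whose coefficients are
    reflected so as to depend on the exponent of z_1 only. *)
Lemma iter_sideE :
  fmul (fdelta z2 z1 z0 (-1) 1) (iter_side a F) e =
  natsum (fun N => gbinom C (- e z1 - 1) N *: F (e z0 - N%:R) (e z2 + e z1 + N%:R + 1)).
Proof.
have [N0 h] := F0; rewrite (fmul_fdelta dis) (@fsum_seq _ _ (support N0)); first last.
- by move=> x /(support_out h) ->; rewrite scaler0.
- apply: allpairs_uniq_dep => [|N _|[N l] [N' l'] _ _ /= []]; rewrite ?iota_uniq //.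
  by move=> /addrI [->] ->.
rewrite big_allpairs_dep (natsumE (N := N0)); last first.
  by move=> i /h ->; rewrite scaler0.
rewrite -(big_mkord xpredT (fun N => gbinom C (- e z1 - 1) N *:
   F (e z0 - N%:R) (e z2 + e z1 + N%:R + 1))) /index_iota subn0.
apply: eq_big_seq => N _; set f := F _ _.
have -> : iota 0 N.+1 = index_iota 0 N.+1 by rewrite /index_iota subn0.
rewrite big_mkord (eq_bigr (fun l : 'I_N.+1 => ((-1) ^+ N *
   (gbinom C (c + N%:Z)%:~R l * gbinom C (- a) (N - l)%N)) *: f)).
  rewrite -scaler_suml -mulr_sumr gbinom_vandermonde gbinom_reflect mulrA.
  rewrite -expr2 sqrr_sign mul1r; congr (gbinom _ _ _ *: _).
  by rewrite intrD -ec -pmulrn; ring.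
move=> l _; have le : (l <= N)%N by rewrite -ltnS.
rewrite iter_shift; have -> : c + N%:Z - c - l%:Z = (N - l)%N%:Z by lia.
have -> : e z2 + (c + N%:Z)%:~R + 1 - a = e z2 + e z1 + N%:R + 1.
  by rewrite intrD -ec -pmulrn; ring.
rewrite subnKC // scalerA /dcoef /= exp1rz mul1r; congr (_ *: _).
have -> : (-1) ^+ N = (-1) ^+ l * (-1) ^+ (N - l) :> C by rewrite -exprD subnKC.
by ring.
Qed.

End IterSide.

Lemma iter_side0 (U : lmodType C) a (F : rat -> rat -> U) (e : exp3) x :
  (forall c : int, e z1 + a != c%:~R) -> iter_side a F (e - dexp z2 z1 z0 x) = 0.
Proof.
have dis : distinct3 z2 z1 z0 by [].
move=> h; apply: twist_in_vars0 => m.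
rewrite ffunE [X in _ + X]ffunE (dexp_i dis); apply/eqP => em.
have /eqP[] := h (x.1 - x.2%:Z - m).
have -> : e z1 = - a - m%:~R + (x.1%:~R - x.2%:R) by rewrite -em; ring.
by rewrite !intrD !mulrNz -pmulrn; ring.
Qed.

Lemma iter_side0E (U : lmodType C) a (F : rat -> rat -> U) (e : exp3) :
  (forall c : int, e z1 + a != c%:~R) ->
  fmul (fdelta z2 z1 z0 (-1) 1) (iter_side a F) e = 0.
Proof.
move=> h; rewrite fmul_fdelta // fsum_zero // => x.
by rewrite iter_side0 // scaler0.
Qed.

Lemma iter_side_fin (U : lmodType C) a (F : rat -> rat -> U) (e : exp3) :
  (forall c c', eventually0 (fun N => F (c - N%:R) (c' + N%:R))) ->
  fmul_finite (fdelta z2 z1 z0 (-1) 1) (iter_side a F) e.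
Proof.
move=> ev; have [[c ec]|no] := pselect (exists c : int, e z1 + a = c%:~R).
  apply: (iter_side_finite ec); have [N h] := ev (e z0) (e z2 + e z1 + 1).
  by exists N => i /h <-; congr F; ring.
apply: fmul_fdelta_finite => //; apply: (sub_finite_set _ (finite_set0 _)) => x /=.
rewrite iter_side0 ?scaler0 ?eqxx // => c.
by apply/eqP => ec; apply: no; exists c.
Qed.

(** F1, F2 and F3 are the coefficients of the two products and of the iterate.
    Leaving them arbitrary covers vertex algebras, twisted modules and, after
    contraction, twisted comodules. *)
Definition jacobi_at (U : lmodType C) (a : rat) (F1 F2 F3 : rat -> rat -> U) (e : exp3) :=
  fmul (fdelta z0 z1 z2 (-1) 1) (in_vars z1 z2 F1) e
  - fmul (fdelta z0 z2 z1 (-1) (-1)) (in_vars z1 z2 F2) e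
  = fmul (fdelta z2 z1 z0 (-1) 1) (iter_side a F3) e.

(** Borcherds' identity: the coefficient of z_0^(-n-1) z_1^(-p-1) z_2^(-q-1). *)
Definition borcherds_at (U : lmodType C) (F1 F2 F3 : rat -> rat -> U)
    (p q : rat) (n : int) :=
  natsum (fun i => gbinom C p i *: F3 (- n%:~R - 1 - i%:R) (- p - q - 1 + i%:R))
  = natsum (fun i => (gbinom C n%:~R i * (-1) ^+ i) *:
      F1 (- p - 1 - n%:~R + i%:R) (- q - 1 - i%:R))
  - (-1) ^ n *: natsum (fun i => (gbinom C n%:~R i * (-1) ^+ i) *:
      F2 (- p - 1 - i%:R) (- q - 1 - n%:~R + i%:R)).

Section JacobiBorcherds.
Variables (U : lmodType C) (a : rat) (F1 F2 F3 : rat -> rat -> U).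
Hypothesis ev2 : forall c c', eventually0 (fun l => F2 (c - l%:R) (c' + l%:R)).
Hypothesis ev3 : forall c c', eventually0 (fun N => F3 (c - N%:R) (c' + N%:R)).

Lemma commutator_sideE (e : exp3) (n : int) : e z0 = - n%:~R - 1 ->
  fmul (fdelta z0 z1 z2 (-1) 1) (in_vars z1 z2 F1) e
  - fmul (fdelta z0 z2 z1 (-1) (-1)) (in_vars z1 z2 F2) e =
  natsum (fun i => (gbinom C n%:~R i * (-1) ^+ i) *:
      F1 (e z1 - n%:~R + i%:R) (e z2 - i%:R))
  - (-1) ^ n *: natsum (fun i => (gbinom C n%:~R i * (-1) ^+ i) *:
      F2 (e z1 - i%:R) (e z2 - n%:~R + i%:R)).
Proof.
move=> en; rewrite (@fmul_delta_int _ z0 z1 z2 isT _ _ _ _ _ _ en).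
rewrite in_varsC (@fmul_delta_int _ z0 z2 z1 isT _ _ _ _ _ _ en).
congr (_ - _); first by apply: eq_natsum => i; rewrite /dcoef exp1rz mul1r.
rewrite (natsum_linear (f := *:%R ((-1) ^ n))).
- by apply: eq_natsum => i; rewrite /dcoef scalerA /= -exprz_inv invrN1.
- by move=> x u v; rewrite scalerDr !scalerA mulrC.
- have [N h] := ev2 (e z1) (e z2 - n%:~R).
  by exists N => i /h ->; rewrite scaler0.
Qed.

Lemma jacobi_borcherds :
  (forall e, jacobi_at a F1 F2 F3 e) ->
  forall p q n, is_int (p - a) -> borcherds_at F1 F2 F3 p q n.
Proof.
move=> jac p q n [c pc].
pose e : exp3 := zexp z0 (- n%:~R - 1) + zexp z1 (- p - 1) + zexp z2 (- q - 1).
have e0 : e z0 = - n%:~R - 1 by rewrite !ffunE /= !addr0.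
have e1 : e z1 = - p - 1 by rewrite !ffunE /= addr0 add0r.
have e2 : e z2 = - q - 1 by rewrite !ffunE /= !add0r.
have ec : e z1 + a = (- c - 1)%:~R.
  by rewrite e1 intrD !mulrNz -pc; ring.
have := jac e; rewrite /jacobi_at (commutator_sideE e0) (iter_sideE ec).
  rewrite /borcherds_at e0 e1 e2 => ->; apply: eq_natsum => i.
  congr (gbinom _ _ _ *: F3 _ _); ring.
have [N h] := ev3 (e z0) (e z2 + e z1 + 1).
by exists N => i /h <-; congr F3; ring.
Qed.

Hypothesis int1 : forall x y, ~ is_int (x + a) -> F1 x y = 0.
Hypothesis int2 : forall x y, ~ is_int (x + a) -> F2 x y = 0.
Hypothesis int3 : forall x y, ~ is_int x -> F3 x y = 0.

(** At exponents outside the cosets allowed by the support conditions all terms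
    vanish, and elsewhere a coefficient is an instance of Borcherds'
    identity. *)
Lemma borcherds_jacobi :
  (forall p q n, is_int (p - a) -> borcherds_at F1 F2 F3 p q n) ->
  forall e, jacobi_at a F1 F2 F3 e.
Proof.
move=> bor e; rewrite /jacobi_at.
have [[n en]|nn] := pselect (exists n : int, e z0 = - n%:~R - 1); last first.
  have nn' (n : int) : e z0 != - n%:~R - 1.
    by apply/eqP => en; apply: nn; exists n.
  rewrite fmul_delta_nint // in_varsC fmul_delta_nint // subr0; apply: esym.
  have [[c ec]|no] := pselect (exists c : int, e z1 + a = c%:~R); last first.
    by apply: iter_side0E => c; apply/eqP => ec; apply: no; exists c.
  have F30 N y : F3 (e z0 - N%:R) y = 0.
    apply: int3 => -[k ek]; apply: nn; exists (- k - N%:Z - 1).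
    by rewrite !intrD !mulrNz -pmulrn -ek; ring.
  rewrite (iter_sideE ec) /natsum; last by exists 0%N => i _; rewrite F30.
  by apply: fsum_zero => N; rewrite F30 scaler0.
rewrite (commutator_sideE en).
have [[c ec]|no] := pselect (exists c : int, e z1 + a = c%:~R); last first.
  have no' (k : int) : ~ is_int (e z1 + k%:~R + a).
    move=> [c ec]; apply: no; exists (c - k).
    by rewrite intrD mulrNz -ec; ring.
  rewrite /natsum !fsum_zero.
  - rewrite scaler0 subr0 iter_side0E // => c.
    by apply/eqP => ec; apply: no; exists c.
  - move=> i; rewrite int2 ?scaler0 // => -[k ek].
    by apply: (no' (- i%:Z)); exists k; rewrite -ek mulrNz -pmulrn.
  - move=> i; rewrite int1 ?scaler0 // => -[k ek].
    apply: (no' (- n + i%:Z)); exists k; rewrite -ek intrD mulrNz -pmulrn.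
    by rewrite addrA.
rewrite (iter_sideE ec); last first.
  have [N h] := ev3 (e z0) (e z2 + e z1 + 1).
  by exists N => i /h <-; congr F3; ring.
have := bor (- e z1 - 1) (- e z2 - 1) n; rewrite /borcherds_at en.
have -> : - (- e z1 - 1) - 1 = e z1 by ring.
have -> : - (- e z2 - 1) - 1 = e z2 by ring.
have -> : - (- e z1 - 1) - (- e z2 - 1) - 1 = e z2 + e z1 + 1 by ring.
move=> h; rewrite -h.
  by apply: eq_natsum => i; congr (_ *: F3 _ _); ring.
exists (- c - 1); rewrite intrD !mulrNz -ec; ring.
Qed.

End JacobiBorcherds.
End Twist.

(** * Eigenspaces of an operator of finite order *)
Section Eigen.
Variable R : realType.
Local Notation C := R[i].

Lemma cisD (x y : R) : cis (x + y) = cis x * cis y.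
Proof. by rewrite /cis cosD sinD; apply/eqP; rewrite eq_complex /= eqxx /= addrC. Qed.

Lemma cis0 : cis (0 : R) = 1.
Proof. by rewrite /cis cos0 sin0. Qed.

Lemma zetaD T r s : zeta R T (r + s) = zeta R T r * zeta R T s.
Proof. by rewrite /zeta -cisD natrD mulrDr mulrDl. Qed.

Lemma zeta0 T : zeta R T 0 = 1.
Proof. by rewrite /zeta mulr0 mul0r cis0. Qed.

Lemma zetaX T r n : zeta R T (r * n) = zeta R T r ^+ n.
Proof.
by elim: n => [|n IH]; rewrite ?muln0 ?zeta0 // mulnS zetaD IH exprS.
Qed.

Lemma zetaT T : (0 < T)%N -> zeta R T T = 1.
Proof.
move=> T0; rewrite /zeta mulfK ?pnatr_eq0 -?lt0n //.
have -> : 2 * pi = pi *+ 2 :> R by rewrite mulr_natl.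
by rewrite /cis cos2pi sin2pi.
Qed.

Lemma zeta_neq0 T r : zeta R T r != 0.
Proof.
apply/eqP => /eqP; rewrite eq_complex /= => /andP[/eqP c0 /eqP s0].
have := cos2Dsin2 (2 * pi * r%:R / T%:R : R).
by rewrite c0 s0 expr0n /= addr0 => /eqP; rewrite eq_sym oner_eq0.
Qed.

(** With x = pi j/T in (0, pi), the real part is 1 - 2 sin(x)^2 < 1. *)
Lemma zeta_neq1 T j : (0 < j < T)%N -> zeta R T j != 1.
Proof.
move=> /andP[j0 jT]; pose x : R := pi * j%:R / T%:R.
have T0 : 0 < T%:R :> R by rewrite ltr0n (leq_ltn_trans _ jT).
have xpi : 0 < x < pi.
  rewrite /x divr_gt0 ?mulr_gt0 ?pi_gt0 ?ltr0n ?(ltn_trans j0 jT) //=.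
  by rewrite ltr_pdivrMr // ltr_pM2l ?pi_gt0 // ltr_nat.
have /lt0r_neq0 sx := sin_gt0_pi xpi.
rewrite eq_complex /= negb_and; apply/orP; left.
have -> : 2 * pi * j%:R / T%:R = x *+ 2 by rewrite /x -[RHS]mulr_natl !mulrA.
rewrite cos_mulr2n cos2sin2; apply: contra_neq sx => e.
by apply/eqP; rewrite -sqrf_eq0; apply/eqP; lra.
Qed.

Lemma zeta_inj T r s : (r < T)%N -> (s < T)%N -> zeta R T r = zeta R T s -> r = s.
Proof.
wlog rs : r s / (r <= s)%N => [W|] rT sT e.
  by have [/W|/ltnW/W] := leqP r s; [exact | move/(_ sT rT (esym e))].
move: e; rewrite -(subnK rs) zetaD -[LHS]mul1r => /(mulIf (zeta_neq0 _ _)) e.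
have [->|sr] := posnP (s - r)%N; first by [].
have /zeta_neq1 : (0 < s - r < T)%N by rewrite sr (leq_ltn_trans (leq_subr _ _)).
by rewrite -e eqxx.
Qed.

Lemma zeta_geom T r : (r < T)%N ->
  \sum_(j < T) zeta R T r ^+ j = if r == 0%N then T%:R else 0.
Proof.
move=> rT; have T0 : (0 < T)%N by exact: leq_ltn_trans rT.
case: posnP => [->|r0].
  by under eq_bigr do rewrite zeta0 expr1n; rewrite sumr_const card_ord.
have zn1 : zeta R T r - 1 != 0 by rewrite subr_eq0 zeta_neq1 // r0.
apply: (mulfI zn1); rewrite -subrX1 mulr0 -zetaX mulnC zetaX zetaT //.
by rewrite expr1n subrr.
Qed.

Section Proj.
Variables (V : lmodType C) (g : V -> V) (T : nat).
Hypotheses (lg : linear g) (T0 : (0 < T)%N) (gT : iter T g =1 id).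
Local Notation P := (eigenproj g T).

Lemma iter_linear j : linear (iter j g).
Proof. by elim: j => [|j IH] a u v //=; rewrite IH lg. Qed.

Lemma eigenproj_linear r : linear (P r).
Proof.
move=> a u v; rewrite /eigenproj scalerA [a * _]mulrC -scalerA -scalerDr; congr (_ *: _).
rewrite scaler_sumr -big_split; apply: eq_bigr => j _ /=.
by rewrite iter_linear scalerDr !scalerA [a * _]mulrC.
Qed.

(** Summing over r first, orthogonality of the characters of Z/T leaves only the
    zeroth power of g. *)
Lemma eigenproj_sum v : \sum_(r < T) P r v = v.
Proof.
rewrite /eigenproj -scaler_sumr exchange_big /=.
rewrite (bigD1 (Ordinal T0)) //= addrC big1 => [|j j0]; last first.
  rewrite -scaler_suml (_ : \sum_(i < T) _ = 0) ?scale0r //.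
  have jT : (0 < j < T)%N by rewrite ltn_ord lt0n j0.
  rewrite (eq_bigr (fun i : 'I_T => (zeta R T (T - j)) ^+ i)) => [|i _].
    rewrite zeta_geom; last by rewrite ltn_subrL T0; case/andP: jT => ->.
    by rewrite subn_eq0 leqNgt ltn_ord.
  rewrite -zetaX mulnC zetaX -exprVn.
  have -> : zeta R T (T - j) = (zeta R T j)^-1.
    apply: (mulIf (zeta_neq0 T j)); rewrite mulVf ?zeta_neq0 // -zetaD.
    by rewrite subnK ?zetaT // ltnW.
  by [].
rewrite add0r (eq_bigr (fun=> v)) => [|i _]; last by rewrite expr0 invr1 scale1r.
by rewrite sumr_const card_ord -[v *+ _]scaler_nat scalerA mulVf ?scale1r // pnatr_eq0 -lt0n.
Qed.

(** Applying g rotates the T terms of the average cyclically. *)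
Lemma eigenproj_eigen r v : eigenpart g T r (P r v).
Proof.
rewrite /eigenpart /= /eigenproj (linear_funZ _ _ lg) !scalerA [zeta _ _ _ * _]mulrC -scalerA.
congr (_ *: _); rewrite (linear_sumE _ _ _ lg) scaler_sumr.
have E j : g (zeta R T r ^- j *: iter j g v) = zeta R T r *: (zeta R T r ^- j.+1 *: iter j.+1 g v).
  by rewrite (linear_funZ _ _ lg) !scalerA exprSr invfM mulrCA mulfV ?zeta_neq0 // mulr1.
under eq_bigr do rewrite E.
pose F j := zeta R T r *: (zeta R T r ^- j *: iter j g v).
have FT : F T = F 0%N.
  by rewrite /F gT -[_ ^+ T]zetaX mulnC zetaX zetaT // expr1n.
rewrite -[LHS]/(\sum_(i < T) F i.+1) -[RHS]/(\sum_(i < T) F i).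
clear E; case: T FT => [|n] FT; first by rewrite !big_ord0.
by rewrite big_ord_recr big_ord_recl /= FT addrC.
Qed.

End Proj.
End Eigen.

(** * Graded spaces, dual bases and tensors *)

Section Graded.
Variable K : fieldType.
Variable V : lmodType K.

Lemma subspaceD (S : set V) u v : is_subspace S -> S u -> S v -> S (u + v).
Proof. by move=> [_ h] Su Sv; have := h 1 u v Su Sv; rewrite scale1r. Qed.
Lemma subspaceZ (S : set V) a u : is_subspace S -> S u -> S (a *: u).
Proof. by move=> [h0 h] Su; have := h a u 0 Su h0; rewrite addr0. Qed.
Lemma subspace_big (S : set V) (I : Type) (s : seq I) (F : I -> V) : is_subspace S ->
  (forall i, S (F i)) -> S (\sum_(i <- s) F i).
Proof.
move=> sS h; apply: (big_rec S) => [|i x _ Sx]; first by case: sS.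
exact: subspaceD.
Qed.

Lemma span_min (A S : set V) : is_subspace S -> A `<=` S -> span A `<=` S.
Proof.
move=> sS AS v [n [a [x [Ax ->]]]]; apply: subspace_big => // i.
by apply: subspaceZ => //; exact: AS.
Qed.

Lemma span_gen (A : set V) v : A v -> span A v.
Proof.
move=> Av; exists 1%N, (fun=> 1), (fun=> v); split => //.
by rewrite big_ord1 scale1r.
Qed.

Lemma span_subspace (A : set V) : is_subspace (span A).
Proof.
split; first by exists 0%N, (fun=> 0), (fun=> 0); split => [[]|] //; rewrite big_ord0.
move=> c u v [n [a [x [Ax ->]]]] [m [b [y [By ->]]]].
pose co (i : 'I_(n + m)) := match fintype.split i with inl i => c * a i | inr i => b i end.
pose ve (i : 'I_(n + m)) := match fintype.split i with inl i => x i | inr i => y i end.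
exists (n + m)%N, co, ve; split; first by move=> i; rewrite /ve; case: fintype.split.
rewrite big_split_ord /= scaler_sumr; congr (_ + _); apply: eq_bigr => i _.
  by rewrite /co /ve -[lshift _ _]/(unsplit (inl i)) unsplitK scalerA.
by rewrite /co /ve -[rshift _ _]/(unsplit (inr i)) unsplitK.
Qed.

Section DirectSum.
Variables (I : choiceType) (S : I -> set V).
Hypothesis dS : direct_sum S.

Lemma component_sum v : exists s : seq I, [/\ uniq s,
  v = \sum_(i <- s) component S i v & forall i, i \notin s -> component S i v = 0].
Proof.
have [_ fin su] := direct_sum_component dS v.
pose s := fset_set [set i | component S i v != 0].
have out i : i \notin (s : seq I) -> component S i v = 0.
  move=> nis; apply/eqP/negPn/negP => h; move/negP: nis; apply.
  by rewrite /s in_fset_set //; apply/mem_set.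
exists s; split => //.
by rewrite -[LHS]su (fsum_seq (fset_uniq s)).
Qed.

Lemma component_in i v : S i (component S i v).
Proof. by have [] := direct_sum_component dS v. Qed.

Lemma graded_ind (P : V -> Prop) : P 0 -> (forall u v, P u -> P v -> P (u + v)) ->
  (forall i v, S i v -> P v) -> forall v, P v.
Proof.
move=> P0 PD Ph v; have [s [_ -> _]] := component_sum v.
by elim/big_rec: _ => // i x _; apply: PD; apply: Ph; exact: component_in.
Qed.

Lemma component_id i v : S i v -> component S i v = v.
Proof.
move=> Sv; have [s [us e out]] := component_sum v.
rewrite {2}e; have [is_|nis] := boolP (i \in s).
  rewrite (bigD1_seq i) //= big1 ?addr0 // => j ji.
  exact: (component_out dS Sv).
rewrite out // big1_seq // => j /andP[_ js]; apply: (component_out dS Sv).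
by apply: contraNneq nis => <-.
Qed.

Lemma gr_subspace i : is_subspace (S i).
Proof. by case: dS. Qed.

End DirectSum.

(** A spanning family of minimal length is free. The projection p onto S makes
    the coordinate forms of S available on the whole space. *)
Lemma dual_basis_fin (S : set V) (p : V -> V) : is_subspace S -> linear p ->
  (forall v, S (p v)) -> (forall v, S v -> p v = v) -> finite_dim S ->
  exists n (b : 'I_n -> V) (f : 'I_n -> V -> K),
  [/\ forall i, S (b i), forall i, linear (f i : V -> K^o)
    & forall v, p v = \sum_(i < n) f i v *: b i].
Proof.
move=> sS lp Sp pid [x Sx].
pose spans n := exists b : 'I_n -> V, (forall i, S (b i)) /\
  forall v, exists c : 'I_n -> K, p v = \sum_(i < n) c i *: b i.
have exn : exists n, (fun n => `[< spans n >]) n.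
  exists (size x); apply/asboolP; exists (fun i => p x`_i); split => // v.
  pose A := [set v | exists c : 'I_(size x) -> K, p v = \sum_i c i *: p x`_i].
  have sA : is_subspace A.
    split; first by exists (fun=> 0); rewrite (linear_fun0 lp) big1 // => i _; rewrite scale0r.
    move=> a u w [c ec] [d ed]; exists (fun i => a * c i + d i).
    rewrite lp ec ed scaler_sumr -big_split; apply: eq_bigr => i _.
    by rewrite scalerDl scalerA.
  have : A (p v).
    apply: (span_min sA _ (Sx _ (Sp v))) => u /= ux.
    have lt : (index u x < size x)%N by rewrite index_mem.
    exists (fun i => (i == Ordinal lt)%:R).
    rewrite (bigD1 (Ordinal lt)) //= eqxx scale1r nth_index // big1 ?addr0 //.
    by move=> i /negbTE ->; rewrite scale0r.
  by rewrite /A /= pid.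
have [n /asboolP[b [Sb bspan]] nmin] := ex_minnP exn.
have free c : \sum_(i < n) c i *: b i = 0 -> forall i, c i = 0.
  move=> c0 k; apply/eqP/negPn/negP => ck.
  case: n b Sb bspan nmin c c0 k ck => [|n] b Sb bspan nmin c c0 k ck; first by case: k ck.
  suff /nmin : `[< spans n >] by rewrite ltnn.
  apply/asboolP; exists (fun i => b (lift k i)); split => // v.
  have [d ed] := bspan v; exists (fun i => d (lift k i) - d k / c k * c (lift k i)).
  have : p v = \sum_i (d i - d k / c k * c i) *: b i.
    have h : (d k / c k) *: (\sum_i c i *: b i) = 0 by rewrite c0 scaler0.
    under [RHS]eq_bigr do rewrite scalerBl -scalerA.
    by rewrite sumrB -scaler_sumr h subr0.
  by rewrite (bigD1_ord k) //= divfK // subrr scale0r add0r.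
pose f i v := projT1 (cid (bspan v)) i.
have fE v : p v = \sum_(i < n) f i v *: b i by rewrite /f; case: cid.
exists n, b, f; split => // i a u v.
apply/eqP; rewrite -subr_eq0; apply/eqP.
apply: (free (fun i => f i (a *: u + v) - (a * f i u + f i v))).
under eq_bigr do rewrite scalerBl scalerDl -scalerA.
by rewrite sumrB big_split /= -scaler_sumr -!fE lp subrr.
Qed.

End Graded.

Section TensorFacts.
Variable K : fieldType.

Lemma tensor_ind (V W : lmodType K) (P : tensor V W -> Prop) :
  P 0 -> (forall x y, P x -> P y -> P (x + y)) -> (forall v w, P (ptens v w)) ->
  forall x, P x.
Proof.
by move=> P0 PD Pp x; rewrite [x]tensor_sum; elim/big_rec: _ => // i y _; apply: PD.
Qed.

Section Forms.
Variables V W : lmodType K.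
Implicit Types (f : V -> K^o) (v : V) (w : W).

Lemma tforml_linear f : linear f -> linear (tforml f : tensor V W -> W).
Proof. by move=> lf; exact: tlift_linear (tforml_bilinear _ lf). Qed.

Lemma tforml_pt f v w : linear f -> tforml f (ptens v w) = f v *: w.
Proof. by move=> lf; rewrite /tforml tliftE //; exact: tforml_bilinear. Qed.

Lemma tpair_linear f (h : W -> K^o) : linear f -> linear h -> linear (tpair f h).
Proof. by move=> lf lh; exact: tlift_linear (tpair_bilinear lf lh). Qed.

Lemma tpair_pt f (h : W -> K^o) v w : linear f -> linear h ->
  tpair f h (ptens v w) = f v * h w.
Proof. by move=> lf lh; rewrite /tpair tliftE //; exact: tpair_bilinear. Qed.

Lemma ptensDl v v' w : ptens (v + v') w = ptens v w + ptens v' w :> tensor V W.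
Proof. exact: (linear_funD (f := fun v => ptens v w) _ _ ((ptens_bilinear V W).1 w)). Qed.
Lemma ptensDr v w w' : ptens v (w + w') = ptens v w + ptens v w' :> tensor V W.
Proof. exact: (linear_funD (f := ptens v) _ _ ((ptens_bilinear V W).2 v)). Qed.
Lemma ptensZl a v w : ptens (a *: v) w = a *: ptens v w :> tensor V W.
Proof. exact: (linear_funZ (f := fun v => ptens v w) _ _ ((ptens_bilinear V W).1 w)). Qed.
Lemma ptensZr a v w : ptens v (a *: w) = a *: ptens v w :> tensor V W.
Proof. exact: (linear_funZ (f := ptens v) _ _ ((ptens_bilinear V W).2 v)). Qed.
Lemma ptens0l w : ptens (0 : V) w = 0 :> tensor V W.
Proof. exact: (linear_fun0 (f := fun v => ptens v w) ((ptens_bilinear V W).1 w)). Qed.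
Lemma ptens0r v : ptens v (0 : W) = 0 :> tensor V W.
Proof. exact: (linear_fun0 (f := ptens v) ((ptens_bilinear V W).2 v)). Qed.
Lemma ptens_suml (I : Type) (s : seq I) (F : I -> V) w :
  ptens (\sum_(i <- s) F i) w = \sum_(i <- s) ptens (F i) w :> tensor V W.
Proof. exact: (linear_sumE (f := fun v => ptens v w) _ _ _ ((ptens_bilinear V W).1 w)). Qed.
Lemma ptens_sumr (I : Type) (s : seq I) v (F : I -> W) :
  ptens v (\sum_(i <- s) F i) = \sum_(i <- s) ptens v (F i) :> tensor V W.
Proof. exact: (linear_sumE (f := ptens v) _ _ _ ((ptens_bilinear V W).2 v)). Qed.

End Forms.

Section Maps.
Variables V W V' W' : lmodType K.

Lemma tmap_linear (f : V -> V') (h : W -> W') : linear f -> linear h -> linear (tmap f h).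
Proof. by move=> lf lh; exact: tlift_linear (tmap_bilinear lf lh). Qed.
Lemma tmap_pt (f : V -> V') (h : W -> W') v w : linear f -> linear h ->
  tmap f h (ptens v w) = ptens (f v) (h w).
Proof. by move=> lf lh; rewrite /tmap tliftE //; exact: tmap_bilinear. Qed.

Lemma tswap_bilinear : bilinear_fun (fun (v : V) (w : W) => ptens w v).
Proof.
by split=> [w a u v|v a u w]; rewrite ?ptensDr ?ptensZr ?ptensDl ?ptensZl.
Qed.
Lemma tswap_linear : linear (@tswap K V W).
Proof. exact: tlift_linear tswap_bilinear. Qed.
Lemma tswap_pt (v : V) (w : W) : tswap (ptens v w) = ptens w v.
Proof. by rewrite /tswap tliftE //; exact: tswap_bilinear. Qed.

Lemma tassoc_in_bilinear (u : V) :
  bilinear_fun (fun (v : W) (w : W') => ptens (ptens u v) w).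
Proof.
by split=> [w a x y|v a x y]; rewrite ?ptensDr ?ptensZr ?ptensDl ?ptensZl.
Qed.
Lemma tassoc_bilinear : bilinear_fun (fun (u : V) (x : tensor W W') =>
   tlift (fun v w => ptens (ptens u v) w) x).
Proof.
split=> [x a u v|u]; last exact: tlift_linear (tassoc_in_bilinear u).
elim/tensor_ind: x => [|x y IHx IHy|v' w].
- by rewrite !(linear_fun0 (tlift_linear (tassoc_in_bilinear _))) scaler0 addr0.
- rewrite !(linear_funD _ _ (tlift_linear (tassoc_in_bilinear _))) IHx IHy.
  by rewrite scalerDr addrACA.
- rewrite !tliftE; try exact: tassoc_in_bilinear.
  by rewrite !ptensDl !ptensZl.
Qed.
Lemma tassoc_linear : linear (@tassoc K V W W').
Proof. exact: tlift_linear tassoc_bilinear. Qed.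
Lemma tassoc_pt (u : V) (v : W) (w : W') :
  tassoc (ptens u (ptens v w)) = ptens (ptens u v) w.
Proof.
rewrite /tassoc tliftE; last exact: tassoc_bilinear.
by rewrite tliftE //; exact: tassoc_in_bilinear.
Qed.

End Maps.
End TensorFacts.

(** * Contraction of tensors and of formal series *)

Lemma rat_bound (x : rat) : exists N : nat, forall i, (N <= i)%N -> x < i%:R.
Proof.
exists (Num.bound `|x|) => i le; apply: le_lt_trans (ler_norm _) _.
by apply: lt_le_trans (archi_boundP (normr_ge0 x)) _; rewrite ler_nat.
Qed.

Lemma field_of_int (A : Type) (U : zmodType) (D : int -> A -> U) v (k : int) :
  field_of D v (- k%:~R - 1) = D k v.
Proof.
rewrite /field_of /fsum (@fsum_one _ _ k) /fmon ?eqxx // => i ik.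
case: eqP => // /addIr/oppr_inj/eqP; rewrite eqr_int eq_sym.
by rewrite (negbTE ik).
Qed.

Lemma field_of_nint (A : Type) (U : zmodType) (D : int -> A -> U) v e :
  ~ is_int e -> field_of D v e = 0.
Proof.
move=> ne; rewrite /field_of /fsum fsum_zero // => k; rewrite /fmon.
by case: eqP => // ->  in ne *; case: ne; exists (- k - 1); rewrite intrD mulrNz.
Qed.

(** Case analysis on the exponent, integral or not, for properties of the
    coefficients of a series with integral exponents. *)
Lemma field_ofP (A : Type) (U : zmodType) (D : int -> A -> U) (P : rat -> U -> Prop) v :
  (forall k : int, P (- k%:~R - 1) (D k v)) -> (forall e, ~ is_int e -> P e 0) ->
  forall e, P e (field_of D v e).
Proof.
move=> h1 h2 e; have [[k ->]|ne] := pselect (is_int e); last first.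
  by rewrite field_of_nint //; exact: h2.
have -> : k%:~R = - (- k - 1)%:~R - 1 :> rat by rewrite intrD !mulrNz; ring.
by rewrite field_of_int.
Qed.

Lemma field_of_linear (K : fieldType) (W U : lmodType K) (D : int -> {linear W -> U}) e :
  linear (fun v => field_of D v e).
Proof.
have [[k ->]|ne] := pselect (is_int e); last first.
  by move=> a u v; rewrite !field_of_nint // scaler0 addr0.
have -> : k%:~R = - (- k - 1)%:~R - 1 :> rat by rewrite intrD !mulrNz; ring.
by move=> a u v; rewrite !field_of_int linearP.
Qed.

Lemma fmul_linear (K : numFieldType) (U W : lmodType K) (phi : U -> W)
    (f : exp3 -> K) (G : exp3 -> U) e : linear phi -> fmul_finite f G e ->
  phi (fmul f G e) = fmul f (fun d => phi (G d)) e.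
Proof.
move=> lp fin; rewrite /fmul linear_fsum //.
by apply: eq_fsbigr => d _; rewrite (linear_funZ _ _ lp).
Qed.

Lemma in_vars_linear (K : numFieldType) (U W : lmodType K) (phi : U -> W) i j
    (F : rat -> rat -> U) : linear phi ->
  (fun d => phi (in_vars i j F d)) = in_vars i j (fun a b => phi (F a b)).
Proof.
move=> lp; apply/funext => d; rewrite /in_vars; case: ifP => // _.
exact: linear_fun0.
Qed.

Section Pairings.
Variable R : realType.
Local Notation C := R[i].
Variables (V M : lmodType C).
Implicit Types u v : V -> C^o.

(** Here the order of composition gets reversed: the form u on the factor that
    was split off first is applied before h. *)
Lemma tforml_assoc u v (h : M -> tensor V M) y : linear u -> linear v -> linear h ->
  tforml (tpair u v) (tassoc (tmap id h y)) = tforml v (h (tforml u y)).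
Proof.
move=> lu lv lh; have lp := tpair_linear lu lv.
have lta := linear_comp (tforml_linear (W := M) lp) (@tassoc_linear _ V V M).
have ltv := tforml_linear (W := M) lv; have ltu := tforml_linear (W := M) lu.
have lm : linear (tmap id h : tensor V M -> _) by apply: tmap_linear.
apply: (linear_tensor_ext (linear_comp lta lm) (linear_comp (linear_comp ltv lh) ltu)) => x m.
rewrite tmap_pt // tforml_pt // (linear_funZ _ _ lh) (linear_funZ _ _ ltv).
have lx : linear (fun z : tensor V M => ptens x z) := (ptens_bilinear _ _).2 x.
have lux : linear (fun z => u x *: tforml v z : M).
  by move=> a z z'; rewrite ltv scalerDr !scalerA mulrC.
apply: (linear_tensor_ext (linear_comp lta lx) lux) => x' m'.
by rewrite tassoc_pt tforml_pt // tpair_pt // tforml_pt // scalerA.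
Qed.

Lemma tforml_form (W : lmodType C) a (f1 f2 : W -> C^o) (y : tensor W M) :
  linear f1 -> linear f2 ->
  tforml (fun x => a * f1 x + f2 x) y = a *: tforml f1 y + tforml f2 y.
Proof.
move=> l1 l2; have l12 : linear (fun x => a * f1 x + f2 x : C^o).
  by move=> c x z; rewrite l1 l2 /GRing.scale /=; ring.
have t1 := tforml_linear (W := M) l1; have t2 := tforml_linear (W := M) l2.
have t12 : linear (fun z => a *: tforml f1 z + tforml f2 z : M).
  by move=> c x z; rewrite t1 t2 !scalerDr !scalerA mulrC addrACA.
apply: (linear_tensor_ext (tforml_linear l12) t12) => x m.
by rewrite !tforml_pt // scalerDl scalerA.
Qed.

Lemma tpair_swap u v z : linear u -> linear v -> tpair u v (tswap z) = tpair v u z.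
Proof.
move=> lu lv; have lps := linear_comp (tpair_linear lu lv) (@tswap_linear _ V V).
apply: (linear_tensor_ext lps (tpair_linear lv lu)) => x m.
by rewrite tswap_pt !tpair_pt // mulrC.
Qed.

Lemma tforml_tmap (W : lmodType C) (f : W -> C^o) (h : V -> W) (y : tensor V M) :
  linear f -> linear h -> tforml f (tmap h id y) = tforml (fun x => f (h x)) y.
Proof.
move=> lf lh; have lm : linear (tmap h id : tensor V M -> _) by apply: tmap_linear.
have lfh := linear_comp lf lh; have ltf := tforml_linear (W := M) lf.
apply: (linear_tensor_ext (linear_comp ltf lm) (tforml_linear lfh)) => x m.
by rewrite tmap_pt // !tforml_pt.
Qed.

Lemma tforml_tmapr (W : lmodType C) u (h : M -> W) (y : tensor V M) :
  linear u -> linear h -> tforml u (tmap id h y) = h (tforml u y).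
Proof.
move=> lu lh; have lm : linear (tmap id h : tensor V M -> _) by apply: tmap_linear.
have lt := linear_comp lh (tforml_linear (W := M) lu).
apply: (linear_tensor_ext (linear_comp (tforml_linear lu) lm) lt) => x m.
by rewrite tmap_pt // !tforml_pt // (linear_funZ _ _ lh).
Qed.

Lemma tforml_swap u v (y : tensor (tensor V V) M) : linear u -> linear v ->
  tforml (tpair u v) (tmap (@tswap _ V V) id y) = tforml (tpair v u) y.
Proof.
move=> lu lv; have lp := tpair_linear lu lv; have lp' := tpair_linear lv lu.
have lm := tmap_linear (@tswap_linear _ V V) (linearP (@idfun M)).
apply: (linear_tensor_ext (linear_comp (tforml_linear lp) lm) (tforml_linear lp')) => z m.
by rewrite tmap_pt ?tforml_pt ?tpair_swap //; exact: tswap_linear.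
Qed.

Lemma tpair_tforml u (w : M -> C^o) (y : tensor V M) : linear u -> linear w ->
  tpair u w y = w (tforml u y).
Proof.
move=> lu lw; have lt := linear_comp lw (tforml_linear (W := M) lu).
apply: (linear_tensor_ext (tpair_linear lu lw) lt) => x m.
by rewrite tpair_pt // tforml_pt // (linear_funZ _ _ lw).
Qed.

Lemma tpair_tformr u (w : M -> C^o) (y : tensor V M) : linear u -> linear w ->
  tpair u w y = u (tformr w y).
Proof.
move=> lu lw; have bf : bilinear_fun (fun (x : V) (m : M) => w m *: x).
  split=> [m a x z|x a m m']; first by rewrite scalerDr !scalerA mulrC.
  by rewrite lw scalerDl -scalerA.
apply: (linear_tensor_ext (tpair_linear lu lw) (linear_comp lu (tlift_linear bf))) => x m.
by rewrite tpair_pt // /tformr tliftE // (linear_funZ _ _ lu) mulrC.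
Qed.

End Pairings.

(** * The restricted dual *)
Section DualSpace.
Variable R : realType.
Local Notation C := R[i].
Variables (V : lmodType C) (X : gvoc V).
Local Notation gr := (voc_gr X).
Local Notation V' := (rdual gr).
Implicit Types (f : V') (v : V).

Let dS := voc_direct X.

Lemma rdual_ext f f' : (forall v, f v = f' v) -> f = f'.
Proof. by move=> h; apply: val_inj; apply/funext. Qed.

Lemma rdual_eval v : linear (fun f : V' => f v : C^o).
Proof. by []. Qed.

Lemma dual_basis s : exists n (b : 'I_n -> V) (f : 'I_n -> V'),
  [/\ forall i, gr s (b i), forall i, rdual_gr s (f i)
    & forall v, component gr s v = \sum_(i < n) f i v *: b i].
Proof.
have lc := component_linear s dS.
have [n [b [f [Sb lf fE]]]] := dual_basis_fin (gr_subspace dS s) lc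
  (component_in dS s) (component_id dS (i := s)) (voc_fin X s).
have P i : (fun v => f i (component gr s v) : C^o) \in rdual_pred gr.
  apply: rdual_subproof => [a u v|]; first by rewrite lc lf.
  apply: (sub_finite_set _ (finite_set1 s)) => t [v tv] /=.
  apply: contra_neqP => /eqP ts.
  by rewrite (component_out dS tv) 1?eq_sym // (linear_fun0 (lf i)).
exists n, b, (fun i => RDual (P i)); split => // [i t v ts tv|v].
  by rewrite /= (component_out dS tv) 1?eq_sym // (linear_fun0 (lf i)).
by rewrite -fE [RHS](component_id dS) //; exact: (component_in dS).
Qed.

Definition dual_dim s := projT1 (cid (dual_basis s)).
Definition dual_vec s : 'I_(dual_dim s) -> V := projT1 (cid (projT2 (cid (dual_basis s)))).
Definition dual_cov s : 'I_(dual_dim s) -> V' :=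
  projT1 (cid (projT2 (cid (projT2 (cid (dual_basis s)))))).

Lemma dual_basisP s : [/\ forall i, gr s (dual_vec (s := s) i),
  forall i, rdual_gr s (dual_cov (s := s) i)
  & forall v, component gr s v = \sum_i dual_cov (s := s) i v *: dual_vec i].
Proof. exact: (projT2 (cid (projT2 (cid (projT2 (cid (dual_basis s))))))). Qed.

Definition dual_part s f : V' :=
  RDual (dual_restrict_subproof X
    (HB.pack (rdual_val f) (GRing.isLinear.Build _ _ _ _ _ (rdual_linear f))) s).

Lemma dual_partE s f v : dual_part s f v = f (component gr s v).
Proof. by []. Qed.

Lemma dual_part_gr s f : rdual_gr s (dual_part s f).
Proof.
move=> t v ts tv; rewrite dual_partE (component_out dS tv) 1?eq_sym //.
exact: linear_fun0 (rdual_linear f).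
Qed.

Lemma rdual_gr_comp s f v : rdual_gr s f -> f (component gr s v) = f v.
Proof.
move=> fs; have {}fs : forall t v, t != s -> gr t v -> f v = 0 := fs.
have [S [us e out]] := component_sum dS v.
rewrite [in RHS]e (linear_sumE _ _ _ (rdual_linear f)).
have [sS|sS] := boolP (s \in S).
  rewrite (bigD1_seq s) //= big1 ?addr0 // => t ts.
  by apply: (fs t) => //; exact: (component_in dS).
rewrite out // (linear_fun0 (rdual_linear f)) big1_seq // => t /andP[_ tS].
apply: (fs t); last exact: (component_in dS).
by apply: contraNneq sS => <-.
Qed.

Lemma dual_direct : direct_sum (rdual_gr (gr := gr)).
Proof.
have lf f := rdual_linear f; split.
  move=> s; split; first by move=> t v _ _.
  by move=> a f f' fs fs' t v ts tv; rewrite rdual_eval (fs _ _ ts tv) (fs' _ _ ts tv) scaler0 addr0.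
move=> f; pose s := fset_set [set s | exists2 v, gr s v & f v != 0].
have out t : t \notin (s : seq int) -> dual_part t f = 0.
  move=> ts; apply: rdual_ext => v; rewrite dual_partE.
  apply/eqP/negPn/negP => h; move/negP: ts; apply.
  rewrite /s in_fset_set //; last exact: rdual_finite.
  by apply/mem_set; exists (component gr t v) => //; exact: (component_in dS).
exists (fun t => dual_part t f); split.
  split; first by move=> t; exact: dual_part_gr.
  - apply: (sub_finite_set _ (finite_seq s)) => t /= h.
    by apply: contra_neqT h => /out.
  - rewrite (fsum_seq (fset_uniq s)) //; apply: rdual_ext => v.
    rewrite (linear_sumE _ _ _ (rdual_eval v)).
    under eq_bigr do rewrite dual_partE.
    have [S [uS e outS]] := component_sum dS v.
    rewrite -(@fsum_seq C int s (fun i => f (component gr i v)) (fset_uniq s)); last first.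
      by move=> i /out /(congr1 (fun h : V' => h v)).
    rewrite (@fsum_seq C int S _ uS) => [|i /outS ->]; last exact: linear_fun0.
    by rewrite [in RHS]e (linear_sumE _ _ _ (lf f)).
move=> h [hg hfin hs]; apply/funext => t; apply: rdual_ext => v.
rewrite dual_partE -[f]hs (linear_fsum (rdual_eval _) hfin) (@fsum_one _ _ t).
  exact: rdual_gr_comp.
by move=> t' tt'; apply: (hg t') _ (component_in dS t v); rewrite eq_sym.
Qed.

Lemma component_dual s f : component (rdual_gr (gr := gr)) s f = dual_part s f.
Proof.
apply: rdual_ext => v; rewrite dual_partE.
have [S [uS e out]] := component_sum dual_direct f.
have cin := component_in dual_direct.
rewrite {2}e (linear_sumE _ _ _ (rdual_eval _)).
have [sS|sS] := boolP (s \in S).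
  rewrite (bigD1_seq s) //= big1 ?addr0; last first.
    move=> t ts; apply: (cin t f s _ _ (component_in dS s v)).
    by rewrite eq_sym.
  by rewrite rdual_gr_comp //; exact: cin.
rewrite out // big1_seq // => t /andP[_ tS].
apply: (cin t f s _ _ (component_in dS s v)).
by apply: contraNneq sS => ->.
Qed.

(** Stated for all sufficiently large finite sets of weights, so that several
    vectors can be expanded over a common one. *)
Lemma dual_expand v : exists s0 : seq int, forall s, uniq s -> {subset s0 <= s} ->
  v = \sum_(i <- s) \sum_k dual_cov (s := i) k v *: dual_vec k.
Proof.
have [S [uS e out]] := component_sum dS v; exists S => s us Ss.
have E i : \sum_k dual_cov (s := i) k v *: dual_vec k = component gr i v.
  by have [_ _ ->] := dual_basisP i.
under eq_bigr do rewrite E.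
rewrite [LHS]e -(fsum_seq uS out) (fsum_seq us) // => i iS.
by apply: out; apply: contra iS; exact: Ss.
Qed.

Lemma dual_sep v : (forall f, f v = 0) -> v = 0.
Proof.
move=> h; have [s0 /(_ (undup s0) (undup_uniq _))->] := dual_expand v.
  by rewrite big1 // => i _; rewrite big1 // => k _; rewrite h scale0r.
by move=> i; rewrite mem_undup.
Qed.

Section WithM.
Variable M : lmodType C.
Local Notation tf f := (tforml (rdual_val f) : tensor V M -> M).

Let ltf f : linear (tf f) := tforml_linear (rdual_linear f).

Lemma tensor_expand (x : tensor V M) : exists s0 : seq int, forall s, uniq s ->
  {subset s0 <= s} ->
  x = \sum_(i <- s) \sum_k ptens (dual_vec k) (tf (dual_cov (s := i) k) x).
Proof.
elim/tensor_ind: x => [|x y [s ex] [s' ey]|v m].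
- exists [::] => s _ _; rewrite big1 // => i _; rewrite big1 // => k _.
  by rewrite (linear_fun0 (ltf _)) ptens0r.
- exists (s ++ s') => S uS sub.
  rewrite {1}(ex S uS); last by move=> i is_; apply: sub; rewrite mem_cat is_.
  rewrite {1}(ey S uS); last by move=> i is_; apply: sub; rewrite mem_cat is_ orbT.
  rewrite -big_split; apply: eq_bigr => i _; rewrite -big_split; apply: eq_bigr => k _ /=.
  by rewrite (linear_funD _ _ (ltf _)) ptensDr.
- have [s0 e] := dual_expand v; exists s0 => s us sub; rewrite {1}(e s us sub) ptens_suml.
  apply: eq_bigr => i _; rewrite ptens_suml; apply: eq_bigr => k _.
  by rewrite tforml_pt ?ptensZl ?ptensZr //; exact: rdual_linear.
Qed.

Lemma tensor_expand1 (x : tensor V M) : exists2 s : seq int, uniq s &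
  x = \sum_(i <- s) \sum_k ptens (dual_vec k) (tf (dual_cov (s := i) k) x).
Proof.
have [s0 e] := tensor_expand x; exists (undup s0); first exact: undup_uniq.
by apply: e; [exact: undup_uniq | move=> i; rewrite mem_undup].
Qed.

Lemma tensor_sep (x : tensor V M) : (forall f, tf f x = 0) -> x = 0.
Proof.
move=> h; have [s _ ->] := tensor_expand1 x.
by rewrite big1 // => i _; rewrite big1 // => k _; rewrite h ptens0r.
Qed.

Lemma tensor_eq (x y : tensor V M) : (forall f, tf f x = tf f y) -> x = y.
Proof.
move=> h; apply/eqP; rewrite -subr_eq0; apply/eqP/tensor_sep => f.
by rewrite (linear_funB _ _ (ltf _)) h subrr.
Qed.

(** The tensor is the sum over the weights in s of b_k (x) L(f_k), for dual
    bases b and f of the finite dimensional spaces V_s and their duals. *)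
Lemma tensor_of (L : V' -> M) (s : seq int) : linear L -> uniq s ->
  (forall t f, t \notin s -> rdual_gr t f -> L f = 0) ->
  exists x : tensor V M, forall f, tf f x = L f.
Proof.
move=> lL us L0.
exists (\sum_(i <- s) \sum_k ptens (dual_vec k) (L (dual_cov (s := i) k))) => f.
have E i : \sum_k f (dual_vec (s := i) k) *: dual_cov (s := i) k = dual_part i f.
  apply: rdual_ext => v; rewrite (linear_sumE _ _ _ (rdual_eval v)) dual_partE.
  have [_ _ ->] := dual_basisP i; rewrite (linear_sumE _ _ _ (rdual_linear f)).
  by apply: eq_bigr => k _; rewrite (linear_funZ _ _ (rdual_linear f)); exact: mulrC.
rewrite (linear_sumE _ _ _ (ltf f)).
rewrite (eq_bigr (fun i => L (dual_part i f))) => [|i _]; last first.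
  rewrite (linear_sumE _ _ _ (ltf f)) -E (linear_sumE _ _ _ lL).
  apply: eq_bigr => k _; rewrite tforml_pt ?(linear_funZ _ _ lL) //.
  exact: rdual_linear.
have [S [uS e out]] := component_sum dual_direct f.
rewrite [in RHS]e (linear_sumE _ _ _ lL).
under [RHS]eq_bigr do rewrite component_dual.
rewrite -(fsum_seq us (F := fun i => L (dual_part i f))); last first.
  by move=> i is_; apply: (L0 i) => //; exact: dual_part_gr.
rewrite (fsum_seq uS) // => i /out; rewrite component_dual => ->.
exact: linear_fun0.
Qed.

(** The coordinates of a tensor with respect to a basis of V are contractions. *)
Lemma tensor_sub_dual (S : set M) (x : tensor V M) : is_subspace S ->
  tensor_sub (V := V) S x <-> forall f, S (tf f x).
Proof.
move=> sS; split=> [Sx f|h].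
  apply: (span_min (S := [set y | S (tf f y)]) _ _ Sx).
    split; first by rewrite /= (linear_fun0 (ltf f)); case: sS.
    by move=> a y z /= Sy Sz; rewrite ltf; case: sS => _; exact.
  move=> _ [m Sm [v ->]] /=; rewrite tforml_pt; last exact: rdual_linear.
  exact: subspaceZ.
have [s _ ->] := tensor_expand1 x.
apply: subspace_big => [|i]; first exact: span_subspace.
apply: subspace_big => [|k]; first exact: span_subspace.
by apply: span_gen; exists (tf (dual_cov k) x) => //; exists (dual_vec k).
Qed.

Lemma tensor3_eq (x y : tensor (tensor V V) M) :
  (forall f f' : V', tforml (tpair f f') x = tforml (tpair f f') y) -> x = y.
Proof.
have lp (f f' : V') := tpair_linear (rdual_linear f) (rdual_linear f').
have ltp f f' := tforml_linear (W := M) (lp f f').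
move=> h; apply/eqP; rewrite -subr_eq0; apply/eqP; move: (x - y) (fun f f' =>
  (linear_funB _ _ (ltp f f') : tforml (tpair f f') (x - y) = _)) => z ez.
have {ez h} zt f f' : tforml (tpair f f') z = 0 by rewrite ez h subrr.
suff [s0 e] : exists s0 : seq int, forall s, uniq s -> {subset s0 <= s} ->
   z = \sum_(i <- s) \sum_k \sum_(j <- s) \sum_l
     ptens (ptens (dual_vec k) (dual_vec l))
        (tforml (tpair (dual_cov (s := i) k) (dual_cov (s := j) l)) z).
  rewrite (e (undup s0) (undup_uniq _)); last by move=> i; rewrite mem_undup.
  do 4 (rewrite big1 // => ? _); by rewrite zt ptens0r.
elim/tensor_ind: z {zt} => [|z z' [s ex] [s' ey]|t m].
- exists [::] => s _ _; apply: esym; do 4 (rewrite big1 // => ? _).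
  by rewrite (linear_fun0 (ltp _ _)) ptens0r.
- exists (s ++ s') => S uS sub.
  rewrite {1}(ex S uS); last by move=> i is_; apply: sub; rewrite mem_cat is_.
  rewrite {1}(ey S uS); last by move=> i is_; apply: sub; rewrite mem_cat is_ orbT.
  do 4 (rewrite -big_split; apply: eq_bigr => ? _) => /=.
  by rewrite (linear_funD _ _ (ltp _ _)) ptensDr.
elim/tensor_ind: t => [|t t' [s ex] [s' ey]|v v'].
- exists [::] => s _ _; rewrite ptens0l; apply: esym; do 4 (rewrite big1 // => ? _).
  by rewrite (linear_fun0 (ltp _ _)) ptens0r.
- exists (s ++ s') => S uS sub; rewrite ptensDl.
  rewrite {1}(ex S uS); last by move=> i is_; apply: sub; rewrite mem_cat is_.
  rewrite {1}(ey S uS); last by move=> i is_; apply: sub; rewrite mem_cat is_ orbT.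
  do 4 (rewrite -big_split; apply: eq_bigr => ? _) => /=.
  by rewrite (linear_funD _ _ (ltp _ _)) ptensDr.
have [s1 e1] := dual_expand v; have [s2 e2] := dual_expand v'.
exists (s1 ++ s2) => s us sub.
rewrite {1}(e1 s us); last by move=> i is_; apply: sub; rewrite mem_cat is_.
rewrite {1}(e2 s us); last by move=> i is_; apply: sub; rewrite mem_cat is_ orbT.
rewrite ptens_suml ptens_suml; apply: eq_bigr => i _.
rewrite ptens_suml ptens_suml; apply: eq_bigr => k _.
rewrite ptens_sumr ptens_suml; apply: eq_bigr => j _.
rewrite ptens_sumr ptens_suml; apply: eq_bigr => l _.
rewrite tforml_pt // tpair_pt; try exact: rdual_linear.
by rewrite !ptensZl ptensZr !ptensZl ptensZr scalerA.
Qed.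

End WithM.
End DualSpace.

(** * The dual vertex operator algebra *)
Section Twist0.
Variable R : realType.
Local Notation C := R[i].

Lemma twist0 (U : lmodType C) (F : rat -> rat -> U) :
  fmul (twist_factor R 0) (in_vars z0 z2 F) = in_vars z0 z2 F.
Proof.
apply/funext => e; pose cond := e z1 == 0.
have cE : (e == zexp z0 (e z0) + zexp z2 (e z2)) = cond.
  apply/eqP/eqP => [->|e1]; first by rewrite !ffunE /= addr0.
  have dis : distinct3 z1 z0 z2 by [].
  by apply: (exp3P dis); rewrite [RHS]ffunE !zexp_at /= ?addr0 ?add0r.
rewrite {2}/in_vars cE /cond.
have [[m em]|no] := pselect (exists m : int, e z1 = - 0 - m%:~R); last first.
  rewrite twist_in_vars0 => [|m]; last by apply/eqP => em; apply: no; exists m.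
  by case: eqP => // e1; case: no; exists 0; rewrite e1 subr0 oppr0.
rewrite (twist_in_vars _ em) em oppr0 add0r oppr_eq0 intr_eq0.
case: m em => [[|l]|l] em //=.
  by rewrite gbinom0 expr0 mulr1 scale1r !subr0.
have -> : gbinom C 0 l.+1 = 0 by exact: (@gbinom_nat0 C 0 l.+1).
by rewrite mul0r scale0r.
Qed.

(** Vertex operators are truncated in one direction and coproducts in the other;
    either condition makes the sums in the Jacobi identity finite. *)
Definition upper0 (U : zmodType) (f : rat -> U) := exists e0, forall e, e0 < e -> f e = 0.
Definition lower0 (U : zmodType) (f : rat -> U) := exists e0, forall e, e < e0 -> f e = 0.

Lemma upper0_ev (U : zmodType) (f : rat -> U) c :
  upper0 f -> eventually0 (fun i => f (c + i%:R)).
Proof.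
move=> [e0 h]; have [N hN] := rat_bound (e0 - c); exists N => i /hN lt.
by apply: h; rewrite -ltrBlDl.
Qed.

Lemma lower0_ev (U : zmodType) (f : rat -> U) c :
  lower0 f -> eventually0 (fun i => f (c - i%:R)).
Proof.
move=> [e0 h]; have [N hN] := rat_bound (c - e0); exists N => i /hN lt.
by apply: h; rewrite ltrBlDl -ltrBlDr.
Qed.

Lemma field_of_upper0 (A : Type) (U : zmodType) (D : int -> A -> U) v :
  (exists k0, forall k, k < k0 -> D k v = 0) -> upper0 (field_of D v).
Proof.
move=> [k0 h]; exists (- k0%:~R - 1); apply: (field_ofP (P := fun e u => - k0%:~R - 1 < e -> u = 0)) => // k.
by rewrite ltrD2r ltrN2 ltr_int => /h.
Qed.

Lemma field_of_lower0 (A : Type) (U : zmodType) (D : int -> A -> U) v :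
  (exists k0, forall k, k0 < k -> D k v = 0) -> lower0 (field_of D v).
Proof.
move=> [k0 h]; exists (- k0%:~R - 1); apply: (field_ofP (P := fun e u => e < - k0%:~R - 1 -> u = 0)) => // k.
by rewrite ltrD2r ltrN2 ltr_int => /h.
Qed.

End Twist0.

Lemma commutator_side_linear (K : numFieldType) (U W : lmodType K) (phi : U -> W)
    (F1 F2 : rat -> rat -> U) (e : exp3) : linear phi ->
  (forall c c', eventually0 (fun i => F1 (c + i%:R) (c' - i%:R))) ->
  (forall c c', eventually0 (fun i => F2 (c - i%:R) (c' + i%:R))) ->
  phi (fmul (fdelta z0 z1 z2 (-1) 1) (in_vars z1 z2 F1) e
    - fmul (fdelta z0 z2 z1 (-1) (-1)) (in_vars z1 z2 F2) e) =
  fmul (fdelta z0 z1 z2 (-1) 1)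
    (in_vars z1 z2 (fun a b => phi (F1 a b))) e
  - fmul (fdelta z0 z2 z1 (-1) (-1))
    (in_vars z1 z2 (fun a b => phi (F2 a b))) e.
Proof.
move=> lp ev1 ev2; rewrite (linear_funB _ _ lp); congr (_ - _).
  rewrite fmul_linear ?in_vars_linear //.
  by apply: fmul_delta_finite => // c c'; exact: ev1.
rewrite fmul_linear ?in_vars_linear // in_varsC.
by apply: fmul_delta_finite => // c c'; exact: ev2.
Qed.

Lemma voa_Y_bilinear (R : realType) (U : lmodType R[i]) (X : voa_data U) e :
  (forall k, bilinear_fun (fun u v => voa_mode X u k v)) ->
  bilinear_fun (fun u v => voa_Y X u v e).
Proof.
move=> bil; have [[k ->]|ne] := pselect (is_int e); last first.
  by split=> w a u v; rewrite /voa_Y !field_of_nint // scaler0 addr0.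
have -> : k%:~R = - (- k - 1)%:~R - 1 :> rat by rewrite intrD !mulrNz; ring.
split=> w a u v; rewrite /voa_Y !field_of_int; first exact: ((bil _).1 w).
exact: ((bil _).2 w).
Qed.

Section DualVOA.
Variable R : realType.
Local Notation C := R[i].
Variables (V : lmodType C) (X : gvoc V).
Local Notation gr := (voc_gr X).
Local Notation V' := (rdual gr).
Local Notation D := (dual_voa X).
Local Notation ups := (voc_ups X).
Implicit Types (u v w : V').

Let dS := voc_direct X.
Let lf (f : V') := rdual_linear f.

Lemma ups_linear e : linear (ups^~ e).
Proof. exact: field_of_linear. Qed.

Lemma ups_upper0 x : upper0 (ups x).
Proof. exact: field_of_upper0 (voc_trunc X x). Qed.

Lemma dual_YE u w e x : (voa_Y D u w e : V') x = tpair u w (ups x e).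
Proof.
rewrite /voa_Y; move: e.
apply: (field_ofP (P := fun e f => (f : V') x = tpair u w (ups x e))) => [k|e ne].
  by rewrite /voc_ups field_of_int.
by rewrite /voc_ups field_of_nint // (linear_fun0 (tpair_linear (lf u) (lf w))).
Qed.

Lemma dual_YEl u w e x : (voa_Y D u w e : V') x = w (tforml u (ups x e)).
Proof. by rewrite dual_YE tpair_tforml. Qed.

Lemma tpair_gr p q n u w y : rdual_gr p u -> rdual_gr q w -> p + q != n ->
  tensor_gr gr n y -> tpair u w y = 0.
Proof.
move=> up wq pq; have lp := tpair_linear (lf u) (lf w).
apply: (span_min (S := [set y | tpair u w y = 0])).
  split; first exact: linear_fun0.
  by move=> a z z' /= hz hz'; rewrite lp hz hz' scaler0 addr0.
move=> _ [a [x [x' [xa x'a ->]]]] /=; rewrite tpair_pt //.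
have [ap|ap] := eqVneq a p; last by rewrite (up a x ap xa) mul0r.
rewrite (wq (n - a) x' _ x'a) ?mulr0 // ap subr_eq.
by apply: contraNneq pq => ->; rewrite addrC.
Qed.

Lemma dual_mode_gr p q k u w : rdual_gr p u -> rdual_gr q w ->
  rdual_gr (p + q - k - 1) (voa_mode D u k w).
Proof.
move=> up wq t x ts tx; apply: (tpair_gr up wq _ (voc_graded k tx)).
by apply: contraNneq ts => e; apply/eqP; rewrite e; ring.
Qed.

Lemma dual_bounded : exists s0, forall s, s < s0 -> rdual_gr s = [set 0 : V'].
Proof.
have [s0 h] := voc_bounded X; exists s0 => s /h gs.
apply/seteqP; split=> [f fs|f ->] //=.
apply: rdual_ext => x; rewrite -(rdual_gr_comp x fs).
have : gr s (component gr s x) by exact: (component_in dS).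
by rewrite gs => ->; exact: linear_fun0.
Qed.

Lemma dual_bilinear k : bilinear_fun (fun u v => voa_mode D u k v).
Proof.
have E u v x : (voa_mode D u k v : V') x = tpair u v (voc_delta X k x) by [].
split=> [w a u v|w a u v]; apply: rdual_ext => x.
  by rewrite rdual_eval !E !(tpair_tformr _ (lf _) (lf w)).
by rewrite rdual_eval !E !(tpair_tforml _ (lf w) (lf _)).
Qed.

Lemma dual_trunc u v : exists k0, forall k, k0 < k -> voa_mode D u k v = 0.
Proof.
have [s0 low] := dual_bounded.
have D0 : forall k, bilinear_fun (fun u v => voa_mode D u k v) := dual_bilinear.
elim/(graded_ind (dual_direct X)): u => [|u u' [k1 h1] [k2 h2]|p u up].
- by exists 0 => k _; exact: (linear_fun0 ((D0 k).1 v)).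
- exists (Num.max k1 k2) => k; rewrite gt_max => /andP[/h1 e1 /h2 e2].
  by rewrite (linear_funD _ _ ((D0 k).1 v)) e1 e2 addr0.
elim/(graded_ind (dual_direct X)): v => [|v v' [k1 h1] [k2 h2]|q v vq].
- by exists 0 => k _; exact: (linear_fun0 ((D0 k).2 u)).
- exists (Num.max k1 k2) => k; rewrite gt_max => /andP[/h1 e1 /h2 e2].
  by rewrite (linear_funD _ _ ((D0 k).2 u)) e1 e2 addr0.
exists (p + q - 1 - s0) => k lt.
have := dual_mode_gr (k := k) up vq; rewrite low //.
by lia.
Qed.

Lemma voc_L_linear k : linear (voc_L X k).
Proof.
move=> a x y; rewrite /voc_L ups_linear.
by rewrite (tforml_linear (linearP (voc_rho X))).
Qed.

Lemma voc_L_gr k s x : gr s x -> gr (s - k) (voc_L X k x).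
Proof.
rewrite !voc_L0 /= => xs; have := voc_virasoro X 0 k x.
rewrite xs (linear_funZ _ _ (voc_L_linear k)) !add0r oppr0.
rewrite !mul0r scale0r if_same addr0 => /eqP; rewrite subr_eq => /eqP ->.
by rewrite -scalerDl -intrD addrC.
Qed.

(** The counit lives in weight 0. For x of weight s, the part of weight s of the
    left counit identity reads x = (c_0 (x) Id) Upsilon_0(x), where c_0 is the
    restriction of c to weight 0. Then
    c(x) = (c_0 (x) c) Upsilon_0(x) = c_0(x) by the right counit identity. *)
Lemma c_weight0 x : voc_c X (component gr 0 x) = voc_c X x.
Proof.
have lc := linearP (voc_c X).
elim/(graded_ind dS): x => [|x y IH IH'|s x xs].
- by rewrite (linear_fun0 (component_linear 0 dS)).
- by rewrite (linear_funD _ _ (component_linear 0 dS)) !linearD /= IH IH'.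
pose c0 := dual_restrict X (voc_c X) 0.
have lc0 := lf c0; have ltc := tforml_linear (W := V) lc.
have ltc0 := tforml_linear (W := V) lc0.
have y0 : tensor_gr gr s (ups x 0).
  have := voc_graded (-1) xs; rewrite -[X in tensor_gr _ X]/(s + -1 + 1) addrNK.
  by rewrite -(field_of_int (voc_delta X)) mulrNz opprK subrr.
have key : component gr s (tforml (voc_c X) (ups x 0)) = tforml c0 (ups x 0).
  apply: (span_min (S := [set y | component gr s (tforml (voc_c X) y) = tforml c0 y]) _ _ y0).
    split; first by rewrite /= (linear_fun0 ltc) (linear_fun0 ltc0)
      (linear_fun0 (component_linear s dS)).
    by move=> a z z' /= h h'; rewrite ltc ltc0 (component_linear s dS) h h'.
  move=> _ [a [v [w [va wa ->]]]] /=; rewrite !tforml_pt //.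
  rewrite (linear_funZ _ _ (component_linear s dS)) /=.
  have [a0|a0] := eqVneq a 0.
    by rewrite a0 subr0 in va wa; rewrite !component_id.
  rewrite (component_out dS va) 1?eq_sym // linear0 scale0r.
  rewrite (component_out dS wa) ?scaler0 //.
  by apply: contra_neq a0 => e; rewrite -(subKr s a) -e subrr.
rewrite voc_counitl /fmon eqxx (component_id dS xs) in key.
rewrite {2}key -(tpair_tforml _ lc0 lc) (tpair_tformr _ lc0 lc).
by have [_ ->] := voc_counitr X x.
Qed.

(** By the right counit identity rho(x) = (rho (x) c) Upsilon_0(x) = c(L(2) x),
    while c lives in weight 0 and L(2) lowers weights by 2. *)
Lemma rho_weight2 x : voc_rho X (component gr 2 x) = voc_rho X x.
Proof.
elim/(graded_ind dS): x => [|x y IH IH'|s x xs].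
- by rewrite (linear_fun0 (component_linear 2 dS)).
- by rewrite (linear_funD _ _ (component_linear 2 dS)) !linearD /= IH IH'.
have [s2|s2] := eqVneq s 2; first by rewrite s2 in xs; rewrite component_id.
rewrite (component_out dS xs) 1?eq_sym // linear0; apply: esym.
have lr := linearP (voc_rho X); have lc := linearP (voc_c X).
have [_ cx] := voc_counitr X x.
rewrite -cx -(tpair_tformr _ lr lc) (tpair_tforml _ lr lc).
have -> : tforml (voc_rho X) (ups x 0) = voc_L X 2 x by rewrite /voc_L subrr.
rewrite -c_weight0 (component_out dS (voc_L_gr 2 xs)) ?linear0 //.
by rewrite eq_sym subr_eq0.
Qed.

Lemma dual_vacE : (voa_vac D : V') = voc_c X :> (V -> C^o).
Proof. by apply/funext => x; exact: c_weight0. Qed.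

Lemma dual_confE : (voa_conf D : V') = voc_rho X :> (V -> C^o).
Proof. by apply/funext => x; exact: rho_weight2. Qed.

Lemma dual_LE n f x : (voa_L D n f : V') x = f (voc_L X (- n) x).
Proof.
rewrite /voa_L /= /dual_mode_fun tpair_tforml // -/(voa_conf D) dual_confE.
rewrite /voc_L /voc_ups.
have -> : (- n)%:~R - 2 = - (n + 1)%:~R - 1 :> rat by rewrite mulrNz intrD; ring.
by rewrite field_of_int.
Qed.

Lemma dual_virasoro : virasoro (voa_L D) (voa_rank D).
Proof.
move=> k j f; apply: rdual_ext => x.
rewrite -[LHS]/((voa_L D k (voa_L D j f) : V') x - (voa_L D j (voa_L D k f) : V') x).
rewrite !dual_LE -(linear_funB _ _ (lf f)).
have -> : voc_L X (- j) (voc_L X (- k) x) - voc_L X (- k) (voc_L X (- j) x) =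
  (k - j)%:~R *: voc_L X (- (k + j)) x +
    (if k + j == 0 then ((k ^+ 3 - k)%:~R / 12%:R * voc_rank X) *: x else 0).
  have e1 : - j - - k = k - j by ring.
  have e2 : - j + - k = - (k + j) by ring.
  rewrite voc_virasoro e1 e2 oppr_eq0; congr (_ + _).
  case: eqP => // /eqP; rewrite addr_eq0 => /eqP ->.
  by congr ((_ %:~R / _ * _) *: _); ring.
rewrite lf; case: ifP => _; last by rewrite (linear_fun0 (lf f)) -dual_LE.
by rewrite (linear_funZ _ _ (lf f)) -dual_LE.
Qed.

Lemma dual_L0 s : rdual_gr s = [set f : V' | voa_L D 0 f = s%:~R *: f].
Proof.
apply/seteqP; split=> f /= fs.
  apply: rdual_ext => x; rewrite (linear_funZ _ _ (rdual_eval x)) dual_LE oppr0.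
  elim/(graded_ind dS): x => [|x y IH IH'|t x xt].
  - by rewrite (linear_fun0 (voc_L_linear 0)) (linear_fun0 (lf f)) scaler0.
  - by rewrite (linear_funD _ _ (voc_L_linear 0)) !(linear_funD _ _ (lf f)) IH IH' scalerDr.
  have := xt; rewrite voc_L0 /= => ->; rewrite (linear_funZ _ _ (lf f)).
  have [->|ts] := eqVneq t s; first by [].
  by rewrite (fs t x ts xt) !scaler0.
move=> t x ts xt; have := congr1 (fun h : V' => h x) fs.
rewrite dual_LE oppr0; have := xt; rewrite voc_L0 /= => ->.
rewrite (linear_funZ _ _ (lf f)) => /eqP; rewrite -subr_eq0.
rewrite -[X in X == 0]/(t%:~R *: f x - s%:~R *: f x) -scalerBl -intrB.
rewrite scaler_eq0 intr_eq0 subr_eq0 (negbTE ts) /= => /eqP; exact.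
Qed.

Lemma dual_Lm1 u v e : voa_Y D (voa_L D (-1) u) v e = fderiv (voa_Y D u v) e.
Proof.
apply: rdual_ext => x; rewrite /fderiv (linear_funZ _ _ (rdual_eval x)) !dual_YEl.
have -> : (voa_L D (-1) u : V') = (fun y => u (voc_L X 1 y)) :> (V -> C^o).
  by apply/funext => y; rewrite dual_LE opprK.
rewrite -(tforml_tmap _ (lf u) (voc_L_linear 1)).
rewrite voc_L1 /fderiv (linear_funZ _ _ (tforml_linear (lf u))).
by rewrite (linear_funZ _ _ (lf v)).
Qed.

Lemma dual_Y_lower0 u v : lower0 (voa_Y D u v).
Proof.
have [k0 h] := dual_trunc u v.
by apply: field_of_lower0; exists k0.
Qed.

Lemma dual_Y_bil e : bilinear_fun (fun u v => voa_Y D u v e).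
Proof. exact: voa_Y_bilinear dual_bilinear. Qed.

(** The co-Jacobi identity paired with u (x) v (x) w. Its right-hand side
    involves z_1^-1 delta((z_2 + z_0)/z_1), whose coefficients are the binomial
    coefficients of Borcherds' identity; passing to coefficients also replaces
    it by the other form of the delta function. *)
Lemma dual_borcherds u v w (p q : rat) (n : int) : is_int p ->
  borcherds_at (fun a b => voa_Y D u (voa_Y D v w b) a)
    (fun a b => voa_Y D v (voa_Y D u w a) b)
    (fun a b => voa_Y D (voa_Y D u v a) w b) p q n.
Proof.
move=> [m pm]; have lp := tpair_linear (lf u) (lf v).
have lt := tforml_linear (W := V) lp.
pose F1 x a b := tassoc (tmap id (ups^~ b) (ups x a)).
pose F2 x a b := tmap (@tswap _ V V) id (tassoc (tmap id (ups^~ a) (ups x b))).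
pose F3 x a b := tmap (ups^~ a) id (ups x b).
pose phi y : C^o := w (tforml (tpair u v) y).
have lphi : linear phi by move=> a y z; rewrite /phi lt lf.
have lups := ups_linear.
have E1 x a b : phi (F1 x a b) = (voa_Y D u (voa_Y D v w b) a : V') x.
  by rewrite /phi /F1 tforml_assoc // !dual_YEl.
have E2 x a b : phi (F2 x a b) = (voa_Y D v (voa_Y D u w a) b : V') x.
  by rewrite /phi /F2 tforml_swap // tforml_assoc // !dual_YEl.
have E3 x a b : phi (F3 x a b) = (voa_Y D (voa_Y D u v a) w b : V') x.
  rewrite /phi /F3 tforml_tmap // dual_YEl; congr (w (tforml _ _)).
  by apply/funext => y; rewrite dual_YE.
have ta b : linear (fun y : tensor V V => tassoc (tmap id (ups^~ b) y)).
  by move=> a y z; rewrite (tmap_linear _ (lups b)) // tassoc_linear.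
have ev1 x c c' : eventually0 (fun i => F1 x (c + i%:R) (c' - i%:R)).
  have [N h] := upper0_ev c (ups_upper0 x); exists N => i /h.
  by rewrite /F1 => ->; rewrite (linear_fun0 (ta _)).
have ev2 x c c' : eventually0 (fun i => F2 x (c - i%:R) (c' + i%:R)).
  have [N h] := upper0_ev c' (ups_upper0 x); exists N => i /h.
  rewrite /F2 => ->; rewrite (linear_fun0 (ta _)) (linear_fun0 (tmap_linear _ _)) //.
  exact: tswap_linear.
have ev3 x c c' : eventually0 (fun i => F3 x (c - i%:R) (c' + i%:R)).
  have [N h] := upper0_ev c' (ups_upper0 x); exists N => i /h.
  by rewrite /F3 => ->; rewrite (linear_fun0 (tmap_linear (lups _) _)).
pose e : exp3 := zexp z0 (- n%:~R - 1) + zexp z1 (- p - 1) + zexp z2 (- q - 1).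
have e0 : e z0 = - n%:~R - 1 by rewrite !ffunE /= !addr0.
have e1 : e z1 = - p - 1 by rewrite !ffunE /= addr0 add0r.
have e2 : e z2 = - q - 1 by rewrite !ffunE /= !add0r.
have e1m : e z1 = - m%:~R - 1 by rewrite e1 pm.
have jac x : fmul (fdelta z0 z1 z2 (-1) 1) (in_vars z1 z2 (F1 x)) e
    - fmul (fdelta z0 z2 z1 (-1) (-1)) (in_vars z1 z2 (F2 x)) e
    = fmul (fdelta z1 z2 z0 1 1) (in_vars z0 z2 (F3 x)) e.
  exact: voc_jacobi X x e.
clearbody F1 F2 F3 phi.
have scal x : borcherds_at
    (fun a b => (voa_Y D u (voa_Y D v w b) a : V') x : C^o)
    (fun a b => (voa_Y D v (voa_Y D u w a) b : V') x : C^o)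
    (fun a b => (voa_Y D (voa_Y D u v a) w b : V') x : C^o) p q n.
  have := congr1 phi (jac x); rewrite (commutator_side_linear e lphi (ev1 x) (ev2 x)).
  have ev2' c c' : eventually0 (fun i => phi (F2 x (c - i%:R) (c' + i%:R))).
    by have [N h] := ev2 x c c'; exists N => i /h ->; exact: linear_fun0.
  rewrite (commutator_sideE (F2 := fun a b => phi (F2 x a b)) _ ev2' e0).
  rewrite (fmul_linear lphi); last first.
    by rewrite in_varsC; apply: fmul_delta_finite => // c c'; exact: ev3.
  rewrite (in_vars_linear _ _ _ lphi) (in_varsC z0 z2).
  rewrite (fmul_delta_int (i := z2) (j := z0) _ _ _ _ e1m) //.
  rewrite /borcherds_at e1 e2 e0 => h.
  transitivity (natsum (fun l => dcoef (1 : C) 1 (m, l) *: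
     phi (F3 x (- n%:~R - 1 - l%:R) (- q - 1 - m%:~R + l%:R)))).
    apply: eq_natsum => i; rewrite /dcoef exp1rz expr1n mul1r mulr1 pm E3.
    by congr (_ *: (voa_Y D _ _ _ : V') x); ring.
  rewrite -h; congr (_ - _ *: _); apply: eq_natsum => i; congr (_ *: _).
    by rewrite -E1; congr (phi (F1 x _ _)); ring.
  by rewrite -E2; congr (phi (F2 x _ _)); ring.
have bil := dual_Y_bil; have low := dual_Y_lower0.
have evY (f : nat -> C) (g : nat -> V') : eventually0 g -> eventually0 (fun i => f i *: g i).
  by move=> [N h]; exists N => i /h ->; rewrite scaler0.
apply: rdual_ext => x; move: (scal x); rewrite /borcherds_at => h.
have ext (f : nat -> C) (g : nat -> V') : eventually0 g ->
    (natsum (fun i => f i *: g i) : V') x = natsum (fun i => f i *: (g i x : C^o)).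
  by move=> ev; rewrite (natsum_linear (rdual_eval x)) //; exact: evY.
have evA : eventually0 (fun i : nat =>
    voa_Y D u (voa_Y D v w (- q - 1 - i%:R)) (- p - 1 - n%:~R + i%:R) : V').
  have [N hN] := lower0_ev (- q - 1) (low v w); exists N => i /hN ->.
  exact: linear_fun0 ((bil _).2 _).
have evB : eventually0 (fun i : nat =>
    voa_Y D v (voa_Y D u w (- p - 1 - i%:R)) (- q - 1 - n%:~R + i%:R) : V').
  have [N hN] := lower0_ev (- p - 1) (low u w); exists N => i /hN ->.
  exact: linear_fun0 ((bil _).2 _).
have evC : eventually0 (fun i : nat =>
    voa_Y D (voa_Y D u v (- n%:~R - 1 - i%:R)) w (- p - q - 1 + i%:R) : V').
  have [N hN] := lower0_ev (- n%:~R - 1) (low u v); exists N => i /hN ->.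
  exact: linear_fun0 ((bil _).1 _).
pose f i := gbinom C n%:~R i * (-1) ^+ i.
rewrite -(ext (gbinom C p) _ evC) -(ext f _ evA) -(ext f _ evB) in h.
exact: h.
Qed.

Lemma dual_jacobi u v w e : jacobi_at 0 (fun a b => voa_Y D u (voa_Y D v w b) a)
    (fun a b => voa_Y D v (voa_Y D u w a) b)
    (fun a b => voa_Y D (voa_Y D u v a) w b) e.
Proof.
have bil := dual_Y_bil; have low := dual_Y_lower0.
have nint u' v' e' : ~ is_int e' -> voa_Y D u' v' e' = 0 by exact: field_of_nint.
apply: borcherds_jacobi => [c c'|c c'|a b|a b|a b|p q n].
- have [N hN] := lower0_ev c (low u w); exists N => i /hN ->.
  exact: linear_fun0 ((bil _).2 _).
- have [N hN] := lower0_ev c (low u v); exists N => i /hN ->.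
  exact: linear_fun0 ((bil _).1 _).
- by rewrite addr0; exact: nint.
- by rewrite addr0 => /nint ->; exact: linear_fun0 ((bil _).2 _).
- by move=> /nint ->; exact: linear_fun0 ((bil _).1 _).
- by rewrite subr0; exact: dual_borcherds.
Qed.

Lemma dual_fin s : finite_dim (rdual_gr (gr := gr) s).
Proof.
exists [seq dual_cov (X := X) (s := s) i | i <- enum 'I_(dual_dim X s)] => f fs.
have -> : f = \sum_k f (dual_vec (X := X) (s := s) k) *: dual_cov k.
  apply: rdual_ext => x; rewrite -(rdual_gr_comp x fs).
  have [_ _ ->] := dual_basisP X s; rewrite (linear_sumE _ _ _ (rdual_eval x)).
  rewrite (linear_sumE _ _ _ (lf f)); apply: eq_bigr => k _.
  by rewrite (linear_funZ _ _ (lf f)); exact: mulrC.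
apply: subspace_big => [|k]; first exact: span_subspace.
apply: (subspaceZ _ (span_subspace _)); apply: span_gen => /=.
by apply: map_f; rewrite mem_enum.
Qed.

Lemma dual_is_voa : is_voa D.
Proof.
split.
- exact: dual_direct.
- exact: dual_fin.
- exact: dual_bounded.
- exact: dual_bilinear.
- exact: dual_trunc.
- move=> v e; apply: rdual_ext => x; rewrite dual_YEl dual_vacE voc_counitl /fmon.
  by case: (e == 0); rewrite ?(linear_fun0 (lf v)).
- move=> v; have E e x : (voa_Y D v (voa_vac D) e : V') x = v (tformr (voc_c X) (ups x e)).
    by rewrite dual_YE dual_vacE (tpair_tformr _ (lf v) (linearP (voc_c X))).
  split=> [e e0|]; apply: rdual_ext => x; rewrite E.
    by have [h _] := voc_counitr X x; rewrite h // (linear_fun0 (lf v)).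
  by have [_ ->] := voc_counitr X x.
- move=> u v w e; have := dual_jacobi u v w e.
  by rewrite /jacobi_at twist0.
- exact: dual_virasoro.
- exact: dual_L0.
- exact: dual_Lm1.
Qed.

End DualVOA.

(** * Consequences of the vertex operator algebra axioms *)

(** The case n = 0: the commutator formula. *)
Lemma borcherds_comm (R : realType) (U : lmodType R[i]) (F1 F2 F3 : rat -> rat -> U) (m : nat) q :
  borcherds_at F1 F2 F3 m%:R q 0 ->
  \sum_(i < m.+1) gbinom R[i] m%:R i *: F3 (- 1 - i%:R) (- m%:R - q - 1 + i%:R) =
  F1 (- m%:R - 1) (- q - 1) - F2 (- m%:R - 1) (- q - 1).
Proof.
rewrite /borcherds_at.
have g0 i : (0 < i)%N -> gbinom R[i] 0 i = 0 by exact: (@gbinom_nat0 R[i] 0 i).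
have E (F : nat -> U) : natsum (fun i => (gbinom R[i] 0%:~R i * (-1) ^+ i) *: F i) = F 0%N.
  rewrite natsum1 => [|i /g0 h]; last by rewrite [gbinom _ _ _]h mul0r scale0r.
  by rewrite gbinom0 expr0 mulr1 scale1r.
have e (x : rat) : x + 0%:R = x by exact: addr0.
have e' (x : rat) : x - 0%:R = x by exact: subr0.
have e'' (x : rat) : x - 0%:~R = x by exact: subr0.
have e3 : - 0%:~R - 1 = - 1 :> rat by rewrite oppr0 add0r.
rewrite !(E (fun i => _)) expr0z scale1r e3 !e ?e' ?e'' ?e ?e' => <-.
by rewrite (natsumE (N := m.+1)) // => i lt; rewrite gbinom_nat0 // scale0r.
Qed.

(** A divided power of L(1) acts on a product by sums along antidiagonals, while
    products of contragredient modes are sums over rectangles. *)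
Lemma antidiagonal_sum (U : zmodType) (B A A' : nat) (G : nat -> nat -> U) : (A + A' <= B)%N ->
  (forall k l, (A <= k)%N || (A' <= l)%N -> G k l = 0) ->
  \sum_(N < B) \sum_(k < N.+1) G k (N - k)%N = \sum_(k < A) \sum_(l < A') G k l.
Proof.
move=> le G0.
have -> : \sum_(N < B) \sum_(k < N.+1) G k (N - k)%N =
    \sum_(N < B) \sum_(k < B) if (k <= N)%N then G k (N - k)%N else 0.
  apply: eq_bigr => N _; rewrite -big_mkcond /=.
  by rewrite (big_ord_widen_cond _ xpredT (fun k => G k (N - k)%N) (ltn_ord N)).
rewrite exchange_big /=.
transitivity (\sum_(k < B) \sum_(l < A') G k l).
  apply: eq_bigr => k _.
  have -> : \sum_(l < A') G k l = \sum_(0 <= l < B - k) G k l.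
    have [kA|Ak] := ltnP k A; last first.
      by rewrite big1 ?big_nat ?big1 // => l _; rewrite G0 // Ak.
    rewrite big_mkord -(natsumE (N := A')) => [|l lA]; last by rewrite G0 // lA orbT.
    rewrite -(natsumE (N := (B - k)%N)) // => l lB; rewrite G0 //.
    by apply/orP; right; lia.
  rewrite -(big_mkord xpredT (fun N => if (k <= N)%N then G k (N - k)%N else 0)).
  rewrite (@big_cat_nat _ _ _ k) //=; last exact: ltnW.
  rewrite big_nat big1 ?add0r => [|i /andP[_ ik]]; last by rewrite leqNgt ik.
  rewrite -{1}[nat_of_ord k]add0n big_addn; apply: eq_bigr => i _.
  by rewrite leq_addl addnK.
rewrite -(natsumE (F := fun k => \sum_(l < A') G k l)); last first.
  by move=> k kB; rewrite big1 // => l _; rewrite G0 //; apply/orP; left; lia.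
by rewrite (natsumE (N := A)) // => k kA; rewrite big1 // => l _; rewrite G0 // kA.
Qed.

Section VOA.
Variable R : realType.
Local Notation C := R[i].
Variables (U : lmodType C) (X : voa_data U).
Hypothesis hX : is_voa X.
Implicit Types u v w : U.
Local Notation gr := (voa_gr X).
Local Notation mode := (voa_mode X).
Local Notation L := (voa_L X).

Let dS := voa_direct hX.
Let bil := voa_bilinear hX.

Lemma voa_Y_at u v e (k : int) : e = - k%:~R - 1 -> voa_Y X u v e = mode u k v.
Proof. by move=> ->; rewrite /voa_Y field_of_int. Qed.

Lemma voa_Y_lower0 u v : lower0 (voa_Y X u v).
Proof. by apply: field_of_lower0; have [k0 h] := voa_trunc hX u v; exists k0. Qed.

Lemma voa_Y_bil e : bilinear_fun (fun u v => voa_Y X u v e).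
Proof. exact: voa_Y_bilinear bil. Qed.

Lemma voa_borcherds u v w (p q : rat) (n : int) : is_int p ->
  borcherds_at (fun a b => voa_Y X u (voa_Y X v w b) a)
    (fun a b => voa_Y X v (voa_Y X u w a) b)
    (fun a b => voa_Y X (voa_Y X u v a) w b) p q n.
Proof.
move=> pi; apply: (@jacobi_borcherds _ _ 0); last by rewrite subr0.
- move=> c c'; have [N hN] := lower0_ev c (voa_Y_lower0 u w); exists N => i /hN ->.
  exact: linear_fun0 ((voa_Y_bil _).2 _).
- move=> c c'; have [N hN] := lower0_ev c (voa_Y_lower0 u v); exists N => i /hN ->.
  exact: linear_fun0 ((voa_Y_bil _).1 _).
by move=> e; rewrite /jacobi_at twist0; exact: (voa_jacobi hX).
Qed.

Lemma voa_commutator (m : nat) (q : int) u v w :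
  \sum_(i < m.+1) gbinom C m%:R i *: mode (mode u i v) (m%:Z + q - i%:Z) w =
  mode u m (mode v q w) - mode v q (mode u m w).
Proof.
have /borcherds_comm := @voa_borcherds u v w m%:R q%:~R 0 (ex_intro _ m%:Z erefl).
rewrite !(@voa_Y_at _ _ (- m%:R - 1) m) // !(@voa_Y_at _ _ (- q%:~R - 1) q) // => <-.
apply: eq_bigr => i _; congr (_ *: _).
rewrite (@voa_Y_at _ _ (- 1 - i%:R) i) ?(@voa_Y_at _ _ _ (m%:Z + q - i%:Z)) //.
  by rewrite !intrD !mulrNz -!pmulrn; ring.
by rewrite -pmulrn addrC.
Qed.

Lemma modeZl k a u v : mode (a *: u) k v = a *: mode u k v.
Proof. exact: (linear_funZ (f := fun u => mode u k v) _ _ ((bil k).1 v)). Qed.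
Lemma mode0l k v : mode 0 k v = 0.
Proof. exact: (linear_fun0 (f := fun u => mode u k v) ((bil k).1 v)). Qed.
Lemma mode0r k u : mode u k 0 = 0.
Proof. exact: (linear_fun0 ((bil k).2 u)). Qed.

Lemma L_linear n : linear (L n).
Proof. exact: (bil _).2. Qed.

Lemma Lm1_mode u k v : mode (L (-1) u) k v = - k%:~R *: mode u (k - 1) v.
Proof.
rewrite -(@voa_Y_at _ _ (- k%:~R - 1) k) // (voa_Lm1 hX) /fderiv subrK.
rewrite (@voa_Y_at _ _ _ (k - 1)); last by rewrite intrD mulrNz; ring.
by rewrite rmorphN /= ratr_int.
Qed.

Lemma L0_gr s u : gr s u -> L 0 u = s%:~R *: u.
Proof. by rewrite (voa_L0 hX). Qed.

(** The commutator of L(0) = omega_1 with u_k. *)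
Lemma voa_mode_gr s t k u v : gr s u -> gr t v -> gr (s + t - k - 1) (mode u k v).
Proof.
move=> us vt; rewrite (voa_L0 hX) /=.
have := voa_commutator 1 k (voa_conf X) u v.
rewrite !big_ord_recl big_ord0 addr0 /= gbinom0 gbinom1 rmorph1 !scale1r addr0.
rewrite -[mode (voa_conf X) 0%Z u]/(L (-1) u) -[mode (voa_conf X) 1%Z u]/(L 0 u).
rewrite -[mode (voa_conf X) 1%Z (mode u k v)]/(L 0 (mode u k v)).
rewrite -[mode (voa_conf X) 1%Z v]/(L 0 v) (L0_gr us) (L0_gr vt).
rewrite Lm1_mode modeZl (linear_funZ _ _ ((bil k).2 u)) => /esym/eqP.
rewrite subr_eq => /eqP ->.
have -> : 1 + k - 1 = k :> int by ring.
rewrite scalerA -!scalerDl; congr (_ *: _).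
by rewrite rmorph1 !intrD !mulrNz; ring.
Qed.

Lemma L_gr n s u : gr s u -> gr (s - n) (L n u).
Proof.
move=> us; rewrite (voa_L0 hX) /=.
have := voa_virasoro hX 0 n u; rewrite (L0_gr us) (linear_funZ _ _ (L_linear n)).
rewrite !add0r oppr0 !mul0r scale0r if_same addr0 => /eqP; rewrite subr_eq => /eqP ->.
by rewrite -scalerDl -intrD addrC.
Qed.

(** The commutator of L(1) = omega_2 with u_k. *)
Lemma L1_mode s k u v : gr s u ->
  L 1 (mode u k v) = mode (L 1 u) k v
    + (2 * s%:~R - k%:~R - 2) *: mode u (k + 1) v + mode u k (L 1 v).
Proof.
move=> us; have := voa_commutator 2 k (voa_conf X) u v.
rewrite !big_ord_recl big_ord0 addr0 /= gbinom0 gbinom1 scale1r addr0.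
rewrite -[mode (voa_conf X) 0%Z u]/(L (-1) u) -[mode (voa_conf X) 1%Z u]/(L 0 u).
rewrite -[mode (voa_conf X) 2%Z (mode u k v)]/(L 1 (mode u k v)).
rewrite -[mode (voa_conf X) 2%Z v]/(L 1 v) -[mode (voa_conf X) 2%Z u]/(L 1 u).
rewrite (L0_gr us) Lm1_mode modeZl => /esym/eqP; rewrite subr_eq => /eqP ->.
have -> : 2 + k - 1 = k + 1 :> int by ring.
have -> : 2 + k - (bump 0 (bump 0 0))%:Z = k :> int by rewrite /bump /=; ring.
have -> : gbinom C 2 (bump 0 (bump 0 0)) = 1.
  have := gbinomS C 2 1; rewrite gbinom1 /bump /= -[_ - _]/(1 : rat) !ratr_nat.
  by rewrite rmorph1 mul1r -[RHS]mulr1 => /(mulfI (natS_neq0 _ _)).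
rewrite scale1r scalerA addrA -scalerDl [X in X + mode u k _]addrC.
congr (_ *: _ + _ + _).
by rewrite !intrD ratr_nat; ring.
Qed.

Definition dL (j : nat) u := (j`!%:R : C)^-1 *: iter j (L 1) u.

Lemma dL0 u : dL 0 u = u.
Proof. by rewrite /dL fact0 invr1 scale1r. Qed.

Lemma L1_dL j u : L 1 (dL j u) = j.+1%:R *: dL j.+1 u.
Proof.
rewrite /dL (linear_funZ _ _ (L_linear 1)) scalerA factS natrM invfM mulrA.
by rewrite mulfV ?mul1r // pnatr_eq0.
Qed.

Lemma dLS j u : dL j.+1 u = j.+1%:R^-1 *: L 1 (dL j u).
Proof. by rewrite L1_dL scalerA mulVf ?scale1r // pnatr_eq0. Qed.

Lemma dL_linear j : linear (dL j).
Proof.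
elim: j => [|j IH] a u v; first by rewrite !dL0.
by rewrite !dLS IH L_linear scalerDr !scalerA mulrC.
Qed.

Lemma dL_gr j s u : gr s u -> gr (s - j%:Z) (dL j u).
Proof.
move=> us; elim: j => [|j IH]; first by rewrite dL0 subr0.
rewrite dLS; apply: (subspaceZ _ (gr_subspace dS _)).
have -> : s - j.+1%:Z = s - j%:Z - 1 by lia.
exact: L_gr.
Qed.

Lemma dL_nilp s u : gr s u -> exists J, forall j, (J <= j)%N -> dL j u = 0.
Proof.
move=> us; have [s0 low] := voa_bounded hX.
exists (`|s - s0|%N.+1) => j le; have := dL_gr j us.
by rewrite low /=; last lia.
Qed.

Lemma dL_dL j k u : dL j (dL k u) = 'C(j + k, j)%:R *: dL (j + k) u.
Proof.
elim: j => [|j IH]; first by rewrite dL0 add0n bin0 scale1r.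
rewrite dLS IH (linear_funZ _ _ (L_linear 1)) L1_dL !scalerA -addSn; congr (_ *: _).
have jn : j.+1%:R != 0 :> C by rewrite pnatr_eq0.
apply: (mulfI jn); rewrite -!mulrA mulVKf // !mulrA -!natrM.
by rewrite addSn -mul_bin_diag mulnC.
Qed.

(** For u of weight s, the coefficient of x^M z^(-n-1) in
    exp(x L(1)) Y(u, z) exp(-x L(1)) =
    Y(exp(x (1 - x z) L(1)) (1 - x z)^(-2 L(0)) u, z/(1 - x z)). *)
Definition conjL s u (n : int) M v :=
  \sum_(j < M.+1) gbinom C ((2 * s)%:~R - j%:R - 2 - n%:~R) (M - j)%N *:
     mode (dL j u) (n + (M - j)%N%:Z) v.

(** The derivative in x of the conjugation formula; on coefficients it is
    Pascal's rule together with the recursion gbinomS. *)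
Lemma L1_conjL s u n M v : gr s u ->
  L 1 (conjL s u n M v) = M.+1%:R *: conjL s u n M.+1 v + conjL s u n M (L 1 v).
Proof.
move=> us; rewrite /conjL (linear_sumE _ _ _ (L_linear 1)).
pose a j i := gbinom C ((2 * s)%:~R - j%:R - 2 - n%:~R) i.
pose Y j := mode (dL j u) (n + (M.+1 - j)%N%:Z) v.
transitivity (\sum_(j < M.+1) (a j (M - j)%N * j.+1%:R) *: Y j.+1 +
  \sum_(j < M.+1) (a j (M - j)%N * ratr ((2 * s)%:~R - j%:R - 2 - n%:~R - M%:R)) *: Y j +
  \sum_(j < M.+1) a j (M - j)%N *: mode (dL j u) (n + (M - j)%N%:Z) (L 1 v)).
  rewrite -!big_split; apply: eq_bigr => j _ /=.
  have le : (j <= M)%N by rewrite -ltnS.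
  rewrite (linear_funZ _ _ (L_linear 1)) (L1_mode _ _ (dL_gr j us)) L1_dL modeZl.
  rewrite !scalerDr !scalerA /Y subSS.
  have -> : n + (M - j)%N%:Z + 1 = n + (M.+1 - j)%N%:Z by lia.
  congr (_ + _ *: _ + _); congr (_ * _).
  rewrite !rmorphB /= !ratr_int !ratr_nat !intrD ?mulrNz intrM -!pmulrn natrB //.
  by ring.
congr (_ + _).
transitivity (\sum_(j < M.+2) (j%:R * gbinom C ((2 * s)%:~R - j%:R + 1 - 2 - n%:~R) (M.+1 - j)%N) *: Y j +
  \sum_(j < M.+2) (if (j <= M)%N then
     a j (M - j)%N * ratr ((2 * s)%:~R - j%:R - 2 - n%:~R - M%:R) else 0) *: Y j).
  congr (_ + _).
    rewrite [RHS]big_ord_recl /= mul0r scale0r add0r; apply: eq_bigr => j _.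
    rewrite /bump /= add1n subSS mulrC; congr (_ * gbinom _ _ _ *: _).
    by rewrite -natr1; ring.
  rewrite [RHS]big_ord_recr /= ltnn scale0r addr0; apply: eq_bigr => j _.
  by rewrite -ltnS ltn_ord.
rewrite -big_split scaler_sumr; apply: eq_bigr => j _ /=.
rewrite -scalerDl scalerA; congr (_ *: _).
have [jM|jM] := leqP j M; last first.
  have -> : nat_of_ord j = M.+1 by apply/eqP; rewrite eqn_leq jM -ltnS ltn_ord.
  by rewrite subnn !gbinom0 addr0.
rewrite subSn // /a; set A := (2 * s)%:~R - j%:R - 2 - n%:~R.
have -> : (2 * s)%:~R - j%:R + 1 - 2 - n%:~R = A + 1 by rewrite /A; ring.
rewrite gbinom_pascal; have := gbinomS C A (M - j)%N.
move: (gbinom C A (M - j).+1) (gbinom C A (M - j)%N) => x y.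
rewrite -[in M.+1%:R](subnK jM) -addSn natrD !rmorphB /= !ratr_nat natrB //.
by move=> h; rewrite [RHS]mulrDl h; ring.
Qed.

(** exp(x L(1)) Y(u, z) v, with exp(x L(1)) moved past Y(u, z). *)
Lemma dL_mode s u n N v : gr s u ->
  dL N (mode u n v) = \sum_(k < N.+1) conjL s u n (N - k)%N (dL k v).
Proof.
move=> us; elim: N => [|N IH].
  by rewrite big_ord1 !dL0 /conjL big_ord1 !dL0 gbinom0 scale1r addr0.
have N0 : N.+1%:R != 0 :> C by rewrite pnatr_eq0.
apply: (scalerI N0); rewrite -L1_dL IH (linear_sumE _ _ _ (L_linear 1)).
under eq_bigr do rewrite (L1_conjL _ _ _ us) L1_dL.
have cZ k M a y : conjL s u k M (a *: y) = a *: conjL s u k M y.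
  rewrite /conjL scaler_sumr; apply: eq_bigr => j _.
  by rewrite (linear_funZ _ _ ((bil _).2 _)) !scalerA mulrC.
rewrite big_split /=.
transitivity (\sum_(k < N.+2) (N.+1 - k)%N%:R *: conjL s u n (N.+1 - k)%N (dL k v) +
  \sum_(k < N.+2) k%:R *: conjL s u n (N.+1 - k)%N (dL k v)).
  congr (_ + _).
    rewrite [RHS]big_ord_recr /= subnn scale0r addr0; apply: eq_bigr => k _.
    by rewrite subSn // -ltnS.
  rewrite [RHS]big_ord_recl /= scale0r add0r; apply: eq_bigr => k _.
  by rewrite /bump /= add1n subSS cZ.
rewrite -big_split scaler_sumr; apply: eq_bigr => k _ /=.
by rewrite -scalerDl -natrD subnK // -ltnS.
Qed.

End VOA.

(** * Contragredient mode families *)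

Lemma sum_finite_bound (A : Type) (P : A -> nat -> Prop) (s : seq A) :
  (forall a, exists N, forall j, (N <= j)%N -> P a j) ->
  exists N, forall j, (N <= j)%N -> forall i, (i < size s)%N -> forall a0, P (nth a0 s i) j.
Proof.
move=> h; elim: s => [|a s [N hN]]; first by exists 0%N.
have [N' hN'] := h a; exists (maxn N N') => j; rewrite geq_max => /andP[l1 l2].
by case=> [|i] //= lt a0; [exact: hN' | exact: hN].
Qed.

Lemma eventually0_sum (U : zmodType) (I : finType) (F : I -> nat -> U) : (forall j, eventually0 (F j)) ->
  eventually0 (fun i => \sum_j F j i).
Proof.
move=> h; pose N j := projT1 (cid (h j)).
exists (\max_j N j) => i le; rewrite big1 // => j _; apply: (projT2 (cid (h j))).
exact: leq_trans (leq_bigmax j) le.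
Qed.

Lemma natsum_sum2 (U : zmodType) (I I' : finType) (F : I -> I' -> nat -> U) : (forall j k, eventually0 (F j k)) ->
  natsum (fun i => \sum_j \sum_k F j k i) = \sum_j \sum_k natsum (F j k).
Proof.
move=> h; rewrite natsum_sum => [|j]; last exact: eventually0_sum.
by apply: eq_bigr => j _; rewrite natsum_sum.
Qed.

Section Contra.
Variable R : realType.
Local Notation C := R[i].
Variables (U : lmodType C) (X : voa_data U).
Hypothesis hX : is_voa X.
Implicit Types u v w : U.
Local Notation gr := (voa_gr X).
Local Notation mode := (voa_mode X).
Local Notation L := (voa_L X).
Local Notation dL := (dL X).

Let dS := voa_direct hX.
Let bil := voa_bilinear hX.
Let dLl j := dL_linear hX j.
Let cl s : linear (component gr s) := component_linear s dS.

Lemma component_bound u : exists (s : seq int) (J : nat), [/\ uniq s,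
  forall t, t \notin s -> component gr t u = 0
  & forall t j, (J <= j)%N -> dL j (component gr t u) = 0].
Proof.
have [s [us _ out]] := component_sum dS u.
have nil t : exists J, forall j, (J <= j)%N -> dL j (component gr t u) = 0.
  by apply: (dL_nilp hX (s := t)); exact: (component_in dS).
have [J hJ] := sum_finite_bound s nil.
exists s, J; split => // t j le; have [ts|/out ->] := boolP (t \in s).
  by have := hJ j le (index t s) _ 0; rewrite index_mem nth_index //; exact.
exact: linear_fun0.
Qed.

Section Modes.
Variable N : lmodType C.
Implicit Types (m : U -> rat -> N -> N) (x : N).

(** The modes of Y(exp(z L(1)) (-z^-2)^L(0) u, 1/z), where Y has modes m. *)
Definition contra_modes m u t x : N :=
  \sum_(s \in [set: int]) (-1) ^ s *:
    natsum (fun j => m (dL j (component gr s u)) ((2 * s)%:~R - j%:R - 2 - t) x).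

Definition mode_bilinear m := forall t, bilinear_fun (fun u x => m u t x).

(** Left modes annihilate a given vector for large t, right modes for small t;
    the boolean b selects left modes. *)
Definition mode_trunc (b : bool) m :=
  forall u x, exists t0, forall t, (if b then t0 < t else t < t0) -> m u t x = 0.

(** The class of a vector is the coset of Z containing the indices of its
    nonzero modes. *)
Definition mode_support (E : rat -> set U) m :=
  forall a u t x, E a u -> ~ is_int (t - a) -> m u t x = 0.

(** For b = false the composition is reversed: the modes act from the right. *)
Definition comp_modes (b : bool) m u (s : rat) v (t : rat) x :=
  if b then m u s (m v t x) else m v t (m u s x).

Definition borcherds_eq (b : bool) m u v (p q : rat) (n : int) x :=
  natsum (fun i => gbinom C p i *: m (mode u (n + i%:Z) v) (p + q - i%:R) x)
  = natsum (fun i => (gbinom C n%:~R i * (-1) ^+ i) *: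
      comp_modes b m u (p + n%:~R - i%:R) v (q + i%:R) x)
  - (-1) ^ n *: natsum (fun i => (gbinom C n%:~R i * (-1) ^+ i) *:
      comp_modes b m v (q + n%:~R - i%:R) u (p + i%:R) x).

Definition mode_borcherds (b : bool) (E : rat -> set U) m :=
  forall a u v (p q : rat) (n : int) x, E a u -> is_int (p - a) ->
  borcherds_eq b m u v p q n x.

Section Bilinear.
Variable m : U -> rat -> N -> N.
Hypothesis mb : mode_bilinear m.

Lemma m0l t x : m 0 t x = 0. Proof. exact: (linear_fun0 ((mb t).1 x)). Qed.
Lemma m0r u t : m u t 0 = 0. Proof. exact: (linear_fun0 ((mb t).2 u)). Qed.
Lemma mDl u v t x : m (u + v) t x = m u t x + m v t x.
Proof. exact: (linear_funD _ _ ((mb t).1 x)). Qed.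
Lemma mDr u t x y : m u t (x + y) = m u t x + m u t y.
Proof. exact: (linear_funD _ _ ((mb t).2 u)). Qed.
Lemma mZl a u t x : m (a *: u) t x = a *: m u t x.
Proof. exact: (linear_funZ _ _ ((mb t).1 x)). Qed.
Lemma mZr a u t x : m u t (a *: x) = a *: m u t x.
Proof. exact: (linear_funZ _ _ ((mb t).2 u)). Qed.
Lemma m_suml (I : Type) (s : seq I) (F : I -> U) t x :
  m (\sum_(i <- s) F i) t x = \sum_(i <- s) m (F i) t x.
Proof. exact: (linear_sumE _ _ _ ((mb t).1 x)). Qed.
Lemma m_sumr (I : Type) (s : seq I) (F : I -> N) u t :
  m u t (\sum_(i <- s) F i) = \sum_(i <- s) m u t (F i).
Proof. exact: (linear_sumE _ _ _ ((mb t).2 u)). Qed.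

Lemma contra_bound u (s : seq int) (J : nat) t x : uniq s ->
  (forall t, t \notin s -> component gr t u = 0) ->
  (forall t j, (J <= j)%N -> dL j (component gr t u) = 0) ->
  contra_modes m u t x = \sum_(r <- s) (-1) ^ r *: \sum_(j < J)
     m (dL j (component gr r u)) ((2 * r)%:~R - j%:R - 2 - t) x.
Proof.
move=> us out hJ; rewrite /contra_modes (fsum_seq us) => [|r /out ->]; last first.
  by rewrite natsum1 ?(linear_fun0 (dLl _)) ?m0l ?scaler0 // => i _;
     rewrite (linear_fun0 (dLl _)) m0l.
apply: eq_bigr => r _; rewrite (natsumE (N := J)) // => j /hJ ->.
by rewrite m0l.
Qed.

Lemma contra_hom r u J t x : gr r u -> (forall j, (J <= j)%N -> dL j u = 0) ->
  contra_modes m u t x = (-1) ^ r *: \sum_(j < J) m (dL j u) ((2 * r)%:~R - j%:R - 2 - t) x.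
Proof.
move=> ur hJ; rewrite (@contra_bound _ [:: r] J) ?big_seq1 ?(component_id dS) //.
  by move=> s; rewrite inE => sr; rewrite (component_out dS ur).
move=> s j le; have [->|sr] := eqVneq s r; first by rewrite (component_id dS) // hJ.
by rewrite (component_out dS ur) // (linear_fun0 (dLl _)).
Qed.

Lemma contra_bilinear : mode_bilinear (contra_modes m).
Proof.
move=> t; split=> [x a u v|u a x y].
  have [s1 [J1 [us1 out1 nil1]]] := component_bound u.
  have [s2 [J2 [us2 out2 nil2]]] := component_bound v.
  pose s := undup (s1 ++ s2); pose J := maxn J1 J2.
  have us : uniq s by exact: undup_uniq.
  have o1 r : r \notin s -> component gr r u = 0.
    by rewrite mem_undup mem_cat negb_or => /andP[/out1].
  have o2 r : r \notin s -> component gr r v = 0.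
    by rewrite mem_undup mem_cat negb_or => /andP[_ /out2].
  have n1 r j : (J <= j)%N -> dL j (component gr r u) = 0.
    by rewrite geq_max => /andP[/nil1].
  have n2 r j : (J <= j)%N -> dL j (component gr r v) = 0.
    by rewrite geq_max => /andP[_ /nil2].
  rewrite (@contra_bound u s J) // (@contra_bound v s J) // (@contra_bound _ s J) //.
  - rewrite scaler_sumr -big_split; apply: eq_bigr => r _ /=.
    rewrite scalerA [a * _]mulrC -scalerA -scalerDr; congr (_ *: _).
    rewrite scaler_sumr -big_split; apply: eq_bigr => j _ /=.
    by rewrite cl dLl mDl mZl.
  - by move=> r rs; rewrite cl o1 // o2 // scaler0 addr0.
  - by move=> r j le; rewrite cl dLl n1 // n2 // scaler0 addr0.
have [s [J [us out nil]]] := component_bound u.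
rewrite !(@contra_bound u s J) // scaler_sumr -big_split; apply: eq_bigr => r _ /=.
rewrite scalerA [a * _]mulrC -scalerA -scalerDr; congr (_ *: _).
rewrite scaler_sumr -big_split; apply: eq_bigr => j _ /=.
by rewrite mDr mZr.
Qed.

(** Inversion of the variable exchanges the two directions of truncation. *)
Lemma contra_trunc b : mode_trunc b m -> mode_trunc (~~ b) (contra_modes m).
Proof.
move=> tr u x; have [s [J [us out nil]]] := component_bound u.
pose van (F : rat -> N) := exists t0, forall t, (if ~~ b then t0 < t else t < t0) -> F t = 0.
have one r j : van (fun t => m (dL j (component gr r u)) ((2 * r)%:~R - j%:R - 2 - t) x).
  have [t0 h] := tr (dL j (component gr r u)) x.
  exists ((2 * r)%:~R - j%:R - 2 - t0) => t.
  by case: b {tr van} h => /= h lt; apply: h; lra.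
have all (I : Type) (q : seq I) (F : I -> rat -> N) :
    (forall i, van (F i)) -> van (fun t => \sum_(i <- q) F i t).
  move=> h; elim: q => [|i q [t1 h1]]; first by exists 0 => t _; rewrite big_nil.
  have [t2 h2] := h i.
  exists (if ~~ b then Num.max t1 t2 else Num.min t1 t2) => t lt.
  rewrite big_cons h1 ?h2 ?addr0 //; move: lt; case: (~~ b);
     by rewrite ?gt_max ?lt_min => /andP[].
have [r|t0 h] := all _ s (fun r t => (-1) ^ r *: \sum_(j < J)
     m (dL j (component gr r u)) ((2 * r)%:~R - j%:R - 2 - t) x).
  have [t0 h] := all _ (index_enum 'I_J) _ (fun j : 'I_J => one r j).
  by exists t0 => t /h ->; rewrite scaler0.
by exists t0 => t lt; rewrite (@contra_bound u s J) //; exact: h.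
Qed.

Variable b : bool.
Hypothesis tr : mode_trunc b m.

Lemma comp_ev u (c : rat) v (c' : rat) x :
  eventually0 (fun i => comp_modes b m u (c - i%:R) v (c' + i%:R) x).
Proof.
rewrite /comp_modes; case: b tr => tr'.
  have [t0 h] := tr' v x; have [K hK] := rat_bound (t0 - c').
  exists K => i /hK lt; rewrite [m v _ _]h ?m0r //; lra.
have [t0 h] := tr' u x; have [K hK] := rat_bound (c - t0).
exists K => i /hK lt; rewrite [m u _ _]h ?m0r //; lra.
Qed.

Lemma mode_ev u n v p x : eventually0 (fun i => m (mode u (n + i%:Z) v) (p - i%:R) x).
Proof.
have [k0 h] := voa_trunc hX u v; exists (`|k0 - n|.+1)%N => i le.
by rewrite h ?m0l //; lia.
Qed.

Lemma eventually0Z (f : nat -> C) (g : nat -> N) :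
  eventually0 g -> eventually0 (fun i => f i *: g i).
Proof. by move=> [K h]; exists K => i /h ->; rewrite scaler0. Qed.

Lemma compDl u u' s v t x : comp_modes b m (u + u') s v t x = comp_modes b m u s v t x + comp_modes b m u' s v t x.
Proof. by rewrite /comp_modes; case: b; rewrite mDl ?mDr. Qed.
Lemma compDr u s v v' t x : comp_modes b m u s (v + v') t x = comp_modes b m u s v t x + comp_modes b m u s v' t x.
Proof. by rewrite /comp_modes; case: b; rewrite mDl ?mDr. Qed.
Lemma comp0l s v t x : comp_modes b m 0 s v t x = 0.
Proof. by rewrite /comp_modes; case: b; rewrite m0l ?m0r. Qed.
Lemma comp0r u s t x : comp_modes b m u s 0 t x = 0.
Proof. by rewrite /comp_modes; case: b; rewrite m0l ?m0r. Qed.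

Lemma borcherds_eqDr u v v' p q n x : borcherds_eq b m u v p q n x ->
  borcherds_eq b m u v' p q n x -> borcherds_eq b m u (v + v') p q n x.
Proof.
rewrite /borcherds_eq => h h'.
have evc := comp_ev; have evm := mode_ev; have evZ := eventually0Z.
under eq_natsum do rewrite (linear_funD _ _ ((bil _).2 _)) mDl scalerDr.
rewrite natsumD ?h ?h'; try by apply: evZ; exact: evm.
under [X in _ = X - _]eq_natsum do rewrite compDr scalerDr.
rewrite [in RHS]natsumD; try by apply: evZ; exact: evc.
under [X in _ = _ - _ *: X]eq_natsum do rewrite compDl scalerDr.
rewrite [X in _ = _ - _ *: X]natsumD; try by apply: evZ; exact: evc.
by rewrite scalerDr opprD addrACA.
Qed.

Lemma borcherds_eqDl u u' v p q n x : borcherds_eq b m u v p q n x ->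
  borcherds_eq b m u' v p q n x -> borcherds_eq b m (u + u') v p q n x.
Proof.
rewrite /borcherds_eq => h h'.
have evc := comp_ev; have evm := mode_ev; have evZ := eventually0Z.
under eq_natsum do rewrite (linear_funD (f := fun u => mode u _ v) _ _ ((bil _).1 _)) mDl scalerDr.
rewrite natsumD ?h ?h'; try by apply: evZ; exact: evm.
under [X in _ = X - _]eq_natsum do rewrite compDl scalerDr.
rewrite [in RHS]natsumD; try by apply: evZ; exact: evc.
under [X in _ = _ - _ *: X]eq_natsum do rewrite compDr scalerDr.
rewrite [X in _ = _ - _ *: X]natsumD; try by apply: evZ; exact: evc.
by rewrite scalerDr opprD addrACA.
Qed.

Lemma borcherds_eq0r u p q n x : borcherds_eq b m u 0 p q n x.
Proof.
rewrite /borcherds_eq /natsum !fsum_zero ?scaler0 ?subr0 // => i.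
- by rewrite comp0l scaler0.
- by rewrite comp0r scaler0.
- by rewrite (linear_fun0 ((bil _).2 _)) m0l scaler0.
Qed.

Lemma borcherds_eq0l v p q n x : borcherds_eq b m 0 v p q n x.
Proof.
rewrite /borcherds_eq /natsum !fsum_zero ?scaler0 ?subr0 // => i.
- by rewrite comp0r scaler0.
- by rewrite comp0l scaler0.
- by rewrite (linear_fun0 (f := fun u => mode u _ v) ((bil _).1 _)) m0l scaler0.
Qed.

End Bilinear.

(** Conjugation by (-1)^L(0) negates L(1), so that the two exponentials cancel;
    on coefficients this is the vanishing of the alternating sums of binomial
    coefficients. *)
Lemma contraK m u t x : mode_bilinear m -> contra_modes (contra_modes m) u t x = m u t x.
Proof.
move=> mb; have cb := contra_bilinear mb; have ccb := contra_bilinear cb.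
elim/(graded_ind dS): u => [|u v IH IH'|r u ur].
- by rewrite (m0l mb) (m0l ccb).
- by rewrite (mDl mb) (mDl ccb) IH IH'.
have [J hJ] := dL_nilp hX ur.
have dd k j : dL k (dL j u) = 'C(k + j, k)%:R *: dL (k + j) u := dL_dL hX k j u.
rewrite (contra_hom cb _ _ ur hJ).
pose G j k := ((-1) ^+ j * 'C(k + j, k)%:R) *: m (dL (k + j) u) (t - (k + j)%:R) x.
have G0 k l : (J <= k)%N || (J <= l)%N -> G k l = 0.
  by rewrite /G => h; rewrite hJ ?(m0l mb) ?scaler0 //; lia.
transitivity (\sum_(j < J) \sum_(k < J) G j k).
  rewrite scaler_sumr; apply: eq_bigr => j _.
  rewrite (contra_hom (J := J) mb _ _ (dL_gr hX j ur)) => [|k le]; last first.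
    by rewrite dd hJ ?scaler0 //; lia.
  rewrite scalerA scaler_sumr; apply: eq_bigr => k _.
  rewrite dd (mZl mb) /G -[in RHS]scalerA; congr (_ *: (_ *: m _ _ x)).
    rewrite -expfzDr ?oppr_eq0 ?oner_eq0 //.
    have -> : r + (r - j%:Z) = (r + r) - j%:Z by ring.
    rewrite expfzDr ?oppr_eq0 ?oner_eq0 // expfzDr ?oppr_eq0 ?oner_eq0 //.
    rewrite -exprzMl ?unitrN1 // mulrNN mulr1 exp1rz mul1r.
    by rewrite -exprz_inv invrN1.
  rewrite natrD !intrM intrB -pmulrn; ring.
rewrite -(antidiagonal_sum (leqnn (J + J)) G0).
rewrite -(natsumE (N := J + J) (F := fun M => \sum_(j < M.+1) G j (M - j)%N)); last first.
  by move=> M le; rewrite big1 // => j _; apply: G0; lia.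
rewrite natsum1 => [|M M0].
  by rewrite big_ord1 /G bin0 mulr1 expr0 scale1r dL0 subr0.
transitivity ((\sum_(j < M.+1) (-1) ^+ j * 'C(M, j)%:R) *: m (dL M u) (t - M%:R) x).
  rewrite scaler_suml; apply: eq_bigr => j _.
  have le : (j <= M)%N by rewrite -ltnS.
  by rewrite /G subnK // bin_sub.
have := exprDn (1 : C) (-1) M; rewrite subrr expr0n -(prednK M0) /= prednK // => e.
rewrite (eq_bigr (fun j : 'I_M.+1 => 1 ^+ (M - j) * (-1) ^+ j *+ 'C(M, j))) => [|j _].
  by rewrite -e scale0r.
by rewrite expr1n mul1r mulr_natr.
Qed.

Section Main.
Variables (m : U -> rat -> N -> N) (b : bool) (E : rat -> set U).
Hypotheses (mb : mode_bilinear m) (tr : mode_trunc b m).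
Hypotheses (EZ : forall a c u, E a u -> E a (c *: u))
  (Ec : forall a s u, E a u -> E a (component gr s u))
  (E1 : forall a u, E a u -> E a (L 1 u)).

Lemma E_dL a j u : E a u -> E a (dL j u).
Proof.
move=> Eu; elim: j => [|j IH]; first by rewrite dL0.
by rewrite (dLS hX); apply: EZ; exact: E1.
Qed.

Lemma contra_supp : mode_support E m -> mode_support (fun a => E (- a)) (contra_modes m).
Proof.
move=> sE a u t x Eu ta; rewrite /contra_modes fsum_zero // => s.
have z j : m (dL j (component gr s u)) ((2 * s)%:~R - j%:R - 2 - t) x = 0.
  apply: (sE (- a)); first by apply: E_dL; exact: Ec.
  move=> [k ek]; apply: ta; exists (2 * s - j%:Z - 2 - k).
  by rewrite !intrB -ek -pmulrn; ring.
by rewrite natsum1 ?z ?scaler0 // => i _; rewrite z.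
Qed.

Lemma comp_contra r u r' v J s t x : gr r u -> gr r' v ->
  (forall j, (J <= j)%N -> dL j u = 0) -> (forall j, (J <= j)%N -> dL j v = 0) ->
  comp_modes (~~ b) (contra_modes m) u s v t x = (-1) ^ (r + r') *: \sum_(j < J) \sum_(k < J)
    comp_modes b m (dL k v) ((2 * r')%:~R - k%:R - 2 - t) (dL j u) ((2 * r)%:~R - j%:R - 2 - s) x.
Proof.
move=> ur vr hu hv; rewrite /comp_modes expfzDr ?oppr_eq0 ?oner_eq0 //; case: b => /=.
  rewrite (contra_hom mb _ _ vr hv) (contra_hom mb _ _ ur hu).
  rewrite [_ ^ r * _]mulrC -scalerA; congr (_ *: _); rewrite [in RHS]exchange_big /= [RHS]scaler_sumr.
  apply: eq_bigr => k _; rewrite (mZr mb); congr (_ *: _).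
  by rewrite (m_sumr mb).
rewrite (contra_hom mb _ _ ur hu) (contra_hom mb _ _ vr hv).
rewrite -scalerA; congr (_ *: _); rewrite [RHS]scaler_sumr.
apply: eq_bigr => k _; rewrite (mZr mb); congr (_ *: _).
by rewrite (m_sumr mb).
Qed.

Hypothesis bor : mode_borcherds b E m.

(** Both sides are combinations of the vectors
    m((L(1)^j u / j!)_(n+T) (L(1)^k v / k!), .). On the left these come from
    dL_mode, and their coefficients sum up to gbinom (P j) T by
    gbinom_alternating, which is the coefficient of the same vector in Borcherds'
    identity for L(1)^j u, L(1)^k v at the inverted indices P j, Q k. On the right
    reversing the compositions exchanges the two products, which costs the
    factor - (-1)^n. *)
Lemma contra_borcherds_hom a u v r r' (p q : rat) (n : int) x :
  E (- a) u -> gr r u -> gr r' v -> is_int (p - a) ->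
  borcherds_eq (~~ b) (contra_modes m) u v p q n x.
Proof.
move=> Eu ur vr pa; rewrite /borcherds_eq.
have [J1 h1] := dL_nilp hX ur; have [J2 h2] := dL_nilp hX vr.
pose J := (maxn J1 J2).+1.
have hu j : (J <= j)%N -> dL j u = 0 by move=> le; apply: h1; lia.
have hv j : (J <= j)%N -> dL j v = 0 by move=> le; apply: h2; lia.
have [I0 hI] : exists I0, forall i, (I0 <= i)%N -> forall j k,
    mode (dL j u) (n + i%:Z) (dL k v) = 0.
  have one (jk : nat * nat) : exists K, forall i, (K <= i)%N ->
      mode (dL jk.1 u) (n + i%:Z) (dL jk.2 v) = 0.
    have [k0 h] := voa_trunc hX (dL jk.1 u) (dL jk.2 v).
    by exists (`|k0 - n|.+1)%N => i le; rewrite h //; lia.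
  have [K hK] := sum_finite_bound [seq (j, k) | j <- iota 0 J, k <- iota 0 J] one.
  exists K => i le j k.
  have [jJ|/hu ->] := ltnP j J; last by rewrite (mode0l hX).
  have [kJ|/hv ->] := ltnP k J; last by rewrite (mode0r hX).
  set s := [seq _ | _ <- _, _ <- _] in hK.
  have js : (j, k) \in s by apply: allpairs_f; rewrite mem_iota.
  by have := hK i le (index (j, k) s) _ (0, 0)%N; rewrite index_mem nth_index //; exact.
(* The indices that p and q become under inversion, corrected by n because the
   products of Borcherds' identity carry n on their left factor. *)
pose P j : rat := (2 * r)%:~R - j%:R - 2 - p - n%:~R.
pose Q k : rat := (2 * r')%:~R - k%:R - 2 - q - n%:~R.
pose c i : C := gbinom C n%:~R i * (-1) ^+ i.
pose A j k := natsum (fun i => c i *: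
  comp_modes b m (dL j u) (P j + n%:~R - i%:R) (dL k v) (Q k + i%:R) x).
pose B j k := natsum (fun i => c i *:
  comp_modes b m (dL k v) (Q k + n%:~R - i%:R) (dL j u) (P j + i%:R) x).
pose D j k := natsum (fun i => gbinom C (P j) i *:
  m (mode (dL j u) (n + i%:Z) (dL k v)) (P j + Q k - i%:R) x).
have DAB j k : D j k = A j k - (-1) ^ n *: B j k.
  apply: (bor (a := - a)); first exact: E_dL.
  have [z pz] := pa; exists (2 * r - j%:Z - 2 - n - z).
  by rewrite /P !intrB -pz -pmulrn; ring.
have evc u' v' s t : eventually0 (fun i => c i *: comp_modes b m u' (s - i%:R) v' (t + i%:R) x).
  by apply: eventually0Z; exact: comp_ev.
have sgn2 : (-1) ^ n * (-1) ^ n = 1 :> C.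
  by rewrite -exprzMl ?unitrN1 // mulrNN mulr1 exp1rz.
have S1 : natsum (fun i => c i *: comp_modes (~~ b) (contra_modes m) u (p + n%:~R - i%:R) v (q + i%:R) x)
    = (-1) ^ (r + r') *: \sum_(j < J) \sum_(k < J) B j k.
  rewrite /B -natsum_sum2 => [|j k]; last exact: evc.
  rewrite (natsum_linear (f := *:%R ((-1) ^ (r + r')))).
  - apply: eq_natsum => i; rewrite (comp_contra _ _ _ ur vr hu hv) scalerA mulrC -scalerA.
    congr (_ *: _); rewrite scaler_sumr; apply: eq_bigr => j _.
    rewrite scaler_sumr; apply: eq_bigr => k _; congr (_ *: comp_modes _ _ _ _ _ _ _).
      by rewrite /Q; ring.
    by rewrite /P; ring.
  - by move=> z y y'; rewrite scalerDr !scalerA mulrC.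
  - by do 2 (apply: eventually0_sum => ?); exact: evc.
have S2 : natsum (fun i => c i *: comp_modes (~~ b) (contra_modes m) v (q + n%:~R - i%:R) u (p + i%:R) x)
    = (-1) ^ (r + r') *: \sum_(j < J) \sum_(k < J) A j k.
  rewrite exchange_big /= /A -natsum_sum2 => [|j k]; last exact: evc.
  rewrite (natsum_linear (f := *:%R ((-1) ^ (r + r')))).
  - apply: eq_natsum => i; rewrite [r + r']addrC.
    rewrite (comp_contra _ _ _ vr ur hv hu) scalerA mulrC -scalerA.
    congr (_ *: _); rewrite scaler_sumr; apply: eq_bigr => j _.
    rewrite scaler_sumr; apply: eq_bigr => k _; congr (_ *: comp_modes _ _ _ _ _ _ _).
      by rewrite /P; ring.
    by rewrite /Q; ring.
  - by move=> z y y'; rewrite scalerDr !scalerA mulrC.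
  - by do 2 (apply: eventually0_sum => ?); exact: evc.
rewrite S1 S2.
transitivity (- (-1) ^ n * (-1) ^ (r + r') *: \sum_(j < J) \sum_(k < J) D j k : N); last first.
  under eq_bigr => j _ do (under eq_bigr => k _ do rewrite DAB; rewrite sumrB -scaler_sumr).
  rewrite sumrB -scaler_sumr; move: (\sum_(j < J) _) (\sum_(j < J) _) => SA SB.
  rewrite scalerBr !scalerA !mulNr !scaleNr opprK [RHS]addrC.
  by rewrite [_ * _ * _]mulrAC sgn2 mul1r.
pose f j l k i : N := m (mode (dL j u) (n + (i + l)%N%:Z) (dL k v)) (P j + Q k - (i + l)%:R) x.
pose g j (i l : nat) : C := gbinom C ((2 * r)%:~R - j%:R - 2 - (n + i%:Z)%:~R) l.
have f0 j l k i : [|| (J <= j)%N, (J <= k)%N | (I0 <= i + l)%N] -> f j l k i = 0.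
  rewrite /f => /or3P[/hu ->|/hv ->|/hI ->]; last exact: (m0l mb).
    by rewrite (mode0l hX) (m0l mb).
  by rewrite (mode0r hX) (m0l mb).
(* Here j and k are the powers of L(1) on u and on v, and l the shift of the
   index of u_(n+i). *)
have term i : contra_modes m (mode u (n + i%:Z) v) (p + q - i%:R) x =
    (-1) ^ (r + r' - n - i%:Z - 1) *:
      \sum_(j < J) \sum_(k < J) \sum_(l < I0) g j i l *: f j l k i.
  have wt : gr (r + r' - n - i%:Z - 1) (mode u (n + i%:Z) v).
    have -> : r + r' - n - i%:Z - 1 = r + r' - (n + i%:Z) - 1 by ring.
    exact: (voa_mode_gr hX).
  pose F k M := \sum_(j < M.+1) g j i (M - j)%N *: f j (M - j)%N k i.
  have F0 k l : (J <= k)%N || (J + I0 <= l)%N -> F k l = 0.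
    move=> h; rewrite /F big1 // => j _; rewrite f0 ?scaler0 //; lia.
  have dLu K : dL K (mode u (n + i%:Z) v) = \sum_(k < K.+1) \sum_(j < (K - k).+1)
      g j i (K - k - j)%N *: mode (dL j u) (n + i%:Z + (K - k - j)%N%:Z) (dL k v).
    by rewrite (dL_mode hX _ _ _ ur).
  have nilK K : (J + (J + I0) <= K)%N -> dL K (mode u (n + i%:Z) v) = 0.
    move=> le; rewrite dLu big1 // => k _; rewrite big1 // => j _.
    have [/hu ->|jJ] := leqP J j; first by rewrite (mode0l hX) scaler0.
    have [/hv ->|kJ] := leqP J k; first by rewrite (mode0r hX) scaler0.
    by rewrite -addrA -PoszD hI ?scaler0 //; lia.
  rewrite (contra_hom mb _ _ wt nilK); congr (_ *: _).
  transitivity (\sum_(K < J + (J + I0)) \sum_(k < K.+1) F k (K - k)%N).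
    apply: eq_bigr => K _; rewrite dLu (m_suml mb); apply: eq_bigr => k _.
    rewrite (m_suml mb) /F; apply: eq_bigr => j _; rewrite (mZl mb) /f.
    have jk : (j + k <= K)%N by have := ltn_ord j; have := ltn_ord k; lia.
    congr (_ *: m (mode _ _ _) _ x); first by lia.
    rewrite /P /Q; have -> : K%:R = (K - k - j)%N%:R + k%:R + j%:R :> rat.
      by rewrite -!natrD; congr (_%:R); lia.
    rewrite natrD !intrM !intrB !intrD -!pmulrn; ring.
  rewrite (antidiagonal_sum (leqnn _) F0) [RHS]exchange_big /=; apply: eq_bigr => k _.
  pose G j l := g j i l *: f j l k i.
  rewrite (antidiagonal_sum (G := G) (leqnn _)) // => j l h.
  by rewrite /G f0 ?scaler0 //; lia.
pose h j k T : N := m (mode (dL j u) (n + T%:Z) (dL k v)) (P j + Q k - T%:R) x.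
have h0 j k T : (I0 <= T)%N -> h j k T = 0 by move=> le; rewrite /h hI // (m0l mb).
rewrite (natsumE (N := I0)) => [|i le]; last first.
  rewrite term !big1 ?scaler0 // => j _; rewrite big1 // => k _; rewrite big1 // => l _.
  by rewrite f0 ?scaler0 //; lia.
pose w i : C := gbinom C p i * (-1) ^ (r + r' - n - i%:Z - 1).
transitivity (\sum_(j < J) \sum_(k < J) \sum_(i < I0) \sum_(l < I0)
    (w i * g j i l) *: h j k (i + l)%N).
  under eq_bigr => i _.
    rewrite term scalerA scaler_sumr; under eq_bigr => j _.
      rewrite scaler_sumr; under eq_bigr => k _.
        rewrite scaler_sumr; under eq_bigr do rewrite scalerA.
        over.
      over.
    over.
  rewrite exchange_big /=; apply: eq_bigr => j _; rewrite exchange_big /=.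
  exact: eq_bigr.
rewrite scaler_sumr; apply: eq_bigr => j _; rewrite scaler_sumr; apply: eq_bigr => k _.
pose G i l := (w i * g j i l) *: h j k (i + l)%N.
have G0 i l : (I0 <= i)%N || (I0 <= l)%N -> G i l = 0.
  by move=> le; rewrite /G h0 ?scaler0 //; lia.
rewrite -(antidiagonal_sum (G := G) (leqnn _) G0).
rewrite -(natsumE (N := I0 + I0) (F := fun T => \sum_(i < T.+1) G i (T - i)%N)); last first.
  by move=> T le; rewrite big1 // => i _; apply: G0; have := ltn_ord i; lia.
rewrite /D (natsum_linear (f := *:%R (- (-1) ^ n * (-1) ^ (r + r')))); first last.
- by exists I0 => T /(h0 j k); rewrite /h => ->; rewrite scaler0.
- by move=> z y y'; rewrite scalerDr !scalerA mulrC.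
apply: eq_natsum => T; rewrite scalerA -/(h j k T).
transitivity ((\sum_(i < T.+1) w i * g j i (T - i)%N) *: h j k T).
  rewrite scaler_suml; apply: eq_bigr => i _; rewrite /G subnKC //.
  by rewrite -ltnS.
congr (_ *: _); rewrite /P.
have -> : (2 * r)%:~R - j%:R - 2 - p - n%:~R = (2 * r)%:~R - j%:R - 2 - n%:~R - p by ring.
rewrite -gbinom_alternating mulr_sumr; apply: eq_bigr => i _.
rewrite /w /g.
have -> : (2 * r)%:~R - j%:R - 2 - (n + i%:Z)%:~R = (2 * r)%:~R - j%:R - 2 - n%:~R - i%:R :> rat.
  by rewrite intrD -pmulrn; ring.
have -> : (-1) ^ (r + r' - n - i%:Z - 1) = - (-1) ^ n * (-1) ^ (r + r') * (-1) ^+ i :> C.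
  have u1 : (-1 : C) != 0 by rewrite oppr_eq0 oner_eq0.
  rewrite !(expfzDr _ _ u1) -!exprz_inv !invrN1 expr1z -[(-1) ^ i%:Z]/((-1) ^+ i).
  by ring.
by ring.
Qed.

Lemma contra_borcherds : mode_borcherds (~~ b) (fun a => E (- a)) (contra_modes m).
Proof.
move=> a u v p q n x Eu pa.
have cb := contra_bilinear mb; have ct := contra_trunc mb tr.
have [s [_ -> _]] := component_sum dS u.
elim/big_rec: _ => [|r y _ IH]; first exact: borcherds_eq0l.
apply: borcherds_eqDl => //; elim/(graded_ind dS): v {IH y} => [|v v' IH IH'|r' v vr].
- exact: borcherds_eq0r.
- exact: borcherds_eqDr.
by apply: contra_borcherds_hom vr pa; [exact: Ec | exact: (component_in dS)].
Qed.

End Main.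
End Modes.
End Contra.

(** * Identities of modes implied by Borcherds' identity *)
Section ModeTheory.
Variable R : realType.
Local Notation C := R[i].
Variables (U : lmodType C) (X : voa_data U).
Hypothesis hX : is_voa X.
Implicit Types u v w : U.
Local Notation gr := (voa_gr X).
Local Notation mode := (voa_mode X).
Local Notation L := (voa_L X).
Local Notation dL := (dL X).
Local Notation vac := (voa_vac X).
Local Notation conf := (voa_conf X).

Lemma mode_vac_ge0 u (k : int) : 0 <= k -> mode u k vac = 0.
Proof.
move=> k0; rewrite -(@voa_Y_at _ _ _ _ _ (- k%:~R - 1)) //.
have [h _] := voa_creation hX u; apply: h.
have : 0 <= k%:~R :> rat by rewrite ler0z.
by lra.
Qed.

Lemma mode_vacN1 u : mode u (-1) vac = u.
Proof.
rewrite -(@voa_Y_at _ _ _ _ _ 0) ?mulrNz ?opprK ?subrr //.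
by have [_] := voa_creation hX u.
Qed.

Lemma mode_vacN2 u : mode u (-2) vac = L (-1) u.
Proof.
rewrite -[RHS]mode_vacN1 (Lm1_mode hX) mulrNz opprK scale1r.
by congr (mode u _ vac); ring.
Qed.

Lemma L_vac n : -1 <= n -> L n vac = 0.
Proof. by move=> n1; apply: mode_vac_ge0; lia. Qed.

Lemma Lm2_vac : L (-2) vac = conf.
Proof. exact: mode_vacN1. Qed.

Lemma vac_gr : gr 0 vac.
Proof. by rewrite (voa_L0 hX) /= L_vac // scale0r. Qed.

Lemma dL_vac j : (0 < j)%N -> dL j vac = 0.
Proof.
by case: j => // j _; rewrite /dL iterSr L_vac // (linear_fun0 (iter_linear (L_linear hX 1) j)) scaler0.
Qed.

(** The Virasoro relations applied to omega = L(-2) 1. *)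
Lemma mode_conf_conf (i : nat) : mode conf i%:Z conf =
  match i with
  | 0 => L (-1) conf | 1 => 2 *: conf | 2 => 0
  | 3 => (voa_rank X / 2) *: vac | _ => 0
  end.
Proof.
have E n : L n conf = (n + 2)%:~R *: L (n - 2) vac
    + (if n == 2 then ((n ^+ 3 - n)%:~R / 12%:R * voa_rank X) *: vac else 0)
    + L (-2) (L n vac).
  rewrite -{1}Lm2_vac; have /eqP := voa_virasoro hX n (-2) vac.
  rewrite subr_eq => /eqP ->; rewrite opprK; congr (_ + _ + _).
  by rewrite subr_eq0.
have L20 n : -1 <= n -> L (-2) (L n vac) = 0.
  by move=> n1; rewrite L_vac // (linear_fun0 (L_linear hX _)).
case: i => [|[|[|[|i]]]].
- by [].
- rewrite -[LHS]/(L 0 conf) E L20 // addr0 /= addr0 add0r.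
  by have -> : 0 - 2 = - 2 :> int by []; rewrite Lm2_vac.
- by rewrite -[LHS]/(L 1 conf) E L20 // L_vac // scaler0 !addr0.
- rewrite -[LHS]/(L 2 conf) E L20 // L_vac // scaler0 add0r addr0 /=; congr (_ *: _).
  have -> : (2 ^+ 3 - 2)%:~R = 6 :> C by [].
  by field.
- have -> : mode conf i.+4%:Z conf = L i.+3%:Z conf by rewrite /voa_L; congr (mode _ _ _); lia.
  rewrite E L20 // L_vac ?scaler0; last by lia.
  by rewrite /= !addr0.
Qed.

Section Modes.
Variables (N : lmodType C) (m : U -> rat -> N -> N) (b : bool) (E : rat -> set U).
Hypotheses (mb : mode_bilinear m) (tr : mode_trunc b m) (sup : mode_support E m).
Implicit Types x : N.

(** Only the indexing differs: exponents of series against indices of modes. *)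
Lemma borcherds_eqE u v p q n x :
  borcherds_at (fun a c => comp_modes b m u (- a - 1) v (- c - 1) x)
    (fun a c => comp_modes b m v (- c - 1) u (- a - 1) x)
    (fun a c => m (voa_Y X u v a) (- c - 1) x) p q n <->
  borcherds_eq X b m u v p q n x.
Proof.
rewrite /borcherds_at /borcherds_eq.
have -> : natsum (fun i => gbinom C p i *:
      m (voa_Y X u v (- n%:~R - 1 - i%:R)) (- (- p - q - 1 + i%:R) - 1) x) =
    natsum (fun i => gbinom C p i *: m (mode u (n + i%:Z) v) (p + q - i%:R) x).
  apply: eq_natsum => i; rewrite (@voa_Y_at _ _ _ _ _ _ (n + i%:Z)); last first.
    by rewrite intrD -pmulrn; ring.
  by congr (_ *: m _ _ x); ring.
have -> : natsum (fun i => (gbinom C n%:~R i * (-1) ^+ i) *: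
      comp_modes b m u (- (- p - 1 - n%:~R + i%:R) - 1) v (- (- q - 1 - i%:R) - 1) x) =
    natsum (fun i => (gbinom C n%:~R i * (-1) ^+ i) *:
      comp_modes b m u (p + n%:~R - i%:R) v (q + i%:R) x).
  by apply: eq_natsum => i; congr (_ *: comp_modes _ _ _ _ _ _ _); ring.
have -> : natsum (fun i => (gbinom C n%:~R i * (-1) ^+ i) *:
      comp_modes b m v (- (- q - 1 - n%:~R + i%:R) - 1) u (- (- p - 1 - i%:R) - 1) x) =
    natsum (fun i => (gbinom C n%:~R i * (-1) ^+ i) *:
      comp_modes b m v (q + n%:~R - i%:R) u (p + i%:R) x).
  by apply: eq_natsum => i; congr (_ *: comp_modes _ _ _ _ _ _ _); ring.
by [].
Qed.

Definition mode_jacobi a u v x e :=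
  jacobi_at a (fun a c => comp_modes b m u (- a - 1) v (- c - 1) x)
    (fun a c => comp_modes b m v (- c - 1) u (- a - 1) x)
    (fun a c => m (voa_Y X u v a) (- c - 1) x) e.

Lemma ev_comp2 u v x c c' :
  eventually0 (fun i => comp_modes b m v (- (c' + i%:R) - 1) u (- (c - i%:R) - 1) x).
Proof.
have [K h] := comp_ev mb tr v (- c' - 1) u (- c - 1) x.
exists K => i /h <-; congr (comp_modes _ _ _ _ _ _ _); ring.
Qed.

Lemma ev_iter u v x c c' :
  eventually0 (fun i => m (voa_Y X u v (c - i%:R)) (- (c' + i%:R) - 1) x).
Proof.
have [K h] := lower0_ev c (voa_Y_lower0 hX u v); exists K => i /h ->.
exact: (m0l mb).
Qed.

Lemma jacobi_mode_borcherds a u v x : (forall e, mode_jacobi a u v x e) ->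
  forall p q n, is_int (p - a) -> borcherds_eq X b m u v p q n x.
Proof.
move=> jac p q n pa; apply/borcherds_eqE; apply: (jacobi_borcherds (a := a)) => //.
- by move=> c c'; exact: ev_comp2.
- by move=> c c'; exact: ev_iter.
Qed.

Lemma mode_borcherds_jacobi a u v x : E a u ->
  (forall p q n, is_int (p - a) -> borcherds_eq X b m u v p q n x) ->
  forall e, mode_jacobi a u v x e.
Proof.
move=> Eu bor; have nu y : ~ is_int (y + a) -> ~ is_int (- y - 1 - a).
  by move=> ny [k ek]; apply: ny; exists (- k - 1); rewrite intrD !mulrNz -ek; ring.
apply: borcherds_jacobi.
- by move=> c c'; exact: ev_comp2.
- by move=> c c'; exact: ev_iter.
- by move=> y z /nu ny; rewrite /comp_modes; case: b; rewrite [m u _ _](sup _ Eu ny) // (m0r mb).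
- by move=> y z /nu ny; rewrite /comp_modes; case: b; rewrite [m u _ _](sup _ Eu ny) // (m0r mb).
- by move=> y z ny; rewrite /voa_Y field_of_nint // (m0l mb).
- by move=> p q n pa; apply/borcherds_eqE; exact: bor.
Qed.

Hypothesis bor : mode_borcherds X b E m.
Hypothesis mvac : forall t x, m vac t x = if t == -1 then x else 0.
Hypothesis EL : forall a n u, E a u -> E a (L n u).

Let gb0 i : (0 < i)%N -> gbinom C 0 i = 0. Proof. exact: (@gbinom_nat0 C 0 i). Qed.

(** Borcherds' identity for u, the vacuum and n = -2: the products vanish, and
    the iterate involves u_(-2) 1 = L(-1) u and u_(-1) 1 = u only. *)
Lemma mode_derivative a u t x : E a u -> m (L (-1) u) t x = - ratr t *: m u (t - 1) x.
Proof.
move=> Eu; have [ta|ta] := pselect (is_int (t - a)); last first.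
  have ta1 : ~ is_int (t - 1 - a).
    by move=> [k ek]; apply: ta; exists (k + 1); rewrite intrD -ek; ring.
  by rewrite (sup _ (EL (-1) Eu) ta) (sup _ Eu ta1) scaler0.
have := bor vac 0 (-2) x Eu ta; rewrite /borcherds_eq.
have nat_neq (i : nat) : (0 + i%:R == -1 :> rat) = false.
  by apply/negbTE; rewrite eq_sym lt_eqF // (lt_le_trans (y := 0)) // add0r ler0n.
have nat_neq' (i : nat) : (0 + (-2)%:~R - i%:R == -1 :> rat) = false.
  apply: lt_eqF; have : 0 <= i%:R :> rat by rewrite ler0n.
  by rewrite mulrNz; lra.
rewrite [X in _ = X - _]/natsum fsum_zero => [|i]; last first.
  by rewrite /comp_modes; case: b; rewrite mvac nat_neq ?(m0r mb) scaler0.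
rewrite [X in _ = _ - _ *: X]/natsum fsum_zero => [|i]; last first.
  by rewrite /comp_modes; case: b; rewrite mvac nat_neq' ?(m0r mb) scaler0.
rewrite scaler0 subr0 (natsumE (N := 2)) => [|i le]; last first.
  by rewrite mode_vac_ge0 ?(m0l mb) ?scaler0 //; lia.
rewrite !big_ord_recl big_ord0 /= gbinom0 gbinom1 scale1r addr0.
have -> : -2 + (bump 0 0)%:Z = -1 :> int by [].
rewrite mode_vacN2 mode_vacN1 addr0 !subr0 -[(bump 0 0)%:R]/(1 : rat) addr0.
by move=> /eqP; rewrite addr_eq0 => /eqP ->; rewrite scaleNr.
Qed.

Lemma mode_commutator u v p q x : E 0 u -> is_int p ->
  natsum (fun i => gbinom C p i *: m (mode u i%:Z v) (p + q - i%:R) x) =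
  comp_modes b m u p v q x - comp_modes b m v q u p x.
Proof.
move=> Eu pi; have := @bor 0 u v p q 0 x Eu; rewrite subr0 => /(_ pi); rewrite /borcherds_eq.
have S0 (F : nat -> N) : natsum (fun i => (gbinom C 0%:~R i * (-1) ^+ i) *: F i) = F 0%N.
  rewrite natsum1 => [|i /gb0 h]; last by rewrite [gbinom _ _ _]h mul0r scale0r.
  by rewrite gbinom0 expr0 mulr1 scale1r.
rewrite !(S0 (fun i => _)) expr0z scale1r => h.
transitivity (natsum (fun i => gbinom C p i *: m (mode u (0 + i%:Z) v) (p + q - i%:R) x)).
  by apply: eq_natsum => i; rewrite add0r.
rewrite h; by congr (_ - _); congr (comp_modes _ _ _ _ _ _ _); ring.
Qed.

Hypothesis Econf : E 0 conf.

(** The commutator formula for omega with itself, by mode_conf_conf. *)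
Lemma mode_virasoro (p q : int) x :
  comp_modes b m conf p%:~R conf q%:~R x - comp_modes b m conf q%:~R conf p%:~R x =
  (p - q)%:~R *: m conf (p + q - 1)%:~R x +
  (if p + q == 2 then (((p - 1) ^+ 3 - (p - 1))%:~R / 12%:R * voa_rank X) *: x else 0).
Proof.
rewrite -mode_commutator //; last by exists p.
rewrite (natsumE (N := 4)) => [|i le]; last first.
  by rewrite mode_conf_conf; case: i le => [|[|[|[|i]]]] // _; rewrite (m0l mb) scaler0.
rewrite !big_ord_recl big_ord0 !mode_conf_conf /= gbinom0 gbinom1 scale1r.
rewrite (mode_derivative _ _ Econf) (mZl mb) (m0l mb) (mZl mb) mvac scaler0 add0r addr0 !scalerA.
rewrite -[bump 0 (bump 0 (bump 0 0))]/3%N -[bump 0 0]/1%N.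
have e2 : p%:~R + q%:~R - 1%:R = (p + q - 1)%:~R :> rat by rewrite intrB intrD.
rewrite e2 addr0 addrA -scalerDl.
have e3 : (p%:~R + q%:~R - 3%:R == -1 :> rat) = (p + q == 2).
  rewrite -intrD -subr_eq0 opprK -[_ - _ + 1]addrA.
  have -> : - 3 + 1 = - 2%:~R :> rat by [].
  by rewrite -intrB intr_eq0 subr_eq0.
rewrite e3; congr (_ *: _ + _).
  by rewrite rmorphD /= !ratr_int !intrD ?mulrNz; ring.
case: ifP => // _; last by rewrite scaler0.
congr (_ *: _).
have g2 : 2%:R * gbinom C p%:~R 2 = (p%:~R - 1) * p%:~R.
  by have := gbinomS C p%:~R 1; rewrite gbinom1 rmorphB /= ratr_int rmorph1.
have g3 : 3%:R * gbinom C p%:~R 3 = (p%:~R - 2%:R) * gbinom C p%:~R 2.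
  by have := gbinomS C p%:~R 2; rewrite rmorphB /= ratr_int ratr_nat.
have g6 : gbinom C p%:~R 3 = (p%:~R - 2%:R) * (p%:~R - 1) * p%:~R / 6%:R.
  have n3 : 3%:R != 0 :> C by rewrite pnatr_eq0.
  have n2 : 2%:R != 0 :> C by rewrite pnatr_eq0.
  apply: (mulfI n3); rewrite g3; apply: (mulfI n2); rewrite mulrCA g2.
  by field.
by rewrite g6 !rmorphB /= rmorphXn /= rmorphB /=; field.
Qed.

End Modes.

Section ContraGr.
Variables (N : lmodType C) (m : U -> rat -> N -> N) (grN : rat -> set N).
Hypotheses (mb : mode_bilinear m) (dN : direct_sum grN).

Lemma contra_vac : (forall t x, m vac t x = if t == -1 then x else 0) ->
  forall t x, contra_modes X m vac t x = if t == -1 then x else 0.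
Proof.
move=> h t x; rewrite (contra_hom hX (J := 1) mb _ _ vac_gr); last first.
  by move=> j; exact: dL_vac.
rewrite expr0z scale1r big_ord1 dL0 h mulr0.
have -> : 0%:~R - 0%:R - 2 - t = - 2 - t by ring.
by congr (if _ then _ else _); apply/eqP/eqP => e; lra.
Qed.

Definition left_graded (m : U -> rat -> N -> N) :=
  forall (w : int) u s t x, gr w u -> grN t x -> grN (w%:~R + t - s - 1) (m u s x).
Definition right_graded (m : U -> rat -> N -> N) :=
  forall (w : int) u s t x, gr w u -> grN t x -> grN (t + s + 1 - w%:~R) (m u s x).

Lemma contra_hom_in (S : set N) (w : int) u s x : is_subspace S -> gr w u ->
  (forall j, S (m (dL j u) ((2 * w)%:~R - j%:R - 2 - s) x)) -> S (contra_modes X m u s x).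
Proof.
move=> sS uw h; have [J hJ] := dL_nilp hX uw; rewrite (contra_hom hX mb _ _ uw hJ).
by apply: (subspaceZ _ sS); apply: subspace_big.
Qed.

(** The index 2 w - j - 2 - s and the weight w - j of L(1)^j u enter the degree
    in such a way that j cancels. *)
Lemma contra_left_graded : right_graded m -> left_graded (contra_modes X m).
Proof.
move=> h w u s t x uw xt; apply: (contra_hom_in (gr_subspace dN _) uw) => j.
have := h _ _ ((2 * w)%:~R - j%:R - 2 - s) _ _ (dL_gr hX j uw) xt.
by congr (grN _ _); rewrite intrB intrM -pmulrn; ring.
Qed.

Lemma contra_right_graded : left_graded m -> right_graded (contra_modes X m).
Proof.
move=> h w u s t x uw xt; apply: (contra_hom_in (gr_subspace dN _) uw) => j.
have := h _ _ ((2 * w)%:~R - j%:R - 2 - s) _ _ (dL_gr hX j uw) xt.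
by congr (grN _ _); rewrite intrB intrM -pmulrn; ring.
Qed.

Lemma contra_stable (S : set N) : is_subspace S ->
  (forall u t x, S x -> S (m u t x)) -> forall u t x, S x -> S (contra_modes X m u t x).
Proof.
move=> sS h u t x Sx; have [s [J [us out nil]]] := component_bound hX u.
rewrite (contra_bound hX mb _ _ us out nil); apply: subspace_big => // r.
by apply: (subspaceZ _ sS); apply: subspace_big => // j; exact: h.
Qed.

End ContraGr.
End ModeTheory.

(** * The transported automorphism and its eigenspaces *)
Section Aut.
Variable R : realType.
Local Notation C := R[i].
Variables (V : lmodType C) (X : gvoc V) (g : voc_aut X) (T : nat).
Hypothesis hT : has_order g T.
Local Notation gr := (voc_gr X).
Local Notation V' := (rdual gr).
Local Notation D := (dual_voa X).
Local Notation h := (dual_aut g).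
Local Notation P := (eigenproj g T).
Implicit Types (f u v : V').

Let dS := voc_direct X.
Let lf f := rdual_linear f.
Let lg : linear g := linearP g.

Lemma aut_order_gt0 : (0 < T)%N. Proof. by case: hT. Qed.
Lemma aut_order_iter : iter T g =1 id. Proof. by case: hT. Qed.
Let T0 := aut_order_gt0.
Let gT := aut_order_iter.

Lemma voc_L_aut k x : voc_L X k (g x) = g (voc_L X k x).
Proof.
rewrite /voc_L aut_ups; have lt := tforml_linear (W := V) (linearP (voc_rho X)).
apply: (linear_tensor_ext (linear_comp lt (tmap_linear lg lg)) (linear_comp lg lt)) => a b.
by rewrite tmap_pt // !tforml_pt ?aut_rho ?linearZ_LR //; exact: linearP.
Qed.

Lemma aut_gr s x : gr s x -> gr s (g x).
Proof. by rewrite !voc_L0 /= voc_L_aut => ->; rewrite linearZ_LR. Qed.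

Lemma component_aut s x : component gr s (g x) = g (component gr s x).
Proof.
have lc := component_linear s dS.
elim/(graded_ind dS): x => [|x y IH IH'|t x xt].
- by rewrite linear0 (linear_fun0 lc) linear0.
- by rewrite linearD !(linear_funD _ _ lc) linearD IH IH'.
have [<-|ts] := eqVneq t s; first by rewrite !(component_id dS) //; exact: aut_gr.
by rewrite !(component_out dS (j := t)) ?linear0 //; rewrite 1?eq_sym //; exact: aut_gr.
Qed.

Lemma eigenproj_gr r s x : gr s x -> gr s (P r x).
Proof.
move=> xs; have sS := gr_subspace dS s.
apply: (subspaceZ _ sS); apply: subspace_big => // j; apply: (subspaceZ _ sS).
by elim: (nat_of_ord j) => [|k IH] //=; exact: aut_gr.
Qed.

Lemma dual_autE f x : (h f : V') x = f (aut_inv g x).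
Proof. by []. Qed.

Lemma dual_autK f x : (h f : V') (g x) = f x.
Proof. by rewrite dual_autE aut_funK. Qed.

Lemma iter_dual_aut j f x : (iter j h f : V') (iter j g x) = f x.
Proof.
by elim: j => [|j IH] //; rewrite !iterS dual_autK.
Qed.

Lemma dual_aut_order : has_order h T.
Proof.
split=> //.
  by move=> f; apply: rdual_ext => x; rewrite -{1}[x]gT iter_dual_aut.
move=> j jT hj; have [_ _ /(_ j jT)] := hT; apply => x.
apply/eqP; rewrite -subr_eq0; apply/eqP/dual_sep => f.
have e : f (iter j g x) = f x by rewrite -{1}[f]hj iter_dual_aut.
have := linear_funB (iter j g x) x (lf f); rewrite e subrr; exact.
Qed.

Lemma tpair_tmap (u v u' v' : V') (y : tensor V V) :
  (forall x, u (g x) = u' x) -> (forall x, v (g x) = v' x) ->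
  tpair u v (tmap g g y) = tpair u' v' y.
Proof.
move=> hu hv; have lp := linear_comp (tpair_linear (lf u) (lf v)) (tmap_linear lg lg).
apply: (linear_tensor_ext lp (tpair_linear (lf u') (lf v'))) => a b.
by rewrite tmap_pt // !tpair_pt // hu hv.
Qed.

Lemma dual_is_aut : is_voa_aut D h.
Proof.
have hit := dual_aut_order; split.
- by move=> a f f'; apply: rdual_ext.
- exists (iter T.-1 h) => f; rewrite -?iterSr -?iterS prednK //; by case: hit.
- apply: rdual_ext => x; rewrite -[x](aut_invK g) dual_autK.
  by rewrite !dual_vacE aut_c.
- apply: rdual_ext => x; rewrite -[x](aut_invK g) dual_autK.
  by rewrite !dual_confE aut_rho.
- move=> u k v; apply: rdual_ext => x; rewrite -[x](aut_invK g) dual_autK.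
  move: (aut_inv g x) => y.
  rewrite -[LHS]/(tpair u v (voc_delta X k y)).
  rewrite -[RHS]/(tpair (h u) (h v) (voc_delta X k (g y))).
  have := aut_ups g y (- k%:~R - 1); rewrite /voc_ups !field_of_int => ->.
  by rewrite (tpair_tmap (u' := u) (v' := v)) // => z; rewrite dual_autK.
Qed.

(** Contraction with an eigenfunctional for e^(2 pi i r/T) picks out the exponents
    in -r/T + Z of a twisted coproduct, hence indices in r/T + Z; the class is
    this coset. *)
Definition dual_class (a : rat) : set V' :=
  [set f | exists r, [/\ (r < T)%N, forall x, f (g x) = zeta R T r * f x
    & is_int (a - r%:R / T%:R)]].

Lemma frac_uniq (a : rat) (r s : nat) : (r < T)%N -> (s < T)%N ->
  is_int (a - r%:R / T%:R) -> is_int (a - s%:R / T%:R) -> r = s.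
Proof.
move=> rT sT [k ek] [l el].
have Tn : T%:R != 0 :> rat by rewrite pnatr_eq0 -lt0n.
have : (s%:Z - r%:Z)%:~R = ((k - l) * T%:Z)%:~R :> rat.
  rewrite intrM !intrB -ek -el -!pmulrn mulrBl mulrBl mulrBl !divfK //; ring.
move/eqP; rewrite eqr_int => /eqP e.
have [kl|kl|kl] := ltgtP k l.
- have : (k - l) * T%:Z <= (- 1) * T%:Z by apply: ler_wpM2r; lia.
  by lia.
- have : 1 * T%:Z <= (k - l) * T%:Z by apply: ler_wpM2r; lia.
  by lia.
by rewrite kl subrr mul0r in e; lia.
Qed.

Lemma dual_class_component a s f : dual_class a f -> dual_class a (component (rdual_gr (gr := gr)) s f).
Proof.
move=> [r [rT fr ar]]; exists r; split => // x.
by rewrite component_dual !dual_partE component_aut fr.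
Qed.

Lemma dual_class_L a n f : dual_class a f -> dual_class a (voa_L D n f).
Proof.
move=> [r [rT fr ar]]; exists r; split => // x.
by rewrite !dual_LE voc_L_aut fr.
Qed.

Lemma dual_class_conf : dual_class 0 (voa_conf D).
Proof.
exists 0%N; split=> // [x|]; first by rewrite dual_confE aut_rho zeta0 mul1r.
by exists 0; rewrite mul0r subr0.
Qed.

Lemma class_opp r : (r < T)%N -> exists s, [/\ (s < T)%N, zeta R T r * zeta R T s = 1
  & is_int (r%:R / T%:R + s%:R / T%:R)].
Proof.
move=> rT; have Tn : T%:R != 0 :> rat by rewrite pnatr_eq0 -lt0n.
case: r rT => [|r] rT.
  exists 0%N; rewrite zeta0 mulr1; split => //; exists 0.
  by rewrite mul0r addr0.
exists (T - r.+1)%N; rewrite -zetaD subnKC ?zetaT //; last exact: ltnW.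
split => //; first by lia.
by exists 1; rewrite -mulrDl -natrD subnKC ?divff //; exact: ltnW.
Qed.

(** The automorphism h is composition with the inverse of g, so that its
    eigenvalues are inverted and classes are negated. *)
Lemma eigen_class r f : (r < T)%N -> eigenpart h T r f -> dual_class (- (r%:R / T%:R)) f.
Proof.
move=> rT fr; have [s [sT rs is_]] := class_opp rT; exists s; split => //.
  move=> x; have := congr1 (fun f : V' => f (g x)) fr.
  rewrite [LHS]dual_autK -[X in _ = X]/(zeta R T r * f (g x)) => ->.
  by rewrite mulrA [zeta R T s * _]mulrC rs mul1r.
have [k ek] := is_; exists (- k); rewrite mulrNz -ek; ring.
Qed.

Lemma class_eigen a f : dual_class (- a) f ->
  exists r, [/\ (r < T)%N, eigenpart h T r f & is_int (a - r%:R / T%:R)].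
Proof.
move=> [s [sT fs [k ek]]]; have [r [rT rs [l el]]] := class_opp sT.
exists r; split => //.
  apply: rdual_ext => x; rewrite -[x](aut_invK g) dual_autK.
  rewrite -[RHS]/(zeta R T r * f (g (aut_inv g x))) fs mulrA.
  by rewrite [zeta R T r * _]mulrC rs mul1r.
by exists (- k - l); rewrite intrD !mulrNz -ek -el; ring.
Qed.

(** Eigenfunctionals annihilate the eigenspaces for other eigenvalues. *)
Lemma class_proj r s f x : (r < T)%N -> (s < T)%N ->
  (forall x, f (g x) = zeta R T s * f x) -> f (P r x) = if r == s then f x else 0.
Proof.
move=> rT sT fs.
have other r' y : (r' < T)%N -> r' != s -> f (P r' y) = 0.
  move=> rT' rs; have := fs (P r' y).
  rewrite (eigenproj_eigen lg T0 gT r' y) (linear_funZ _ _ (lf f)).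
  move/eqP; rewrite -[X in X == _]/(zeta R T r' * f (P r' y)) -subr_eq0 -mulrBl mulf_eq0.
  case/orP => [|/eqP //]; rewrite subr_eq0 => /eqP /(zeta_inj rT' sT) e.
  by rewrite e eqxx in rs.
case: eqP => [->|/eqP]; last exact: other.
rewrite -{2}(eigenproj_sum g T0 x) (linear_sumE _ _ _ (lf f)).
rewrite (bigD1 (Ordinal sT)) //= big1 ?addr0 // => i ne.
by apply: other => //; apply: contra_neq ne => e; apply: val_inj.
Qed.

Lemma dual_proj_subproof r f : (fun x => f (P r x)) \in rdual_pred gr.
Proof.
apply: rdual_subproof => [a x y|]; first by rewrite (eigenproj_linear T lg) (lf f).
apply: (sub_finite_set _ (rdual_finite f)) => s [x xs hx] /=.
by exists (P r x) => //; exact: eigenproj_gr.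
Qed.

Definition dual_proj r f : V' := RDual (dual_proj_subproof r f).

Lemma dual_projE r f x : dual_proj r f x = f (P r x). Proof. by []. Qed.

Lemma eigenproj_aut r x : P r (g x) = g (P r x).
Proof.
rewrite /eigenproj linearZ_LR (linear_sumE _ _ _ lg); congr (_ *: _).
by apply: eq_bigr => j _; rewrite linearZ_LR /= -iterSr iterS.
Qed.

Lemma dual_proj_eigen r f x : dual_proj r f (g x) = zeta R T r * dual_proj r f x.
Proof.
rewrite !dual_projE eigenproj_aut (eigenproj_eigen lg T0 gT r x).
exact: (linear_funZ _ _ (lf f)).
Qed.

Lemma dual_proj_class (r : 'I_T) f : dual_class (r%:R / T%:R) (dual_proj r f).
Proof.
by exists r; split=> //; [exact: dual_proj_eigen | exists 0; rewrite subrr].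
Qed.

Lemma dual_proj_sum f : f = \sum_(r < T) dual_proj r f.
Proof.
apply: rdual_ext => x; rewrite (linear_sumE _ _ _ (rdual_eval x)).
by rewrite -{1}(eigenproj_sum g T0 x) (linear_sumE _ _ _ (lf f)).
Qed.

Lemma dual_proj_gr r s f : rdual_gr s f -> rdual_gr s (dual_proj r f).
Proof. by move=> fs t x ts xt; apply: (fs t) => //; exact: eigenproj_gr. Qed.

(** * Twisted comodules as families of modes *)
Section Modes.
Variable M : lmodType C.
Implicit Types m : M.

(** Contracting (Id (x) Upsilon(z_2)) Upsilon(z_1) with u (x) v applies the mode
    of u first: these modes act from the right. *)
Definition right_modes (ups : M -> rat -> tensor V M) f (t : rat) m : M :=
  tforml f (ups m (- t - 1)).

Section TwistedField.
Variable D0 : int -> M -> tensor V M.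
Local Notation tw := (twisted_field_of g T D0).

Lemma shifted_field_int (U : zmodType) (F : int -> U) (a : rat) (k : int) :
  fsum (fun k : int => fmon (- k%:~R - 1 - a : rat) (F k)) (- k%:~R - 1 - a) = F k.
Proof.
rewrite /fsum (@fsum_one _ _ k) /fmon ?eqxx // => i ik.
case: eqP => // /addIr/addIr/oppr_inj/eqP; rewrite eqr_int eq_sym.
by rewrite (negbTE ik).
Qed.

Lemma shifted_field_nint (U : zmodType) (F : int -> U) (a e : rat) :
  ~ is_int (e + a) -> fsum (fun k : int => fmon (- k%:~R - 1 - a : rat) (F k)) e = 0.
Proof.
move=> ne; rewrite /fsum fsum_zero // => k; rewrite /fmon.
case: eqP => // ek; case: ne; exists (- k - 1).
by rewrite ek intrD !mulrNz; ring.
Qed.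

Lemma shifted_field_case (a e : rat) : is_int (e + a) -> exists k : int, e = - k%:~R - 1 - a.
Proof.
move=> [k ek]; exists (- k - 1); rewrite intrD !mulrNz -ek; ring.
Qed.

Lemma tforml0 (y : tensor V M) : tforml (fun=> 0) y = 0.
Proof.
have lin0 (U W : lmodType C) : linear ((fun=> 0) : U -> W).
  by move=> a x z; rewrite scaler0 addr0.
apply: (linear_tensor_ext (tforml_linear (lin0 V _)) (lin0 _ M)) => a b.
by rewrite tforml_pt ?scale0r //; exact: lin0.
Qed.

Lemma tforml_proj f r s (y : tensor V M) : (r < T)%N -> (s < T)%N ->
  (forall x, f (g x) = zeta R T s * f x) ->
  tforml f (tmap (P r) id y) = if r == s then tforml f y else 0.
Proof.
move=> rT sT fs; rewrite tforml_tmap //; last exact: eigenproj_linear.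
case: eqP => rs.
  congr tforml; apply/funext => x; rewrite (class_proj x rT sT fs).
  by rewrite rs eqxx.
have -> : (fun x => f (P r x)) = (fun=> 0).
  by apply/funext => x; rewrite (class_proj x rT sT fs) ifF //; apply/eqP.
exact: tforml0.
Qed.

(** Only the summand r = s of the twisted field survives. *)
Lemma tw_pair f s m e : (s < T)%N -> (forall x, f (g x) = zeta R T s * f x) ->
  tforml f (tw m e) =
  fsum (fun k : int => fmon (- k%:~R - 1 - s%:R / T%:R) (tforml f (D0 k m))) e.
Proof.
move=> sT fs; have ltf := tforml_linear (W := M) (lf f).
have E r : (r < T)%N ->
    tforml f (fsum (fun k : int => fmon (- k%:~R - 1 - r%:R / T%:R)
      (tmap (P r) id (D0 k m))) e) =
    if r == s then fsum (fun k : int => fmon (- k%:~R - 1 - s%:R / T%:R) (tforml f (D0 k m))) e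
    else 0.
  move=> rT; have [/shifted_field_case[k ->]|ne] := pselect (is_int (e + r%:R / T%:R)).
    rewrite shifted_field_int (tforml_proj _ rT sT fs); case: eqP => // ->.
    by rewrite shifted_field_int.
  rewrite shifted_field_nint // (linear_fun0 ltf); case: eqP => // rs.
  by rewrite shifted_field_nint // -rs.
rewrite /twisted_field_of (linear_sumE _ _ _ ltf) (bigD1 (Ordinal sT)) //= big1 ?addr0.
  by rewrite E ?eqxx.
move=> r rs; rewrite E // ifF //.
by apply: contraNF rs => /eqP e'; apply/eqP/val_inj.
Qed.

Lemma tforml_form_linear (y : tensor V M) : linear (fun f : V' => tforml f y).
Proof. by move=> a f f'; exact: (tforml_form a y (lf f) (lf f')). Qed.

Lemma tforml_decomp f (y : tensor V M) :
  tforml f y = \sum_(r < T) tforml (dual_proj r f) y.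
Proof. by rewrite {1}[f]dual_proj_sum (linear_sumE _ _ _ (tforml_form_linear y)). Qed.

(** Eigenfunctionals span V', hence separate tensors. *)
Lemma tw_eq (y : tensor V M) m e :
  (forall f s, (s < T)%N -> (forall x, f (g x) = zeta R T s * f x) ->
    fsum (fun k : int => fmon (- k%:~R - 1 - s%:R / T%:R) (tforml f (D0 k m))) e
    = tforml f y) -> tw m e = y.
Proof.
move=> hy; apply: (tensor_eq (X := X)) => f; rewrite tforml_decomp [RHS]tforml_decomp.
by apply: eq_bigr => r _; rewrite (tw_pair _ _ (ltn_ord r) (dual_proj_eigen r f)) hy //;
   exact: dual_proj_eigen.
Qed.

Lemma tw_linear e : (forall k, linear (D0 k)) -> linear (fun m => tw m e).
Proof.
move=> lD a m m'; apply: tw_eq => f s sT fs; have ltf := tforml_linear (W := M) (lf f).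
rewrite ltf !(tw_pair _ _ sT fs).
have [/shifted_field_case[k ->]|ne] := pselect (is_int (e + s%:R / T%:R)).
  by rewrite !shifted_field_int lD ltf.
by rewrite !shifted_field_nint // scaler0 addr0.
Qed.

Lemma tw_upper0 m : (exists k0, forall k, k < k0 -> D0 k m = 0) -> upper0 (tw m).
Proof.
move=> [k0 hk]; exists (- k0%:~R - 1) => e lt; apply: tw_eq => f s sT fs.
have ltf := tforml_linear (W := M) (lf f); rewrite (linear_fun0 ltf).
have [/shifted_field_case[k ek]|ne] := pselect (is_int (e + s%:R / T%:R)); last first.
  by rewrite shifted_field_nint.
rewrite ek shifted_field_int hk ?(linear_fun0 ltf) //.
have s0 : 0 <= s%:R / T%:R :> rat by rewrite divr_ge0 ?ler0n.
by move: lt; rewrite ek -(ltr_int rat); lra.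
Qed.

End TwistedField.

Section Pairing.
Variable ups : M -> rat -> tensor V M.
Hypotheses (ul : forall e, linear (ups^~ e)) (uu : forall m, upper0 (ups m)).
Local Notation Rm := (right_modes ups).

Lemma right_modes_bilinear : mode_bilinear Rm.
Proof.
move=> t; split=> [m|f a m m']; first exact: tforml_form_linear.
by rewrite /right_modes ul (tforml_linear (lf f)).
Qed.

Lemma right_modes_trunc : mode_trunc false Rm.
Proof.
move=> f m; have [e0 he] := uu m; exists (- e0 - 1) => t lt.
rewrite /right_modes he; last by lra.
exact: (linear_fun0 (tforml_linear (lf f))).
Qed.

Definition com_lhs m (e : exp3) : tensor (tensor V V) M :=
  fmul (fdelta z0 z1 z2 (-1) 1)
      (in_vars z1 z2 (fun a b =>
         tassoc (tmap id (ups^~ b) (ups m a)))) e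
    - fmul (fdelta z0 z2 z1 (-1) (-1))
      (in_vars z1 z2 (fun a b =>
         tmap (@tswap _ V V) id
           (tassoc (tmap id (ups^~ a) (ups m b))))) e.

Definition com_rhs m (e : exp3) : tensor (tensor V V) M :=
  fmul (fdelta z2 z1 z0 (-1) 1)
      (fun e' => \sum_(r < T)
         fmul (twist_factor R (r%:R / T%:R))
           (in_vars z0 z2 (fun a b =>
              tmap (tmap (P r) id) id
                (tmap ((voc_ups X)^~ a) id (ups m b)))) e') e.

Lemma tforml_ups f m e : tforml f (ups m e) = Rm f (- e - 1) m.
Proof. by rewrite /right_modes; congr (tforml _ (ups _ _)); ring. Qed.

Lemma pair_lhs u v m e : tforml (tpair u v) (com_lhs m e) =
  fmul (fdelta z0 z1 z2 (-1) 1) (in_vars z1 z2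
    (fun a c => comp_modes false Rm u (- a - 1) v (- c - 1) m)) e
  - fmul (fdelta z0 z2 z1 (-1) (-1)) (in_vars z1 z2
    (fun a c => comp_modes false Rm v (- c - 1) u (- a - 1) m)) e.
Proof.
have lp := tpair_linear (lf u) (lf v); have lt := tforml_linear (W := M) lp.
have ta b : linear (fun y : tensor V M => tassoc (tmap id (ups^~ b) y)).
  by move=> a y z; rewrite (tmap_linear _ (ul b)) // tassoc_linear.
have lsw := @tswap_linear _ V V.
pose F1 a b := tassoc (tmap id (ups^~ b) (ups m a)).
pose F2 a b := tmap (@tswap _ V V) id (tassoc (tmap id (ups^~ a) (ups m b))).
have E1 : (fun a b => tforml (tpair u v) (F1 a b)) =
    (fun a c => comp_modes false Rm u (- a - 1) v (- c - 1) m).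
  apply/funext => a; apply/funext => b.
  by rewrite /F1 tforml_assoc // !tforml_ups.
have E2 : (fun a b => tforml (tpair u v) (F2 a b)) =
    (fun a c => comp_modes false Rm v (- c - 1) u (- a - 1) m).
  apply/funext => a; apply/funext => b.
  by rewrite /F2 tforml_swap // tforml_assoc // !tforml_ups.
rewrite -E1 -E2 /com_lhs; apply: (commutator_side_linear (F1 := F1) (F2 := F2) _ lt).
- move=> c c'; have [N hN] := upper0_ev c (uu m); exists N => i /hN.
  by rewrite /F1 => ->; rewrite (linear_fun0 (ta _)).
- move=> c c'; have [N hN] := upper0_ev c' (uu m); exists N => i /hN.
  by rewrite /F2 => ->; rewrite (linear_fun0 (ta _)) (linear_fun0 (tmap_linear lsw _)).
Qed.

Lemma iter_side_linear (U W : lmodType C) (phi : U -> W) a (F : rat -> rat -> U) e :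
  linear phi -> phi (fmul (twist_factor R a) (in_vars z0 z2 F) e) =
  fmul (twist_factor R a) (in_vars z0 z2 (fun x y => phi (F x y))) e.
Proof.
move=> lp; have [[k ek]|no] := pselect (exists k : int, e z1 = - a - k%:~R).
  rewrite !(twist_in_vars _ ek); case: k ek => [l|l] _; last exact: linear_fun0.
  exact: linear_funZ.
by rewrite !twist_in_vars0 ?(linear_fun0 lp) // => k; apply/eqP => ek; apply: no; exists k.
Qed.

(** The eigenfunctional u selects one term of the sum over r, and thereby one
    twist factor. *)
Lemma pair_rhs u v m e s : (s < T)%N -> (forall x, u (g x) = zeta R T s * u x) ->
  tforml (tpair u v) (com_rhs m e) =
  fmul (fdelta z2 z1 z0 (-1) 1)
    (fmul (twist_factor R (s%:R / T%:R)) (in_vars z0 z2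
      (fun a c => Rm (voa_Y D u v a) (- c - 1) m))) e.
Proof.
move=> sT us; have lp := tpair_linear (lf u) (lf v); have lt := tforml_linear (W := M) lp.
have lP r := eigenproj_linear T lg r.
have lups := ups_linear X.
have lPP r : linear (tmap (P r) (@id V)) by exact: tmap_linear.
have lPPM r : linear (tmap (tmap (P r) (@id V)) (@id M)) by exact: tmap_linear.
pose F r a b := tmap (tmap (P r) id) id (tmap ((voc_ups X)^~ a) id (ups m b)).
pose G r e' := fmul (twist_factor R (r%:R / T%:R)) (in_vars z0 z2 (F r)) e'.
have finG r : fmul_finite (fdelta z2 z1 z0 (-1) 1) (G r) e.
  apply: iter_side_fin => c c'; have [N hN] := upper0_ev c' (uu m); exists N => i /hN.
  by rewrite /F => ->; rewrite (linear_fun0 (tmap_linear (lups _) _)) // (linear_fun0 (lPPM _)).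
have pF r a b : (r < T)%N -> tforml (tpair u v) (F r a b) =
    if r == s then Rm (voa_Y D u v a) (- b - 1) m else 0.
  move=> rT; have lpP : linear (fun x => tpair u v (tmap (P r) id x) : C^o).
    by move=> c x y; rewrite lPP lp.
  rewrite /F tforml_tmap // tforml_tmap //.
  have E y : tpair u v (tmap (P r) id y) = if r == s then tpair u v y else 0.
    elim/tensor_ind: y => [|y z IH IH'|x x'].
    - by rewrite (linear_fun0 (lPP r)) !(linear_fun0 lp) if_same.
    - rewrite (linear_funD _ _ (lPP r)) !(linear_funD _ _ lp) IH IH'.
      by case: ifP; rewrite ?addr0.
    rewrite tmap_pt // !tpair_pt // (class_proj x rT sT us).
    by case: ifP; rewrite ?mul0r.
  rewrite /right_modes; have -> : - (- b - 1) - 1 = b by ring.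
  have -> : (fun x => tpair u v (tmap (P r) id (voc_ups X x a))) =
    (if r == s then (voa_Y D u v a : V') : V -> C^o else fun=> 0).
    by apply/funext => x; rewrite E; case: ifP => // _; rewrite dual_YE.
  case: ifP => // _.
  have lin0 : linear ((fun=> 0) : V -> C^o) by move=> c x z; rewrite scaler0 addr0.
  exact: tforml0.
have pFE r : (r < T)%N -> (fun a b => tforml (tpair u v) (F r a b)) =
    if r == s then fun a b => Rm (voa_Y D u v a) (- b - 1) m else fun _ _ => 0.
  by move=> rT; apply/funext => a; apply/funext => b; rewrite pF //; case: ifP.
transitivity (fmul (fdelta z2 z1 z0 (-1) 1)
   (fun e' => tforml (tpair u v) (\sum_(r < T) G r e')) e).
  apply: (fmul_linear lt).
  have fin : finite_set (\bigcup_(r in [set: 'I_T])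
      [set d | fdelta z2 z1 z0 (-1) 1 d *: G r (e - d) != 0]).
    by apply: bigcup_finite => // r _; exact: finG.
  apply: sub_finite_set fin => d /=; rewrite scaler_sumr => hd.
  apply: contrapT => no; move/eqP: hd; apply; rewrite big1 // => r _.
  by apply: contrapT => /eqP hr; apply: no; exists r.
congr (fmul _ _ _); apply/funext => e'.
rewrite (linear_sumE _ _ _ lt) (bigD1 (Ordinal sT)) //= big1 ?addr0.
  by rewrite /G (iter_side_linear _ _ _ lt) pFE // eqxx.
move=> r rs; rewrite /G (iter_side_linear _ _ _ lt) pFE // ifF; last first.
  by apply: contraNF rs => /eqP e''; apply/eqP/val_inj.
have -> : in_vars z0 z2 (fun _ _ => 0 : M) = (fun=> 0).
  by apply/funext => d; rewrite /in_vars if_same.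
by rewrite /fmul fsum_zero // => d; rewrite scaler0.
Qed.

(** Pairing with u (x) v for all eigenfunctionals u and all v loses no
    information on V (x) V (x) M. *)
Lemma com_jacobi_modes : (forall m e, com_lhs m e = com_rhs m e) <->
  (forall s u v m e, (s < T)%N -> (forall x, u (g x) = zeta R T s * u x) ->
    mode_jacobi D Rm false (s%:R / T%:R) u v m e).
Proof.
split=> [jac s u v m e sT us|jac m e].
  have := congr1 (tforml (tpair u v)) (jac m e).
  by rewrite pair_lhs (pair_rhs _ _ _ sT us).
apply: (tensor3_eq (X := X)) => u v.
have lin (y : tensor (tensor V V) M) : linear (fun u : V' => tforml (tpair u v) y).
  move=> a u1 u2; rewrite -tforml_form; try exact: tpair_linear.
  by congr tforml; apply/funext => z; rewrite !tpair_tformr.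
rewrite [u]dual_proj_sum !(linear_sumE _ _ _ (lin _)); apply: eq_bigr => r _.
rewrite pair_lhs (pair_rhs _ _ _ (ltn_ord r) (dual_proj_eigen r u)).
exact: jac (ltn_ord r) (dual_proj_eigen r u).
Qed.

End Pairing.

End Modes.
End Aut.

Section Equivalence.
Variable R : realType.
Local Notation C := R[i].
Variables (V : lmodType C) (X : gvoc V) (g : voc_aut X) (T : nat).
Hypothesis hT : has_order g T.
Local Notation gr := (voc_gr X).
Local Notation V' := (rdual gr).
Local Notation D := (dual_voa X).
Local Notation h := (dual_aut g).
Local Notation P := (eigenproj g T).
Local Notation cls := (dual_class g T).
Implicit Types (f u v : V').

Let hX := dual_is_voa X.
Let lf f := rdual_linear f.
Let lg : linear g := linearP g.
Let T0 := aut_order_gt0 hT.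

(** With E the classes of functionals and b = false, these are the contracted
    modes of twisted V-comodules; with the classes negated and b = true, the
    modes of twisted V'-modules. *)
Definition is_modes (b : bool) (E : rat -> set V') (M : lmodType C) (m : V' -> rat -> M -> M) :=
  [/\ mode_bilinear m, mode_trunc b m, mode_support E m, mode_borcherds D b E m
    & forall t x, m (voa_vac D) t x = if t == -1 then x else 0].

Lemma contra_is_modes b (E : rat -> set V') (M : lmodType C) (m : V' -> rat -> M -> M) :
  (forall a c u, E a u -> E a (c *: u)) ->
  (forall a s u, E a u -> E a (component (voa_gr D) s u)) ->
  (forall a n u, E a u -> E a (voa_L D n u)) ->
  is_modes b E m -> is_modes (~~ b) (fun a => E (- a)) (contra_modes D m).
Proof.
move=> EZ Ec EL [mb mt ms mB mv]; split.
- exact: contra_bilinear.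
- exact: contra_trunc.
- by apply: contra_supp => // a u; exact: EL.
- by apply: contra_borcherds => // a u; exact: EL.
- exact: contra_vac.
Qed.

Lemma dual_classZ a (c : C) u : cls a u -> cls a (c *: u).
Proof.
move=> [r [rT ur ar]]; exists r; split => // x.
by rewrite !(linear_funZ _ _ (rdual_eval _)) ur; exact: mulrCA.
Qed.

Section ToModes.
Variables (M : lmodType C) (W : twisted_comodule g T M).
Local Notation ups := (com_ups W).
Local Notation Rm := (right_modes ups).

Lemma com_ups_linear e : linear (ups^~ e).
Proof. by apply: tw_linear => // k; exact: linearP. Qed.

Lemma com_ups_upper0 x : upper0 (ups x).
Proof. by apply: tw_upper0 => //; exact: com_trunc. Qed.

Lemma com_modes_class f s (k : int) x : (s < T)%N -> (forall x, f (g x) = zeta R T s * f x) ->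
  Rm f (k%:~R + s%:R / T%:R) x = tforml f (com_delta W k x).
Proof.
move=> sT fs; rewrite /right_modes.
have -> : - (k%:~R + s%:R / T%:R) - 1 = - k%:~R - 1 - s%:R / T%:R :> rat by ring.
by rewrite [LHS](tw_pair hT _ _ _ sT fs) shifted_field_int.
Qed.

Lemma com_modes_support : mode_support cls Rm.
Proof.
move=> a f t x [s [sT fs as_]] ta; rewrite [LHS](tw_pair hT _ _ _ sT fs).
rewrite shifted_field_nint // => -[k ek]; apply: ta; have [l el] := as_.
by exists (- k - 1 - l); rewrite !intrB mulrNz -ek -el; ring.
Qed.

Lemma com_is_modes : is_modes false cls Rm.
Proof.
have ul := com_ups_linear; have uu := com_ups_upper0.
have rb := right_modes_bilinear X ul; have rt := right_modes_trunc (X := X) uu.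
split=> //; first exact: com_modes_support.
  have [/(_ (com_jacobi W)) jac _] := com_jacobi_modes hT ul uu.
  move=> a u v p q n x [s [sT us as_]] pa.
  apply: (jacobi_mode_borcherds hX rb rt (fun e => jac s u v x e sT us)).
  have [[k ek] [l el]] := (pa, as_).
  by exists (k + l); rewrite intrD -ek -el; ring.
move=> t x; rewrite /right_modes dual_vacE com_counit /fmon.
by congr (if _ then _ else _); apply/eqP/eqP => e; lra.
Qed.

Variable grM : rat -> set M.
Hypothesis adm : admissible_comodule W grM.

(** Decomposing f into eigenfunctionals F makes the mode a contraction of some
    Delta_k(x), whose terms v (x) m' contribute only when the weight and the
    eigenvalue of v match those of F. *)
Lemma com_right_graded : right_graded D grM Rm.
Proof.
have [dM _ Dgr] := adm; have [rb _ sup _ _] := com_is_modes.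
move=> w f s t x fw xt; rewrite /right_modes (tforml_decomp hT).
apply: subspace_big => [|r]; first exact: (gr_subspace dM).
have Fr := dual_proj_eigen hT r f; have Fw := dual_proj_gr g T r fw.
move: (dual_proj g T r f) Fr Fw => F Fr Fw; rewrite -/(right_modes ups F s x).
have [[k ek]|ns] := pselect (is_int (s - r%:R / T%:R)); last first.
  rewrite (sup (r%:R / T%:R)) //; first by case: (gr_subspace dM (t + s + 1 - w%:~R)).
  by exists r; split=> //; exists 0; rewrite subrr.
have -> : s = k%:~R + r%:R / T%:R by rewrite -ek subrK.
rewrite (com_modes_class _ _ (ltn_ord r) Fr).
have sM := gr_subspace dM (t + (k%:~R + r%:R / T%:R) + 1 - w%:~R).
have ltF := tforml_linear (W := M) (lf F).
apply: (span_min (S := [set y | grM _ (tforml F y)]) _ _ (Dgr k t x xt)).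
  split; first by rewrite /= (linear_fun0 ltF); case: sM.
  by move=> a y z /= hy hz; rewrite ltF; case: sM => _; exact.
move=> _ [r' [a [v [m' [rT' vr va m'g ->]]]]] /=; rewrite tforml_pt //.
have [e1|ne] := eqVneq (F v) 0; first by rewrite e1 scale0r; case: sM.
apply: (subspaceZ _ sM).
have rr : r' = r.
  apply/(@zeta_inj R T _ _ rT' (ltn_ord r)); apply/eqP; rewrite -subr_eq0.
  have := Fr v; rewrite vr (linear_funZ _ _ (lf F)).
  move/eqP; rewrite -[X in X == _]/(zeta R T r' * F v) -subr_eq0 -mulrBl mulf_eq0.
  by rewrite (negbTE ne) orbF.
have aw : a = w.
  by apply: contraNeq ne => aw; apply/eqP; exact: (Fw a v aw va).
by have -> : t + (k%:~R + r%:R / T%:R) + 1 - w%:~R = t + k%:~R + 1 + r'%:R / T%:R - a%:~R;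
  [rewrite aw rr; ring|].
Qed.

Lemma com_sub_modes (S : set M) : is_subspace S ->
  (forall k x, S x -> tensor_sub (V := V) S (com_delta W k x)) <->
  (forall f t x, S x -> S (Rm f t x)).
Proof.
move=> sS; have [rb _ sup _ _] := com_is_modes; split=> [hS f t x Sx|hS k x Sx].
  rewrite /right_modes (tforml_decomp hT); apply: subspace_big => // r.
  have Fr := dual_proj_eigen hT r f.
  move: (dual_proj g T r f) Fr => F Fr; rewrite -/(right_modes ups F t x).
  have [[k ek]|ns] := pselect (is_int (t - r%:R / T%:R)); last first.
    rewrite (sup (r%:R / T%:R)) //; first by case: sS.
    by exists r; split=> //; exists 0; rewrite subrr.
  have -> : t = k%:~R + r%:R / T%:R by rewrite -ek subrK.
  rewrite (com_modes_class _ _ (ltn_ord r) Fr).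
  by have /(tensor_sub_dual X _ sS) := hS k x Sx; exact.
apply/(tensor_sub_dual X _ sS) => f; rewrite (tforml_decomp hT).
apply: subspace_big => // r; have Fr := dual_proj_eigen hT r f.
by rewrite -(com_modes_class _ _ (ltn_ord r) Fr); exact: hS.
Qed.

End ToModes.
(** * Comodules from families of modes *)
Section FromModes.
Variables (M : lmodType C) (Rm : V' -> rat -> M -> M) (grM : rat -> set M).
Hypothesis md : is_modes false cls Rm.
Hypotheses (dM : direct_sum grM) (posM : forall t, ~ in_fracN T t -> grM t = [set 0])
  (grd : right_graded D grM Rm).

Let rb : mode_bilinear Rm. Proof. by case: md. Qed.
Let rs : mode_support cls Rm. Proof. by case: md. Qed.

Lemma grM_neg t x : t < 0 -> grM t x -> x = 0.
Proof.
move=> t0; rewrite posM // => -[n e]; move: t0; rewrite e ltNge.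
by rewrite divr_ge0 ?ler0n.
Qed.

Lemma rat_int_gt (a : rat) : exists n : int, a < n%:~R.
Proof. by have [N h] := rat_bound a; exists N; rewrite -pmulrn h. Qed.

Lemma frac_lt1 (r : 'I_T) : (0 <= r%:R / T%:R :> rat) && (r%:R / T%:R < 1 :> rat).
Proof.
rewrite divr_ge0 ?ler0n //= ltr_pdivrMr ?ltr0n // mul1r ltr_nat.
exact: ltn_ord.
Qed.

(** On a vector of degree t, functionals of weight w > t + k + 2 lower the degree
    below zero. *)
Lemma modes_weight_bound (k : int) x : exists w1 : int, forall w f (r : 'I_T), w1 < w ->
  rdual_gr w f -> Rm f (k%:~R + r%:R / T%:R) x = 0.
Proof.
elim/(graded_ind dM): x => [|x y [w1 h1] [w2 h2]|t x xt].
- by exists 0 => w f r _ _; rewrite (m0r rb).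
- exists (Num.max w1 w2) => w f r; rewrite gt_max => /andP[l1 l2] fw.
  by rewrite (mDr rb) (h1 w) // (h2 w) // addr0.
have [w1 hw] := rat_int_gt (t + k%:~R + 2); exists w1 => w f r lt fw.
apply: (grM_neg _ (grd _ fw xt)); have /andP[_ r1] := frac_lt1 r.
by move: lt; rewrite -(ltr_int rat); lra.
Qed.

Lemma modes_lower_bound x : exists k0 : int, forall (k : int) f (r : 'I_T), k < k0 ->
  Rm f (k%:~R + r%:R / T%:R) x = 0.
Proof.
have [w0 low] := dual_bounded X.
elim/(graded_ind dM): x => [|x y [k1 h1] [k2 h2]|t x xt].
- by exists 0 => k f r _; rewrite (m0r rb).
- exists (Num.min k1 k2) => k f r; rewrite lt_min => /andP[l1 l2].
  by rewrite (mDr rb) h1 // h2 // addr0.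
have [n hn] := rat_int_gt (t + 2 - w0%:~R); exists (- n) => k f r lt.
elim/(graded_ind (dual_direct X)): f => [|f f' IH IH'|w f fw].
- by rewrite (m0l rb).
- by rewrite (mDl rb) IH IH' addr0.
have [ww|ww] := ltP w w0; first by move: fw; rewrite low //= => ->; rewrite (m0l rb).
apply: (grM_neg _ (grd _ fw xt)); have /andP[_ r1] := frac_lt1 r.
by move: lt ww; rewrite -(ltr_int rat) -(ler_int rat) mulrNz; lra.
Qed.

(** All r are summed because functionals of class r/T see only the index
    k + r/T. *)
Lemma modes_delta_ex (k : int) x : exists y : tensor V M,
  forall f, tforml f y = \sum_(r < T) Rm f (k%:~R + r%:R / T%:R) x.
Proof.
have [w0 low] := dual_bounded X; have [w1 high] := modes_weight_bound k x.
pose s := [seq w0 + i%:Z | i <- iota 0 (`|w1 - w0|.+1)%N].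
apply: (tensor_of (s := s)).
- move=> a f f'; rewrite scaler_sumr -big_split; apply: eq_bigr => r _ /=.
  by rewrite (mDl rb) (mZl rb).
- rewrite map_inj_uniq ?iota_uniq // => i j /addrI; exact: (congr1 absz).
- move=> w f ws fw; rewrite big1 // => r _.
  have [ww|ww] := ltP w w0; first by move: fw; rewrite low //= => ->; rewrite (m0l rb).
  apply: (high w) => //; rewrite ltNge; apply: contra ws => le.
  by apply/mapP; exists `|w - w0|%N; rewrite ?mem_iota; lia.
Qed.

Definition modes_delta_fun k x := projT1 (cid (modes_delta_ex k x)).

Lemma modes_delta_pair k x f :
  tforml f (modes_delta_fun k x) = \sum_(r < T) Rm f (k%:~R + r%:R / T%:R) x.
Proof. by rewrite /modes_delta_fun; case: (cid _) => /= y; exact. Qed.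

Lemma modes_delta_linear k : linear (modes_delta_fun k).
Proof.
move=> a x y; apply: (tensor_eq (X := X)) => f.
rewrite (tforml_linear (lf f)) !modes_delta_pair scaler_sumr -big_split.
by apply: eq_bigr => r _; rewrite (mDr rb) (mZr rb).
Qed.

Definition modes_delta k : {linear M -> tensor V M} :=
  HB.pack (modes_delta_fun k) (GRing.isLinear.Build _ _ _ _ _ (modes_delta_linear k)).

Local Notation ups := (twisted_field_of g T modes_delta).

Lemma modes_delta_class f s (k : int) x : (s < T)%N ->
  (forall x, f (g x) = zeta R T s * f x) ->
  tforml f (modes_delta k x) = Rm f (k%:~R + s%:R / T%:R) x.
Proof.
move=> sT fs; rewrite modes_delta_pair (bigD1 (Ordinal sT)) //= big1 ?addr0 // => r ne.
have cf : cls (s%:R / T%:R) f by exists s; split => //; exists 0; rewrite subrr.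
apply: (rs _ cf) => ti; move: ne => /eqP; apply; apply: val_inj => /=.
apply: (frac_uniq hT (a := s%:R / T%:R) (ltn_ord r) sT); last by exists 0; rewrite subrr.
by have [l el] := ti; exists (k - l); rewrite intrB -el; ring.
Qed.

Lemma modes_ups f t x : right_modes ups f t x = Rm f t x.
Proof.
rewrite /right_modes (tforml_decomp hT) [in RHS](dual_proj_sum hT f) (m_suml rb).
apply: eq_bigr => r _; have Fr := dual_proj_eigen hT r f; have Fc := dual_proj_class hT r f.
move: (dual_proj g T r f) Fr Fc => F Fr Fc.
rewrite (tw_pair hT _ _ _ (ltn_ord r) Fr).
have [[k ek]|ns] := pselect (is_int (t - r%:R / T%:R)); last first.
  rewrite (rs _ Fc ns) shifted_field_nint // => -[k ek]; apply: ns.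
  by exists (- k - 1); rewrite intrB mulrNz -ek; ring.
have -> : - t - 1 = - k%:~R - 1 - r%:R / T%:R :> rat by rewrite -ek; ring.
rewrite shifted_field_int (modes_delta_class _ _ (ltn_ord r) Fr).
by congr (Rm F _ x); rewrite -ek subrK.
Qed.

Lemma modes_tforml f e x : tforml f (ups x e) = Rm f (- e - 1) x.
Proof. by rewrite tforml_ups modes_ups. Qed.

Lemma modes_ups_linear e : linear (ups^~ e).
Proof. by apply: tw_linear => // k; exact: linearP. Qed.

Lemma modes_com_trunc x : exists k0, forall k, k < k0 -> modes_delta k x = 0.
Proof.
have [k0 hk] := modes_lower_bound x; exists k0 => k /hk z.
apply: (tensor_eq (X := X)) => f; rewrite [LHS]modes_delta_pair.
by rewrite (linear_fun0 (tforml_linear (lf f))) big1.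
Qed.

Lemma modes_derivative f t x : Rm (voa_L D (-1) f) t x = - ratr t *: Rm f (t - 1) x.
Proof.
have [_ _ _ bo va] := md.
rewrite (dual_proj_sum hT f) (linear_sumE _ _ _ (L_linear hX (-1))) !(m_suml rb) scaler_sumr.
apply: eq_bigr => r _.
apply: (mode_derivative hX rb rs bo va _ _ _ (dual_proj_class hT r f)).
by move=> a n u; exact: dual_class_L.
Qed.

Lemma modes_com_L k x : tforml (voc_rho X) (ups x (k%:~R - 2)) = Rm (voa_conf D) (1 - k)%:~R x.
Proof.
rewrite -dual_confE modes_tforml; congr (Rm _ _ x).
by rewrite intrB; ring.
Qed.

Lemma modes_com_virasoro :
  virasoro (fun (k : int) x => tforml (voc_rho X) (ups x (k%:~R - 2))) (voc_rank X).
Proof.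
have [_ _ _ bo va] := md; move=> k j x; rewrite !modes_com_L.
have cl a n u : cls a u -> cls a (voa_L D n u) by exact: dual_class_L.
have := mode_virasoro hX rb rs bo va cl (dual_class_conf hT) (1 - j) (1 - k) x.
rewrite /comp_modes => ->.
have -> : (1 - j) - (1 - k) = k - j by ring.
have -> : (1 - j) + (1 - k) - 1 = 1 - (k + j) by ring.
have -> : ((1 - j) + (1 - k) == 2) = (k + j == 0).
  by apply/eqP/eqP => e; lia.
congr (_ + _); case: eqP => // /eqP; rewrite addr_eq0 => /eqP ->.
by congr ((_ %:~R / _ * _) *: _); ring.
Qed.

Lemma modes_com_L1 x e :
  tmap (voc_L X 1) id (ups x e) = fderiv (ups x) e.
Proof.
apply: (tensor_eq (X := X)) => f; rewrite tforml_tmap //; last exact: voc_L_linear.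
have -> : (fun y => f (voc_L X 1 y)) = (voa_L D (-1) f : V') :> (V -> C^o).
  by apply/funext => y; rewrite dual_LE opprK.
rewrite /fderiv (linear_funZ _ _ (tforml_linear (lf f))) !modes_tforml modes_derivative.
congr (_ *: Rm _ _ x); last by ring.
by rewrite -rmorphN; congr ratr; ring.
Qed.

(** The commutator of omega_0 = L(-1) of V' with f. *)
Lemma modes_com_L1M x e :
  fderiv (ups x) e =
  ups (tforml (voc_rho X) (ups x (1 - 2))) e
  - tmap id (fun y => tforml (voc_rho X) (ups y (1 - 2))) (ups x e).
Proof.
have [_ _ _ bo _] := md; have lup := modes_ups_linear.
have llr := tforml_linear (W := M) (linearP (voc_rho X)).
have lL : linear (fun y => tforml (voc_rho X) (ups y (1 - 2))).
  by move=> a y z; rewrite lup llr.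
have E y : tforml (voc_rho X) (ups y (1 - 2)) = Rm (voa_conf D) 0 y.
  by rewrite -[1 - 2]/(1%:~R - 2) modes_com_L subrr.
apply: (tensor_eq (X := X)) => f; have ltf := tforml_linear (W := M) (lf f).
rewrite (linear_funB _ _ ltf) tforml_tmapr // !E !modes_tforml.
rewrite /fderiv (linear_funZ _ _ ltf) modes_tforml.
have := mode_commutator bo f (- e - 1) x (dual_class_conf hT) (ex_intro _ 0 erefl).
rewrite /comp_modes => <-; rewrite natsum1 => [|i i0]; last first.
  by rewrite (@gbinom_nat0 C 0 i) // scale0r.
rewrite gbinom0 scale1r -[voa_mode D _ _ f]/(voa_L D (-1) f) modes_derivative.
congr (_ *: Rm _ _ x); last by rewrite add0r subr0; ring.
by rewrite -rmorphN; congr ratr; rewrite add0r subr0; ring.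
Qed.

Lemma modes_com_counit x e : tforml (voc_c X) (ups x e) = fmon 0 x e.
Proof.
have [_ _ _ _ va] := md; rewrite -dual_vacE modes_tforml va /fmon.
by congr (if _ then _ else _); apply/eqP/eqP => h'; lra.
Qed.

Lemma modes_com_jacobi x e : com_lhs ups x e = com_rhs g T ups x e.
Proof.
have [_ tr _ bo _] := md; have uu y : upper0 (ups y).
  by apply: tw_upper0 => //; exact: modes_com_trunc.
have [_] := com_jacobi_modes hT modes_ups_linear uu; apply => s u v m e' sT us.
have -> : right_modes ups = Rm.
  by apply/funext => f; apply/funext => t; apply/funext => y; exact: modes_ups.
have cu : cls (s%:R / T%:R) u by exists s; split => //; exists 0; rewrite subrr.
apply: (mode_borcherds_jacobi hX rb tr rs cu) => p q n pa.
exact: bo cu pa.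
Qed.

Definition modes_comodule : twisted_comodule g T M :=
  @TwistedComodule R V X g T M modes_delta modes_com_trunc modes_com_counit
    modes_com_jacobi modes_com_virasoro modes_com_L1 modes_com_L1M.

(** Expanding the part of Delta_k(x) in V^(r) (x) M over dual bases, the second
    tensor factors are modes of x, and their degrees are known. *)
Lemma modes_comodule_adm : admissible_comodule modes_comodule grM.
Proof.
split => // k t x xt.
have -> : com_delta modes_comodule k x = \sum_(r < T) tmap (P r) id (modes_delta k x).
  apply: (tensor_eq (X := X)) => f; have ltf := tforml_linear (W := M) (lf f).
  rewrite (linear_sumE _ _ _ ltf) (tforml_decomp hT).
  apply: eq_bigr => r _; rewrite tforml_tmap //; exact: eigenproj_linear.
have sS := span_subspace.
apply: subspace_big => [|r]; first exact: sS.
set y := tmap _ _ _.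
have projE f (w : tensor V M) :
    tforml f (tmap (P r) id w) = tforml (dual_proj g T r f) w.
  by rewrite tforml_tmap //; exact: eigenproj_linear.
have yP : y = tmap (P r) id y.
  apply: (tensor_eq (X := X)) => f; rewrite /y !projE.
  suff -> : dual_proj g T r (dual_proj g T r f) = dual_proj g T r f by [].
  apply: rdual_ext => z; have := dual_proj_eigen hT r f.
  move/(class_proj hT (r := r) z (ltn_ord r) (ltn_ord r)).
  by rewrite eqxx.
rewrite yP; have lm : linear (tmap (P r) (@id M)).
  by apply: tmap_linear => //; exact: eigenproj_linear.
have [s _ ->] := tensor_expand1 X y; rewrite (linear_sumE _ _ _ lm).
apply: subspace_big => [|i]; first exact: sS.
rewrite (linear_sumE _ _ _ lm); apply: subspace_big => [|l]; first exact: sS.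
rewrite tmap_pt //; last exact: eigenproj_linear.
have [bi ci _] := dual_basisP X i; apply: span_gen.
exists r, i, (P r (dual_vec l)), (tforml (dual_cov l) y); split => //.
- exact: (eigenproj_eigen lg T0 (aut_order_iter hT)).
- by apply: eigenproj_gr; exact: bi.
rewrite /y projE (modes_delta_class _ _ (ltn_ord r) (dual_proj_eigen hT r _)).
have := grd (k%:~R + r%:R / T%:R) (dual_proj_gr g T r (ci l)) xt.
by have -> : t + (k%:~R + r%:R / T%:R) + 1 - i%:~R = t + k%:~R + 1 + r%:R / T%:R - i%:~R
  by ring.
Qed.

End FromModes.

(** * Twisted modules *)

Section Modules.
Variables (M : lmodType C).

Lemma tm_is_modes (W : twisted_module D h T M) :
  is_modes true (fun a => cls (- a)) (tm_mode W).
Proof.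
have mb : mode_bilinear (tm_mode W) := tm_bilinear W.
have mt : mode_trunc true (tm_mode W) := tm_trunc W.
split => //.
- move=> a f t x /(class_eigen hT)[r [rT fr ar]] ta.
  apply: tm_support rT fr _ => k; apply/eqP => tk; apply: ta.
  by have [l el] := ar; exists (k - l); rewrite tk intrB -el; ring.
- move=> a u v p q n x /(class_eigen hT)[r [rT ur ar]] pa.
  apply: (jacobi_mode_borcherds hX mb mt (fun e => tm_jacobi W v x e rT ur)).
  by have [[k ek] [l el]] := (pa, ar); exists (k + l); rewrite intrD -ek -el; ring.
- move=> t x; have := tm_vacuum W x (- t - 1).
  have -> : tm_Y W (voa_vac D) x (- t - 1) = tm_mode W (voa_vac D) t x.
    by rewrite /tm_Y; congr (tm_mode _ _ _ _); ring.
  by move=> ->; rewrite /fmon; congr (if _ then _ else _); apply/eqP/eqP => e; lra.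
Qed.

Lemma modes_tm (m : V' -> rat -> M -> M) : is_modes true (fun a => cls (- a)) m ->
  exists W : twisted_module D h T M, tm_mode W = m.
Proof.
move=> [mb mt ms mB mv].
have sup r u t n : (r < T)%N -> eigenpart h T r u ->
    (forall k : int, t != k%:~R + r%:R / T%:R) -> m u t n = 0.
  move=> rT ur nt; apply: (ms _ _ _ _ (eigen_class hT rT ur)) => -[k ek].
  by have /eqP[] := nt k; rewrite -ek subrK.
have vac n e : m (voa_vac D) (- e - 1) n = fmon 0 n e.
  by rewrite mv /fmon; congr (if _ then _ else _); apply/eqP/eqP => e'; lra.
have jac r u v n e : (r < T)%N -> eigenpart h T r u ->
    mode_jacobi D m true (r%:R / T%:R) u v n e.
  move=> rT ur; have cu := eigen_class hT rT ur.
  apply: (mode_borcherds_jacobi hX mb mt ms cu) => p q k pa.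
  exact: mB cu pa.
by exists (@TwistedModule R V' D h T M m mb sup mt vac jac).
Qed.

End Modules.

Lemma opp_class : (fun a => cls (- - a)) = cls.
Proof. by apply/funext => a; rewrite opprK. Qed.

(** Both structures live on the same graded space and have the same invariant
    graded subspaces, so that complete reducibility is literally shared; that
    invariance transfers in both directions uses that the contragredient is an
    involution. *)
Lemma rational_corational : rational_voa D h T -> corational g T.
Proof.
move=> [_ _ _ rat_] M W grM adm; have [dM posM _] := adm.
have md := com_is_modes W.
have clsZ a (c : C) u : cls a u -> cls a (c *: u) by exact: dual_classZ.
have [|m ml] := modes_tm (m := contra_modes D (right_modes (com_ups W))) (M := M).
  apply: (contra_is_modes (b := false)) md => //; first exact: dual_class_component.
  by move=> a n u; exact: dual_class_L.
have [rb _ _ _ _] := md.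
have admm : admissible_module m grM.
  split => // w u s t x uw xt; rewrite ml.
  exact: (contra_left_graded hX rb dM (com_right_graded adm) s uw xt).
suff -> : admissible_subcomodule W grM = admissible_submodule m grM by exact: rat_.
apply/funext => S; apply/propext; split=> -[gS hS]; split => //; have [sS _] := gS.
  by rewrite ml; apply: (contra_stable hX rb sS); apply/(com_sub_modes W sS).
apply/(com_sub_modes W sS) => f t x Sx; rewrite -(contraK hX _ _ _ rb).
rewrite ml in hS; apply: (contra_stable hX _ sS) => //.
exact: contra_bilinear.
Qed.

Lemma corational_rational : corational g T -> rational_voa D h T.
Proof.
move=> cor; split; [exact: hX | exact: (dual_is_aut hT) | exact: (dual_aut_order hT) |].
move=> M m grM adm; have [dM posM gm] := adm.
have md := tm_is_modes m; have [mb _ _ _ _] := md.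
pose Rm := contra_modes D (tm_mode m).
have mdR : is_modes false cls Rm.
  rewrite -opp_class; apply: (contra_is_modes (b := true) (E := fun a => cls (- a))) md.
  - by move=> a c u; exact: dual_classZ.
  - by move=> a s u; exact: dual_class_component.
  - by move=> a n u; exact: dual_class_L.
have grd : right_graded D grM Rm by apply: contra_right_graded.
pose W := modes_comodule mdR dM posM grd.
have Wm : right_modes (com_ups W) = Rm.
  apply/funext => f; apply/funext => t; apply/funext => x.
  exact: (modes_ups mdR dM posM grd).
have [rb _ _ _ _] := mdR.
suff -> : admissible_submodule m grM = admissible_subcomodule W grM.
  by apply: cor; exact: modes_comodule_adm.
apply/funext => S; apply/propext; split=> -[gS hS]; split => //; have [sS _] := gS.
  by apply/(com_sub_modes W sS); rewrite Wm; apply: contra_stable.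
move/(com_sub_modes W sS): hS; rewrite Wm => hS f t x Sx.
rewrite -(contraK hX _ _ _ mb).
exact: (contra_stable hX rb sS).
Qed.

End Equivalence.

Theorem theorem7p13 (R : realType) (V : lmodType R[i]) (X : gvoc V)
    (g : voc_aut X) (T : nat)
    (hc : ~ (voc_gr X 0 `<=` [set v | voc_c X v = 0]))
    (hrho : ~ (voc_gr X 2 `<=` [set v | voc_rho X v = 0]))
    (hT : has_order g T)
    (hA : forall l i : nat, (i < T)%N ->
        zhu_finite (dual_voa X) (dual_aut g) T l i) :
  corational g T <-> rational_voa (dual_voa X) (dual_aut g) T.
Proof.
split; [exact: corational_rational | exact: rational_corational].
Qed.
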